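(* Let $d\ge1$, $\eta>(d-1)/2$ and $\omega_{d,\eta}>0$, and put $c_{d,\eta}=\omega_{d,\eta}\Gamma(\eta d)/\Gamma_d(\eta)$. There exists a homogeneous Gamma matrix distribution $\Gamma_{\mathbb{S}_d^+}(\alpha_\eta,\beta)$ with respect to the trace norm, concentrated on the open cone $\mathbb{S}_d^+$, where $\beta(U)=1$ for each $U\in\mathbf{S}^+_{\|\cdot\|}$ and $\alpha_\eta$ is the measure on $\mathbf{S}^+_{\|\cdot\|}$ given by $$\alpha_\eta(\mathrm{d}U)=c_{d,\eta}|U|^\eta\frac{\mathrm{d}U}{|U|^{(d+1)/2}},\qquad\text{with}\quad \alpha_\eta(\mathbf{S}^+_{\|\cdot\|})=\omega_{d,\eta}.$$ Moreover, the Lévy measure of $\Gamma_{\mathbb{S}_d^+}(\alpha_\eta,\beta)$ is $\rho_\eta(\mathrm{d}X)=g_\eta(X)\mathrm{d}X$ on $\mathbb{S}_d^+$, where $$g_\eta(X)=c_{d,\eta}\frac{e^{-\mathrm{tr}(X)}}{(\mathrm{tr}(X))^{\eta d}}|X|^{\eta-(d+1)/2},\quad X>0,$$ and it has the polar decomposition $$\rho_\eta(E)=\int_E g_\eta(X)\mathrm{d}X=c_{d,\eta}\int_{\mathbf{S}^+_{\|\cdot\|}}\int_0^\infty1_E(rU)\frac{e^{-r}}{r}\,\mathrm{d}r\,\frac{|U|^\eta\,\mathrm{d}U}{|U|^{(d+1)/2}},\quad E\in\mathcal{B}(\overline{\mathbb{S}}_d^+).$$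
   Context: $\mathbb{S}_d^+$ and $\overline{\mathbb{S}}_d^+$ are the open cone of positive definite and the closed cone of nonnegative definite symmetric real $d\times d$ matrices; $X>0$ means $X\in\mathbb{S}_d^+$; $|X|$ is the determinant. The trace norm is $\|X\|=\mathrm{tr}((X^\top X)^{1/2})$, so $\|X\|=\mathrm{tr}(X)$ on $\overline{\mathbb{S}}_d^+$, and $\mathbf{S}^+_{\|\cdot\|}=\{U\in\overline{\mathbb{S}}_d^+:\mathrm{tr}(U)=1\}$. $\mathrm{d}X$ is Lebesgue measure on symmetric matrices identified with $\mathbb{R}^{d(d+1)/2}$, and $\mathrm{d}U$ is the measure on $\mathbf{S}^+_{\|\cdot\|}$ determined by $\mathrm{d}X=r^{d(d+1)/2-1}\,\mathrm{d}r\,\mathrm{d}U$ under $X=rU$, $r=\mathrm{tr}(X)$, $\mathrm{tr}(U)=1$, $X>0$ (it is concentrated on $U>0$). The multivariate Gamma function is $\Gamma_d(\eta)=\int_{X>0}e^{-\mathrm{tr}(X)}|X|^{\eta-(d+1)/2}\mathrm{d}X$ for $\eta>(d-1)/2$; $\Gamma$ is the usual Gamma function. For a finite measure $\alpha$ on $\mathbf{S}^+_{\|\cdot\|}$ and measurable $\beta:\mathbf{S}^+_{\|\cdot\|}\to[0,\infty)$, the matrix Gamma distribution with parameters $\alpha,\beta$ is the infinitely divisible distribution on $\overline{\mathbb{S}}_d^+$ with Laplace transform $\exp\{-\int_{\mathbf{S}^+_{\|\cdot\|}}\int_0^\infty(1-e^{-r\,\mathrm{tr}(\Theta U)})\frac{e^{-\beta(U)r}}{r}\,\mathrm{d}r\,\alpha(\mathrm{d}U)\}$,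 $\Theta\in\overline{\mathbb{S}}_d^+$; its Lévy measure is $E\mapsto\int\int_0^\infty1_E(rU)\frac{e^{-\beta(U)r}}{r}\,\mathrm{d}r\,\alpha(\mathrm{d}U)$. It is called homogeneous if $\beta$ is constant. *)

(* Defs.v *)
From HB Require Import structures.
From mathcomp Require Import all_boot all_order all_algebra.
From mathcomp Require Import all_classical all_reals all_analysis.
From mathcomp Require Import zify.

Set Implicit Arguments.
Unset Strict Implicit.
Unset Printing Implicit Defensive.

Import Order.TTheory GRing.Theory Num.Theory.
Import numFieldNormedType.Exports.

Local Open Scope classical_set_scope.
Local Open Scope ring_scope.

Fact mx_display : measure_display. Proof. exact. Qed.

(* Matrices carry their Borel sigma-algebra. *)
Section matrix_borel.
Context (R : realType) (m n : nat).

HB.instance Definition _ := @isMeasurable.Build mx_display 'M[R]_(m, n)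
  <<s @open 'M[R]_(m, n) >> (@sigma_algebra0 _ setT _) (@sigma_algebraC _ _)
  (@sigma_algebra_bigcup _ setT _).

Lemma measurable_mxE : measurable = <<s @open 'M[R]_(m, n) >>.
Proof. by []. Qed.

Lemma mx_ball_rat (A : set 'M[R]_(m, n)) : open A ->
  A = \bigcup_(Qq in [set Qq : 'M[rat]_(m, n) * rat |
        ball (map_mx ratr Qq.1 : 'M[R]_(m, n)) (ratr Qq.2) `<=` A])
      ball (map_mx ratr Qq.1 : 'M[R]_(m, n)) (ratr Qq.2).
Proof.
move=> oA; apply/seteqP; split => [M AM|M [Qq /= QqA QqM]]; last exact: QqA.
have /nbhs_ballP[e /= e0 eA] : nbhs M A by move: oA; rewrite openE; exact.
have [q] := rat_in_itvoo (divr_gt0 e0 (@ltr0n R 2)).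
rewrite in_itv/= => /andP[q0 qe].
have hQ i j : exists s : rat, M i j < ratr s < M i j + ratr q.
  have h : M i j < M i j + ratr q by rewrite ltrDl.
  by have [s] := rat_in_itvoo h; rewrite in_itv/=; exists s.
pose Q : 'M[rat]_(m, n) := \matrix_(i, j) projT1 (cid (hQ i j)).
have QM : ball (map_mx ratr Q : 'M[R]_(m, n)) (ratr q) M.
  split => // i j; rewrite !mxE; case: cid => s /= /andP[Ms sq].
  rewrite /ball/= gtr0_norm ?subr_gt0//.
  by rewrite ltrBlDl.
exists (Q, q) => //= N QN; apply: eA.
rewrite [e]splitr; apply: ball_triangle.
  apply: (le_ball (ltW qe)); exact: ball_sym QM.
exact: (le_ball (ltW qe)).
Qed.

Lemma measurable_fun_mx d (T : measurableType d) (f : T -> 'M[R]_(m, n)) :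
  (forall i j, measurable_fun setT (fun t => f t i j : measurableTypeR R)) ->
  measurable_fun setT f.
Proof.
move=> mf; apply: (@measurability _ _ _ _ _ _ (@open 'M[R]_(m, n))) => //.
move=> _ [A oA <-]; rewrite setTI (mx_ball_rat oA) preimage_bigcup.
rewrite bigcup_mkcond.
rewrite (_ : \bigcup_i _ = \bigcup_k (if unpickle k is Some Qq then
    (if Qq \in [set Qq : 'M[rat]_(m, n) * rat |
        ball (map_mx ratr Qq.1 : 'M[R]_(m, n)) (ratr Qq.2) `<=` A] then
      f @^-1` ball (map_mx ratr Qq.1 : 'M[R]_(m, n)) (ratr Qq.2) else set0)
    else set0)); last first.
  apply/seteqP; split => [t [Qq _ ft]|t [k _]].
    by exists (pickle Qq) => //; rewrite pickleK.
  by case: unpickle => // Qq ft; exists Qq.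
apply: bigcupT_measurable => k; case: unpickle => // -[Q q].
case: ifPn => // _ /=.
have [q0|q0] := leP (ratr q : R) 0.
  rewrite (_ : _ @^-1` _ = set0)//; apply/seteqP; split => // t /= [].
  by move=> /lt_le_trans /(_ q0); rewrite ltxx.
rewrite (_ : _ @^-1` _ = \big[setI/setT]_(ij : 'I_m * 'I_n)
    ((fun t => f t ij.1 ij.2 : measurableTypeR R) @^-1`
      ball (ratr (Q ij.1 ij.2) : R) (ratr q))); last first.
  rewrite -bigcap_seq; apply/seteqP; split.
    by move=> t [_ ft] ij _ /=; have := ft ij.1 ij.2; rewrite mxE.
  move=> t ft; split => // i j; rewrite mxE.
  by apply: (ft (i, j)); rewrite /= mem_index_enum.
apply: bigsetI_measurable => ij _; rewrite -[X in measurable X]setTI.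
by apply: mf => //; apply: measurable_realfun.open_measurable; exact: ball_open.
Qed.

End matrix_borel.

Section lebesgue_tuple.
Context {R : realType}.
Let T := measurableTypeR R.

Definition cons_pair n (p : T * n.-tuple T) : n.+1.-tuple T :=
  [tuple of p.1 :: p.2].

Lemma measurable_cons_pair n : measurable_fun setT (@cons_pair n).
Proof. exact: measurable_cons. Qed.

HB.instance Definition _ n := isMeasurableFun.Build _ _ _ _
  (@cons_pair n) (@measurable_cons_pair n).

Section step.
Context n (mu : {sigma_finite_measure set (n.-tuple T) -> \bar R}).

Definition lebesgue_cons : set (n.+1.-tuple T) -> \bar R :=
  pushforward (lebesgue_measure \x mu)%E (@cons_pair n).

Let lebesgue_cons0 : lebesgue_cons set0 = 0%E.
Proof. exact: measure0. Qed.

Let lebesgue_cons_ge0 A : (0 <= lebesgue_cons A)%E.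
Proof. exact: measure_ge0. Qed.

Let lebesgue_cons_sigma_additive : semi_sigma_additive lebesgue_cons.
Proof. exact: (@measure_semi_sigma_additive _ _ _ (pushforward _ _)). Qed.

HB.instance Definition _ := isMeasure.Build _ _ _ lebesgue_cons
  lebesgue_cons0 lebesgue_cons_ge0 lebesgue_cons_sigma_additive.

Let lebesgue_cons_sigma_finite : sigma_finite setT lebesgue_cons.
Proof.
have /sigma_finiteP[F [TF ndF Foo]] :=
  sigma_finiteT (lebesgue_measure : {sigma_finite_measure set T -> \bar R}).
have /sigma_finiteP[G [TG ndG Goo]] := sigma_finiteT mu.
pose g (t : n.+1.-tuple T) : T * n.-tuple T := (thead t, [tuple of behead t]).
have mg : measurable_fun setT g.
  apply/measurable_fun_pairP; split; first exact: measurable_tnth.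
  exact: measurable_behead.
exists (fun k => g @^-1` (F k `*` G k)).
  apply/seteqP; split => // t _.
  have : setT (thead t) by [].
  have : setT ([tuple of behead t] : n.-tuple T) by [].
  rewrite TF TG => -[k _ Gk] [j _ Fj]; exists (maxn j k) => //; split => /=.
    by move: Fj; apply/subsetPset/ndF/leq_maxl.
  by move: Gk; apply/subsetPset/ndG/leq_maxr.
move=> k; have [mF Fk] := Foo k; have [mG Gk] := Goo k; split.
  by rewrite -[X in measurable X]setTI; apply: mg => //; exact: measurableX.
rewrite /lebesgue_cons /pushforward -comp_preimage.
rewrite (_ : g \o _ = id); last first.
  by apply/funext => -[x t]; rewrite /g/= theadE; congr pair; exact/val_inj.
by rewrite preimage_id product_measure1E// lte_mul_pinfty// ge0_fin_numE.
Qed.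

HB.instance Definition _ := Measure_isSigmaFinite.Build _ _ _ lebesgue_cons
  lebesgue_cons_sigma_finite.
End step.

Fixpoint lebesgue_tuple n : {sigma_finite_measure set (n.-tuple T) -> \bar R} :=
  if n is n'.+1 then lebesgue_cons (lebesgue_tuple n') else \d_[tuple].

End lebesgue_tuple.

Definition symdim (d : nat) : nat := (d * d.+1)./2.

(* Position of the entry (i, j) when the upper triangle of a symmetric matrix
   is listed column by column: (0,0), (0,1), (1,1), (0,2), (1,2), (2,2), ... *)
Definition sym_index (i j : nat) : nat := (symdim (maxn i j) + minn i j)%N.

Lemma symdimS d : symdim d.+1 = (symdim d + d.+1)%N.
Proof.
rewrite /symdim (_ : d.+1 * d.+2 = d.+1.*2 + d * d.+1)%N; last by nia.
by rewrite halfD odd_double doubleK add0n addnC.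
Qed.

Lemma leq_symdim : {homo symdim : m n / (m <= n)%N}.
Proof. by move=> m n mn; rewrite half_leq// leq_mul. Qed.

Lemma ltn_sym_index d (i j : 'I_d) : (sym_index i j < symdim d)%N.
Proof.
apply: (@leq_trans (symdim (maxn i j).+1)); last first.
  by apply: leq_symdim; rewrite gtn_max !ltn_ord.
by rewrite symdimS /sym_index ltn_add2l ltnS geq_min leq_max leqnn.
Qed.

Lemma sym_index_inj (i j k l : nat) : (i <= j)%N -> (k <= l)%N ->
  sym_index i j = sym_index k l -> (i, j) = (k, l).
Proof.
rewrite /sym_index => ij kl.
rewrite (maxn_idPr ij) (minn_idPl ij) (maxn_idPr kl) (minn_idPl kl) => e.
have [jl|jl|jl] := ltngtP j l; last by rewrite jl in e *; congr pair; lia.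
- by have := leq_symdim jl; rewrite symdimS; lia.
- by have := leq_symdim jl; rewrite symdimS; lia.
Qed.

Section symmetric_matrices.
Context {R : realType}.
Let T := measurableTypeR R.

Definition sym_of_tuple d (t : (symdim d).-tuple T) : 'M[R]_d :=
  \matrix_(i, j) nth (0 : R) t (sym_index i j).

Lemma measurable_sym_of_tuple d : measurable_fun setT (@sym_of_tuple d).
Proof.
apply: measurable_fun_mx => i j.
rewrite (_ : (fun _ => _) = @tnth _ T ^~ (Ordinal (ltn_sym_index i j))).
  exact: measurable_tnth.
by apply/funext => t; rewrite mxE (tnth_nth 0).
Qed.

HB.instance Definition _ d := isMeasurableFun.Build _ _ _ _
  (@sym_of_tuple d) (@measurable_sym_of_tuple d).

(* Lebesgue measure on the symmetric matrices, identified with the space of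
   dimension d (d + 1) / 2 of their entries on and above the diagonal; as a
   measure on all square matrices it is carried by the symmetric ones. *)
Definition lebesgue_sym d : set 'M[R]_d -> \bar R :=
  pushforward (lebesgue_tuple (symdim d)) (@sym_of_tuple d).

Arguments lebesgue_sym d : clear implicits.

Let lebesgue_sym0 d : lebesgue_sym d set0 = 0%E.
Proof. exact: measure0. Qed.

Let lebesgue_sym_ge0 d A : (0 <= lebesgue_sym d A)%E.
Proof. exact: measure_ge0. Qed.

Let lebesgue_sym_sigma_additive d : semi_sigma_additive (lebesgue_sym d).
Proof. exact: (@measure_semi_sigma_additive _ _ _ (pushforward _ _)). Qed.

HB.instance Definition _ d := isMeasure.Build _ _ _ (lebesgue_sym d)
  (@lebesgue_sym0 d) (@lebesgue_sym_ge0 d) (@lebesgue_sym_sigma_additive d).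

End symmetric_matrices.
Arguments lebesgue_sym {R} d _.

Section matrix_gamma.
Context {R : realType}.

(* Positive definite and nonnegative definite symmetric matrices *)
Definition pdmx d : set 'M[R]_d :=
  [set X | X^T = X /\
           forall v : 'rV[R]_d, v != 0 -> 0 < (v *m X *m v^T) 0 0].
Arguments pdmx d : clear implicits.

Definition psdmx d : set 'M[R]_d :=
  [set X | X^T = X /\ forall v : 'rV[R]_d, 0 <= (v *m X *m v^T) 0 0].
Arguments psdmx d : clear implicits.

(* The unit sphere of the trace norm in the cone [psdmx d], on which this norm
   is the trace *)
Definition trsphere d : set 'M[R]_d := [set U | psdmx d U /\ \tr U = 1].
Arguments trsphere d : clear implicits.

(* dX = r^(d (d + 1) / 2 - 1) dr dU under X = r U, X > 0, r = tr X *)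
Definition polar_measure d (mu : {measure set 'M[R]_d -> \bar R}) : Prop :=
  mu (~` (trsphere d `&` pdmx d)) = 0%E /\
  forall E, measurable E ->
    lebesgue_sym d (E `&` pdmx d) =
    (\int[mu]_(U in trsphere d) \int[lebesgue_measure]_(r in `]0%R, +oo[)
       (\1_E (r *: U) * r ^+ (symdim d).-1)%:E)%E.

(* The measure dU on the sphere. It is unique with the property
   [polar_measure]; the null measure is only the value the definition would
   take if there were none. *)
Definition sphere_measure d : {measure set 'M[R]_d -> \bar R} :=
  if pselect (exists mu, @polar_measure d mu) is left h then projT1 (cid h)
  else mzero.
Arguments sphere_measure d : clear implicits.

Definition Gamma (x : R) : R :=
  \int[lebesgue_measure]_(t in `]0, +oo[) (expR (- t) * t `^ (x - 1)).

Definition mvGamma d (eta : R) : R :=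
  \int[lebesgue_sym d]_(X in pdmx d)
    (expR (- \tr X) * (\det X) `^ (eta - d.+1%:R / 2)).

(* n-fold convolution power of a probability measure *)
Fixpoint conv_pow d (Q : probability 'M[R]_d R) (n : nat) :
    set 'M[R]_d -> \bar R :=
  if n is n'.+1 then
    fun A => (\int[Q]_X conv_pow Q n' [set Y | A (X + Y)%R])%E
  else \d_(0 : 'M[R]_d).

Definition infinitely_divisible d (P : probability 'M[R]_d R) : Prop :=
  forall n, (0 < n)%N -> exists Q : probability 'M[R]_d R,
    forall A, measurable A -> P A = conv_pow Q n A.

Definition laplace d (P : probability 'M[R]_d R) (Theta : 'M[R]_d) : \bar R :=
  (\int[P]_X (expR (- \tr (Theta *m X)))%:E)%E.

(* A measure on the sphere is a measure on all matrices that does not charge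
   the complement of the sphere, and likewise for the other sets below. *)
Definition matrix_gamma d (alpha : {finite_measure set 'M[R]_d -> \bar R})
    (beta : 'M[R]_d -> R) (P : probability 'M[R]_d R) : Prop :=
  [/\ alpha (~` trsphere d) = 0%E,
      measurable_fun (trsphere d) (beta : 'M[R]_d -> measurableTypeR R) /\
        (forall U, trsphere d U -> 0 <= beta U),
      infinitely_divisible P,
      P (~` psdmx d) = 0%E &
      forall Theta, psdmx d Theta ->
        laplace P Theta = expeR (- (\int[alpha]_(U in trsphere d)
          \int[lebesgue_measure]_(r in `]0%R, +oo[)
            ((1 - expR (- (r * \tr (Theta *m U)))) *
             (expR (- (beta U * r)) / r))%:E))%E].

Definition homogeneous d (beta : 'M[R]_d -> R) : Prop :=
  exists b, forall U, trsphere d U -> beta U = b.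

(* Levy measure of a law on the cone [psdmx d], by the Levy-Khintchine formula
   for Laplace transforms, with drift [Psi] *)
Definition levy_measure_of d (P : probability 'M[R]_d R)
    (rho : {measure set 'M[R]_d -> \bar R}) : Prop :=
  [/\ rho (~` psdmx d) = 0%E, rho [set 0] = 0%E,
      (\int[rho]_(X in psdmx d) (Num.min 1 (\tr X))%:E < +oo)%E &
      exists2 Psi, psdmx d Psi & forall Theta, psdmx d Theta ->
        laplace P Theta = expeR (- ((\tr (Theta *m Psi))%:E +
          \int[rho]_(X in psdmx d) (1 - expR (- \tr (Theta *m X)))%:E))%E].

(* The Levy measure of the matrix Gamma law in terms of its parameters *)
Definition gamma_levy d (alpha : {measure set 'M[R]_d -> \bar R})
    (beta : 'M[R]_d -> R) (E : set 'M[R]_d) : \bar R :=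
  (\int[alpha]_(U in trsphere d) \int[lebesgue_measure]_(r in `]0%R, +oo[)
     (\1_E (r *: U) * (expR (- (beta U * r)) / r))%:E)%E.

Definition c_const d (eta omega : R) : R :=
  omega * Gamma (eta * d%:R) / mvGamma d eta.

Definition g_density d (eta omega : R) (X : 'M[R]_d) : R :=
  c_const d eta omega * (expR (- \tr X) / (\tr X) `^ (eta * d%:R)) *
  (\det X) `^ (eta - d.+1%:R / 2).

End matrix_gamma.

Arguments pdmx {R} d _.
Arguments psdmx {R} d _.
Arguments trsphere {R} d _.

(* Main.v *)
(* Polar coordinates X = r U turn c g(tr X) (tr X)^(-eta d) |X|^(eta-(d+1)/2) dX
   into alpha(dU) g(r) dr / r.  With g(r) = e^(-r) r^(eta d) this computes the
   mass of alpha, and with g(r) = e^(-r) it identifies the Levy measure rho.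

   Existence of the law does not go through a general Levy-Khintchine theorem.
   If H(T) is the integral of 1 - e^(-tr(T X)) against rho, the substitution
   X = 2 Z gives H(T) = H(T/2) + (integral of 1 - e^(-tr(T X)) against m), where
   m has radial part e^(-r) - e^(-2r) and is finite.  A stationary law of the
   Markov chain x -> x/2 + Y, with Y compound Poisson of intensity m, thus has
   a Laplace transform with phi(T) = phi(T/2) e^(H(T/2) - H(T)), and iterating
   gives phi = e^(-H).  The chain has a stationary law by regeneration: its
   kernel is minorised by a fixed measure where the trace is small, and the
   trace is a Lyapunov function.  Replacing c by c / n gives the n-th roots,
   because the Laplace transform determines a law on the cone. *)
Require Import Defs.
From HB Require Import structures.
From mathcomp Require Import all_boot all_order all_algebra.
From mathcomp Require Import all_classical all_reals all_analysis.
From mathcomp Require Import measurable_realfun ring lra.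

Import Order.TTheory GRing.Theory Num.Theory.
Import numFieldNormedType.Exports.

Local Open Scope classical_set_scope.
Local Open Scope ring_scope.

Set Implicit Arguments.
Unset Strict Implicit.
Unset Printing Implicit Defensive.

(** The Levy measure has infinite total mass, because [exp(-r) / r] is not integrable at 0, so the
    law is not compound Poisson. It is self-decomposable, however, and only the finite difference
    [m] has to be realised by jumps. The doubling argument works because the density without its
    exponential factor is homogeneous of exactly the degree that cancels the scaling of Lebesgue
    measure. The normalisation is meaningful only if [mvGamma] is positive and finite; this is
    obtained by removing one row and column at a time with Schur complements, which also yields the
    measurability of the cones and the determinant bounds. A measure with the property
    [polar_measure] must be exhibited, since [sphere_measure] is a choice among such measures. The
    obstacle in the minorisation is the boundary of the cone, where the power of the determinant may
    vanish or blow up. The minorising measure therefore lives on a translate of the open cone, so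
    far inside that the determinant stays at least 1 after subtracting any starting point of bounded
    trace. *)

(** * Mixtures, image measures and measures with a density *)

Section mixture.
Context d1 d2 {X : measurableType d1} {Y : measurableType d2} {R : realType}.
Variables (mu : {measure set X -> \bar R}) (k : X -> {measure set Y -> \bar R}).
Hypothesis mk : forall U, measurable U -> measurable_fun [set: X] (fun x => k x U).
Local Open Scope ereal_scope.

(** Measurability of [k] is carried as an argument so that the measure instance declared below can
    recover it from the term. Later constructions of measures carry their hypotheses in the same
    way. *)
Definition mixture of (forall U, measurable U -> measurable_fun [set: X] (fun x => k x U)) :=
  fun A => \int[mu]_x k x A.

Let mixture0 : mixture mk set0 = 0.
Proof. by apply: integral0_eq => x _; rewrite measure0. Qed.

Let mixture_ge0 A : 0 <= mixture mk A.
Proof. exact: integral_ge0. Qed.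

Let mixture_sigma_additive : semi_sigma_additive (mixture mk).
Proof.
move=> F mF tF mUF; rewrite [X in _ --> X](_ : _ =
    \int[mu]_x (\sum_(n <oo) k x (F n))); last first.
  by apply: eq_integral => x _; apply/esym/cvg_lim => //;
     exact/measure_semi_sigma_additive.
apply/cvg_closeP; split.
  by apply: is_cvg_nneseries => n _ _; exact: integral_ge0.
by rewrite closeE// integral_nneseries// => n; exact: mk.
Qed.

HB.instance Definition _ := isMeasure.Build _ _ _ (mixture mk)
  mixture0 mixture_ge0 mixture_sigma_additive.

Import HBNNSimple.

(** Both sides are monotone limits along simple approximations of [f], for which the identity is
    linearity over the finitely many fibres. *)
Lemma integral_mixture f : (forall y, 0 <= f y) -> measurable_fun setT f ->
  \int[mixture mk]_y f y = \int[mu]_x \int[k x]_y f y.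
Proof.
move=> f0 mf; pose g := nnsfun_approx measurableT mf.
have mg n : measurable_fun setT (EFin \o g n) by exact/measurable_EFinP.
have ndg y : {homo (fun n => (g n y)%:E) : n m / (n <= m)%N >-> n <= m}.
  by move=> n m nm; rewrite lee_fin; exact/lefP/nd_nnsfun_approx.
have g0 n y : 0 <= (g n y)%:E by rewrite lee_fin.
have gf y : f y = limn (fun n => (g n y)%:E).
  by apply/esym/cvg_lim => //; exact: cvg_nnsfun_approx.
have fE (nu : {measure set Y -> \bar R}) :
    \int[nu]_y f y = limn (fun n => \int[nu]_y (g n y)%:E).
  by under eq_integral do rewrite gf; rewrite monotone_convergence.
rewrite fE (eq_integral _ _ (fun x _ => fE (k x))) monotone_convergence//.
- congr (limn _); apply/funext => n.
  have gE (nu : {measure set Y -> \bar R}) : \int[nu]_y (g n y)%:E =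
      \sum_(r \in range (g n)) r%:E * nu (g n @^-1` [set r]).
    by rewrite integralT_nnsfun sintegralE.
  under [RHS]eq_integral do rewrite gE.
  rewrite gE ge0_integral_fsum//; last first.
  - move=> r x _; apply: (mulemu_ge0 (fun r => g n @^-1` [set r])).
    exact: preimage_nnfun0.
  - by move=> r; apply: measurable_funeM; exact: mk.
  apply: eq_fsbigr => r _; rewrite /mixture.
  (* The approximation is nonnegative, so the fibre over a negative value is empty. *)
  have [r0|r0] := leP 0%R r.
    by rewrite ge0_integralZl//; exact: mk.
  rewrite preimage_nnfun0// measure0 mule0 integral0_eq// => x _.
  by rewrite measure0 mule0.
- by move=> n; exact: (measurable_fun_integral_kernel mk (g0 n) (mg n)).
- by move=> n x _; exact: integral_ge0.
- by move=> x _ n m nm; apply: ge0_le_integral => //;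
    first [exact: mg | move=> y _; exact: ndg].
Qed.

End mixture.

Section image_measure.
Context d1 d2 {X : measurableType d1} {Y : measurableType d2} {R : realType}.
Variables (mu : {measure set X -> \bar R}) (phi : X -> Y).
Hypothesis mphi : measurable_fun [set: X] phi.

Definition image_measure of measurable_fun [set: X] phi : set Y -> \bar R :=
  pushforward mu phi.

Local Notation nu := (image_measure mphi).

Let nu0 : nu set0 = 0%E.
Proof. exact: measure0. Qed.

Let nu_ge0 A : (0 <= nu A)%E.
Proof. exact: measure_ge0. Qed.

Let nu_sigma_additive : semi_sigma_additive nu.
Proof.
move=> F mF tF mUF; rewrite /image_measure /pushforward preimage_bigcup.
apply: measure_sigma_additive => [n|].
  by rewrite -[X in measurable X]setTI; exact: mphi.
apply/trivIsetP => i j _ _ ij; rewrite -preimage_setI.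
by move/trivIsetP : tF => /(_ _ _ Logic.I Logic.I ij) ->; rewrite preimage_set0.
Qed.

HB.instance Definition _ := isMeasure.Build _ _ _ nu nu0 nu_ge0
  nu_sigma_additive.

Lemma integral_image_measure (f : Y -> \bar R) : (forall y, 0 <= f y)%E ->
  measurable_fun [set: Y] f ->
  (\int[nu]_y f y = \int[mu]_x f (phi x))%E.
Proof. by move=> f0 mf; rewrite ge0_integral_pushforward. Qed.

End image_measure.

Section density_measure.
Context d {T : measurableType d} {R : realType}.
Variables (mu : {measure set T -> \bar R}) (g : T -> R).
Hypotheses (g0 : forall x, 0 <= g x)
           (mg : measurable_fun [set: T] (EFin \o g)).
Local Open Scope ereal_scope.

Let k x : {measure set T -> \bar R} := mscale (NngNum (g0 x)) \d_x.

Let mk U : measurable U -> measurable_fun [set: T] (fun x => k x U).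
Proof.
move=> mU; rewrite /k /mscale/=; apply: emeasurable_funM => //.
exact: measurable_fun_dirac.
Qed.

(** The mixture over [mu] of the point masses [g x] at [x]; additivity and the integral formula are
    then inherited from mixtures. *)
Definition density_measure : {measure set T -> \bar R} := mixture mu mk.

Lemma density_measureE A : measurable A ->
  density_measure A = \int[mu]_(x in A) (g x)%:E.
Proof.
move=> mA; rewrite [RHS]integral_mkcond; apply: eq_integral => x _.
rewrite (_ : k x A = (g x)%:E * (\1_A x)%:E)// indicE patchE; case: ifP => _.
  by rewrite mule1.
by rewrite mule0.
Qed.

Lemma integral_density_measure f : (forall y, 0 <= f y) ->
  measurable_fun [set: T] f ->
  \int[density_measure]_y f y = \int[mu]_x ((g x)%:E * f x).
Proof.
move=> f0 mf; rewrite integral_mixture//; apply: eq_integral => x _.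
by rewrite ge0_integral_mscale// integral_dirac// diracT mul1e.
Qed.

End density_measure.

(** * Tonelli's theorem and affine changes of variables for Lebesgue measure *)

Section curried_tonelli.
Context d1 d2 (X : measurableType d1) (Y : measurableType d2) (R : realType).
Variable m2 : {sigma_finite_measure set Y -> \bar R}.
Variable f : X -> Y -> \bar R.
Hypothesis f0 : forall x y, (0 <= f x y)%E.
Hypothesis mf : measurable_fun [set: X * Y] (fun p => f p.1 p.2).
Local Open Scope ereal_scope.

Lemma measurable_fun_integral :
  measurable_fun [set: X] (fun x => \int[m2]_y f x y).
Proof. exact: (@measurable_fun_fubini_tonelli_F _ _ _ _ _ m2 _ mf (fun p => f0 p.1 p.2)). Qed.

Lemma tonelli (m1 : {sigma_finite_measure set X -> \bar R}) :
  \int[m1]_x \int[m2]_y f x y = \int[m2]_y \int[m1]_x f x y.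
Proof. exact: (@fubini_tonelli _ _ _ _ _ m1 m2 _ mf (fun p => f0 p.1 p.2)). Qed.

End curried_tonelli.
Arguments measurable_fun_integral {d1 d2 X Y R m2} f f0 mf.
Arguments tonelli {d1 d2 X Y R m2} f f0 mf m1.

Section lebesgue_affine.
Context {R : realType}.
Notation leb := (@lebesgue_measure R).

Let affine (a b : R) (x : measurableTypeR R) : measurableTypeR R := a * x + b.

Let measurable_affine a b : measurable_fun setT (affine a b).
Proof. by apply: measurable_funD => //; exact: measurable_funM. Qed.

(** The scaled image measure gives half-open intervals their length, hence it is Lebesgue measure by
    uniqueness. *)
Lemma integral_affine (a b : R) (f : R -> \bar R) : 0 < a ->
  (forall x, 0 <= f x)%E ->
  measurable_fun [set: measurableTypeR R] f ->
  (a%:E * \int[leb]_x f (a * x + b)%R = \int[leb]_x f x)%E.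
Proof.
move=> a0 f0 mf.
have a_ge0 : 0 <= a by exact: ltW.
pose nu : {measure set (measurableTypeR R) -> \bar R} :=
  mscale (NngNum a_ge0) (image_measure leb (@measurable_affine a b)).
have nuE B : nu B = (a%:E * leb (affine a b @^-1` B))%E by [].
have lebE A : measurable A -> leb A = nu A.
  apply: lebesgue_measure_unique => // _ [[x y]] _ <-.
  rewrite nuE.
  rewrite (_ : _ @^-1` _ = `](x - b) / a, (y - b) / a]%classic); last first.
    apply/seteqP; split=> z; rewrite /affine/= !in_itv/=;
    by rewrite ltr_pdivrMr// ler_pdivlMr// ltrBlDr lerBrDr [z * _]mulrC.
  rewrite !lebesgue_measure_itv/= !lte_fin ltr_pM2r ?invr_gt0// ltrD2r.
  case: ifPn => _; last by rewrite mule0.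
  rewrite -!EFinB -EFinM; congr EFin.
  by rewrite -mulrBl mulrC divfK ?gt_eqF// opprD addrACA subrr addr0.
rewrite [RHS](@eq_measure_integral _ _ _ _ nu)// => [|A mA _]; last exact: lebE.
by rewrite ge0_integral_mscale// integral_image_measure.
Qed.

End lebesgue_affine.

Section lebesgue_tuple.
Context {R : realType}.
Let T := measurableTypeR R.
Notation leb := (@lebesgue_measure R).
Notation lt := (@lebesgue_tuple R).
Local Open Scope ereal_scope.

Lemma integral_lebesgue_tuple0 (F : seq R -> \bar R) :
  \int[lt 0]_t F t = F [::].
Proof.
have ct : (fun t : 0.-tuple T => F t) = cst (F [::]).
  by apply/funext => t; rewrite (tuple0 t).
by rewrite /= integral_dirac ?ct// diracT mul1e.
Qed.

Lemma integral_lebesgue_tupleS n (f : n.+1.-tuple T -> \bar R) :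
  (forall t, 0 <= f t) -> measurable_fun setT f ->
  \int[lt n.+1]_t f t = \int[leb]_x \int[lt n]_t f [tuple of x :: t].
Proof.
move=> f0 mf; rewrite [LHS](ge0_integral_pushforward (@measurable_cons_pair R n))//.
rewrite preimage_setT fubini_tonelli1//; last by move=> x; exact: f0.
by apply: measurableT_comp => //; exact: measurable_cons_pair.
Qed.

(** One coordinate at a time: each contributes one factor [a], and the translation vector varies in
    the induction because its head is split off. *)
Lemma integral_lebesgue_tuple_affine n (a : R) (z : n.-tuple T)
    (f : n.-tuple T -> \bar R) : (0 < a)%R ->
  (forall t, 0 <= f t) -> measurable_fun setT f ->
  (a ^+ n)%:E * \int[lt n]_t f [tuple (a * tnth t i + tnth z i)%R | i < n] =
  \int[lt n]_t f t.
Proof.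
move=> a0; elim: n => [|n ih] in z f * => f0 mf.
  rewrite expr0 mul1e; apply: eq_integral => t _; congr f.
  by rewrite (tuple0 t) (tuple0 [tuple _ | _ < _]).
have mc : measurable_fun [set: T * n.-tuple T]
    (fun p : T * n.-tuple T => f [tuple of p.1 :: p.2]).
  by apply: measurableT_comp => //; exact: measurable_cons_pair.
have ma (p : nat) (w : p.-tuple T) : measurable_fun [set: p.-tuple T]
    (fun t => [tuple (a * tnth t i + tnth w i)%R | i < p] : p.-tuple T).
  apply/measurable_fun_tnthP => i.
  rewrite (_ : _ \o _ = fun t : p.-tuple T => (a * tnth t i + tnth w i)%R).
    by apply: measurable_funD => //; apply: measurable_funM => //;
       exact: measurable_tnth.
  by apply/funext => t; rewrite /= tnth_mktuple.
case/tupleP: z => z0 z.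
rewrite [in RHS]integral_lebesgue_tupleS// integral_lebesgue_tupleS//; last first.
  by apply: measurableT_comp => //; exact: ma.
pose g x := \int[lt n]_t f [tuple of x :: t].
have g0 x : 0 <= g x by exact: integral_ge0.
have mg : measurable_fun [set: T] g.
  by apply: (measurable_fun_integral (fun (x : T) (t : n.-tuple T) =>
    f [tuple of x :: t])).
rewrite -[RHS](integral_affine z0 a0 g0 mg) exprS EFinM -muleA; congr (_ * _).
rewrite -ge0_integralZl//; last 3 first.
- apply: (measurable_fun_integral (fun (x : T) (t : n.-tuple T) =>
    f [tuple (a * tnth [tuple of x :: t] i
       + tnth [tuple of z0 :: z] i)%R | i < n.+1])) => //.
  apply: measurableT_comp => //.
  by apply: (measurableT_comp (ma _ [tuple of z0 :: z])); exact: measurable_cons_pair.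
- by move=> x _; exact: integral_ge0.
- by rewrite lee_fin exprn_ge0// ltW.
apply: eq_integral => x _; rewrite /g.
rewrite -[RHS](ih z (fun t => f [tuple of (a * x + z0)%R :: t]))//; last first.
  by apply: measurableT_comp => //; exact: measurable_cons.
congr (_ * _); apply: eq_integral => t _; congr f.
apply: eq_from_tnth => i; rewrite tnth_mktuple.
case: (unliftP ord0 i) => [j ->|->]; last by rewrite !tnth0.
by rewrite !tnthS tnth_mktuple.
Qed.

Lemma measurable_cat_tuple d (X : measurableType d) m n
    (f : X -> m.-tuple T) (g : X -> n.-tuple T) :
  measurable_fun [set: X] f -> measurable_fun [set: X] g ->
  measurable_fun [set: X] (fun x => [tuple of f x ++ g x] : (m + n).-tuple T).
Proof.
move=> mf mg; apply/measurable_fun_tnthP => i; case: (split_ordP i) => j ->.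
  rewrite (_ : _ \o _ = fun x => tnth (f x) j).
    exact: (measurableT_comp (measurable_tnth j)).
  by apply/funext => p /=; rewrite tnth_lshift.
rewrite (_ : _ \o _ = fun x => tnth (g x) j).
  exact: (measurableT_comp (measurable_tnth j)).
by apply/funext => p /=; rewrite tnth_rshift.
Qed.

(** The integrand takes sequences, so that concatenation requires no cast between tuple lengths;
    measurability is then asked at every length. *)
Lemma integral_lebesgue_tuple_cat m n (F : seq R -> \bar R) :
  (forall s, 0 <= F s) ->
  (forall k, measurable_fun [set: k.-tuple T] (fun t : k.-tuple T => F t)) ->
  \int[lt (m + n)%N]_t F t = \int[lt m]_s \int[lt n]_u F (s ++ u).
Proof.
elim: m => [|m ih] in F * => F0 mF.
  by rewrite [RHS](integral_lebesgue_tuple0 (fun s => \int[lt n]_u F (s ++ u))).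
rewrite [LHS](integral_lebesgue_tupleS (n := (m + n)%N)
  (f := fun t : (m + n).+1.-tuple T => F t))//.
rewrite [RHS](integral_lebesgue_tupleS (n := m)
  (f := fun s : m.+1.-tuple T => \int[lt n]_u F (s ++ u))); last 2 first.
- by move=> t; exact: integral_ge0.
- apply: (measurable_fun_integral
    (fun (s : m.+1.-tuple T) (u : n.-tuple T) => F (s ++ u))) => //.
  apply: (measurableT_comp (mF (m.+1 + n)%N)).
  exact: measurable_cat_tuple measurable_fst measurable_snd.
apply: eq_integral => x _; apply: (ih (fun s => F (x :: s))) => // k.
have mc : measurable_fun [set: k.-tuple T]
    (fun t : k.-tuple T => [tuple of x :: t] : k.+1.-tuple T).
  exact: measurable_cons.
exact: (measurableT_comp (mF k.+1) mc).
Qed.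

Lemma integral_lebesgue_tuple1 (F : seq R -> \bar R) :
  (forall s, 0 <= F s) ->
  (forall k, measurable_fun [set: k.-tuple T] (fun t : k.-tuple T => F t)) ->
  \int[lt 1]_t F t = \int[leb]_x F [:: x].
Proof.
move=> F0 mF.
rewrite [LHS](integral_lebesgue_tupleS (f := fun t : 1.-tuple T => F t))//.
by apply: eq_integral => x _; rewrite (integral_lebesgue_tuple0 (fun s => F (x :: s))).
Qed.

End lebesgue_tuple.

(** * Quadratic forms and the cones of positive and nonnegative definite matrices *)

Section quadratic_form.
Context {R : realType}.

Definition qform d (X : 'M[R]_d) (v : 'rV[R]_d) : R := (v *m X *m v^T) 0 0.

Lemma qformD d (X Y : 'M[R]_d) v : qform (X + Y) v = qform X v + qform Y v.
Proof. by rewrite /qform mulmxDr mulmxDl mxE. Qed.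

Lemma qformN d (X : 'M[R]_d) v : qform (- X) v = - qform X v.
Proof. by rewrite /qform mulmxN mulNmx mxE. Qed.

Lemma qformZ d a (X : 'M[R]_d) v : qform (a *: X) v = a * qform X v.
Proof. by rewrite /qform -scalemxAr -scalemxAl mxE. Qed.

Lemma qform1 d (v : 'rV[R]_d) : qform 1%:M v = \sum_i v 0 i ^+ 2.
Proof.
by rewrite /qform mulmx1 mxE; apply: eq_bigr => i _; rewrite mxE expr2.
Qed.

Lemma qform1_gt0 d (v : 'rV[R]_d) : v != 0 -> 0 < qform 1%:M v.
Proof.
move=> v0; rewrite qform1 lt_def sumr_ge0 ?andbT => [|i _]; last exact: sqr_ge0.
apply: contra v0 => /eqP s0; apply/eqP/rowP => i; rewrite mxE.
apply/eqP; rewrite -sqrf_eq0; apply/eqP.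
by have := psumr_eq0P (fun i _ => sqr_ge0 (v 0 i)) s0; exact.
Qed.

Lemma qform_rank1 d (u v : 'rV[R]_d) :
  qform (u^T *m u) v = ((v *m u^T) 0 0) ^+ 2.
Proof.
rewrite /qform mulmxA -mulmxA [in LHS]mxE big_ord1 expr2; congr (_ * _).
by rewrite -[u *m _]trmxK trmx_mul trmxK mxE.
Qed.

Lemma qform_delta d (X : 'M[R]_d) i : qform X (delta_mx 0 i) = X i i.
Proof.
by rewrite /qform -rowE trmx_delta -colE !mxE.
Qed.

Lemma qform_delta2 d (X : 'M[R]_d) (a : R) i j : X^T = X ->
  qform X (delta_mx 0 i + a *: delta_mx 0 j) =
  X i i + 2 * a * X i j + a ^+ 2 * X j j.
Proof.
move=> sX; have Xji : X j i = X i j by rewrite -[in LHS]sX mxE.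
rewrite /qform linearD/= linearZ/= mulmxDl !mulmxDr !mulmxDl.
rewrite -?scalemxAl -?scalemxAr -?scalemxAl -!rowE !trmx_delta -!colE !mxE Xji.
ring.
Qed.

Lemma qform0 d (X : 'M[R]_d) : qform X 0 = 0.
Proof. by rewrite /qform !mul0mx mxE. Qed.

End quadratic_form.

Section cone.
Context {R : realType}.
Implicit Types d : nat.

Lemma pdmx_psdmx d : pdmx d `<=` psdmx (R := R) d.
Proof.
move=> X [sX pX]; split => // v.
by have [->|v0] := eqVneq v 0; [rewrite -/(qform _ _) qform0|exact/ltW/pX].
Qed.

Lemma pdmxD d (X Y : 'M[R]_d) : psdmx d X -> pdmx d Y -> pdmx d (X + Y).
Proof.
move=> [sX pX] [sY pY]; split; first by rewrite linearD/= sX sY.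
move=> v v0; rewrite -/(qform _ _) qformD ltr_wpDl//; [exact: pX|exact: pY].
Qed.

Lemma psdmxD d (X Y : 'M[R]_d) : psdmx d X -> psdmx d Y -> psdmx d (X + Y).
Proof.
move=> [sX pX] [sY pY]; split; first by rewrite linearD/= sX sY.
by move=> v; rewrite -/(qform _ _) qformD addr_ge0//; [exact: pX|exact: pY].
Qed.

Lemma pdmxZ d a (X : 'M[R]_d) : 0 < a -> pdmx d X -> pdmx d (a *: X).
Proof.
move=> a0 [sX pX]; split; first by rewrite linearZ/= sX.
by move=> v v0; rewrite -/(qform _ _) qformZ mulr_gt0//; exact: pX.
Qed.

Lemma psdmxZ d a (X : 'M[R]_d) : 0 <= a -> psdmx d X -> psdmx d (a *: X).
Proof.
move=> a0 [sX pX]; split; first by rewrite linearZ/= sX.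
by move=> v; rewrite -/(qform _ _) qformZ mulr_ge0//; exact: pX.
Qed.

Lemma psdmx0 d : psdmx d (0 : 'M[R]_d).
Proof.
split=> [|v]; first by rewrite linear0.
by rewrite mulmx0 mul0mx mxE.
Qed.

Lemma pdmx1 d : pdmx d (1%:M : 'M[R]_d).
Proof. by split=> [|v v0]; [rewrite trmx1|exact: qform1_gt0]. Qed.

Lemma psdmx_rank1 d (u : 'rV[R]_d) : psdmx d (u^T *m u).
Proof.
split=> [|v]; first by rewrite trmx_mul trmxK.
by rewrite -/(qform _ _) qform_rank1 sqr_ge0.
Qed.

Lemma psdmx_diag_ge0 d (X : 'M[R]_d) i : psdmx d X -> 0 <= X i i.
Proof. by move=> [_ /(_ (delta_mx 0 i))]; rewrite -/(qform _ _) qform_delta. Qed.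

Lemma mxtrace_psdmx_ge0 d (X : 'M[R]_d) : psdmx d X -> 0 <= \tr X.
Proof. by move=> pX; apply: sumr_ge0 => i _; exact: psdmx_diag_ge0. Qed.

Lemma mxtrace_pdmx_gt0 d (X : 'M[R]_d.+1) : pdmx d.+1 X -> 0 < \tr X.
Proof.
move=> pX; rewrite /mxtrace (bigD1 ord0)//= ltr_pwDl//.
  case: pX => _ /(_ (delta_mx 0 ord0)); rewrite -/(qform _ _) qform_delta; apply.
  by apply/eqP => /matrixP/(_ 0 0)/eqP; rewrite !mxE !eqxx oner_eq0.
by apply: sumr_ge0 => i _; exact/psdmx_diag_ge0/pdmx_psdmx.
Qed.

Lemma psdmx_diag_le d (X : 'M[R]_d) i : psdmx d X -> X i i <= \tr X.
Proof.
move=> pX; rewrite /mxtrace (bigD1 i)//= lerDl.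
by apply: sumr_ge0 => j _; exact: psdmx_diag_ge0.
Qed.

(** Nonnegativity of the form at [e_i + e_j] and [e_i - e_j] gives [2 |X i j| <= X i i + X j j], and
    each diagonal entry is at most the trace. *)
Lemma psdmx_entry_le d (X : 'M[R]_d) i j : psdmx d X -> `|X i j| <= \tr X.
Proof.
move=> pX; have [sX qX] := pX.
have := qX (delta_mx 0 i + 1 *: delta_mx 0 j).
have := qX (delta_mx 0 i + (- 1) *: delta_mx 0 j).
rewrite -!/(qform _ _) !qform_delta2//.
have := psdmx_diag_le i pX; have := psdmx_diag_le j pX => h1 h2 h3 h4.
by rewrite ler_norml; lra.
Qed.

Lemma mxtrace_mul_le d (Theta X : 'M[R]_d) : psdmx d X ->
  `|\tr (Theta *m X)| <= (\sum_i \sum_j `|Theta i j|) * \tr X.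
Proof.
move=> pX; rewrite mulr_suml /mxtrace.
apply: (le_trans (ler_norm_sum _ _ _)); apply: ler_sum => i _.
rewrite mxE mulr_suml; apply: (le_trans (ler_norm_sum _ _ _)).
by apply: ler_sum => j _; rewrite normrM ler_wpM2l//; exact: psdmx_entry_le.
Qed.

End cone.

(** * Schur complements, bordered matrices and determinant bounds *)

Section schur_complement.
Context {R : realType}.
Implicit Types d : nat.

(** Schur complement of the corner [x] in the symmetric matrix with blocks [Y], [v^T], [v] and
    [x]. *)
Definition schur d (Y : 'M[R]_d) (v : 'rV[R]_d) (x : R) : 'M[R]_d :=
  Y - x^-1 *: (v^T *m v).

Let blk d (Y : 'M[R]_d) (v : 'rV[R]_d) (x : R) : 'M[R]_(d + 1) :=
  block_mx Y v^T v x%:M.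

(** Completing the square in the last coordinate [t]. *)
Let qform_blk d (Y : 'M[R]_d) v x w t : x != 0 ->
  qform (blk Y v x) (row_mx w t%:M) =
  qform (schur Y v x) w + x * (t + x^-1 * (w *m v^T) 0 0) ^+ 2.
Proof.
move=> x0; rewrite /schur qformD qformN qformZ qform_rank1.
rewrite /qform /blk mul_row_block tr_row_mx mul_row_col tr_scalar_mx !mulmxDl.
rewrite !mul_scalar_mx !mul_mx_scalar -scalemxAl.
have -> : v *m w^T = w *m v^T.
  by rewrite [RHS]mx11_scalar -tr_scalar_mx -mx11_scalar trmx_mul trmxK.
have eD (A B : 'M[R]_1) : (A + B) 0 0 = A 0 0 + B 0 0 by rewrite mxE.
have eZ a (A : 'M[R]_1) : (a *: A) 0 0 = a * A 0 0 by rewrite mxE.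
rewrite !(eD, eZ) [x%:M 0 0]mxE eqxx mulr1n.
by field.
Qed.

Let pdmx_blk d (Y : 'M[R]_d) v x :
  pdmx (d + 1) (blk Y v x) <-> 0 < x /\ pdmx d (schur Y v x).
Proof.
have symS : Y^T = Y -> (schur Y v x)^T = schur Y v x.
  by move=> sY; rewrite /schur linearB linearZ/= trmx_mul trmxK sY.
split=> [[sB pB]|[x0 [sS pS]]].
  have sY : Y^T = Y.
    by move/(congr1 ulsubmx): sB; rewrite /blk tr_block_mx !block_mxKul.
  have x0 : 0 < x.
    have /pB : row_mx 0 1%:M != 0 :> 'rV[R]_(d + 1).
      apply/eqP => /(congr1 rsubmx); rewrite row_mxKr => /matrixP/(_ 0 0)/eqP.
      by rewrite !mxE oner_eq0.
    rewrite /blk mul_row_block tr_row_mx mul_row_col !mul0mx !add0r !mul1mx.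
    by rewrite trmx0 mulmx0 add0r trmx1 mulmx1 mxE eqxx.
  split => //; split; first exact: symS.
  move=> w w0.
  (* This last coordinate makes the completed square vanish, leaving the form of the complement
     alone. *)
  have := pB (row_mx w (- (x^-1 * (w *m v^T) 0 0))%:M).
  rewrite -!/(qform _ _) qform_blk ?gt_eqF// addNr expr0n mulr0 addr0.
  apply; apply: contra w0 => /eqP/(congr1 lsubmx); rewrite row_mxKl => ->.
  by rewrite linear0.
have sY : Y^T = Y.
  rewrite -[Y](subrK (x^-1 *: (v^T *m v))) linearD/= sS.
  by rewrite linearZ/= trmx_mul trmxK.
split=> [|w]; first by rewrite /blk tr_block_mx trmxK sY tr_scalar_mx.
rewrite -(hsubmxK w); move: (lsubmx w) (rsubmx w) => {w} w t.
rewrite (mx11_scalar t) => w0.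
rewrite -/(qform _ _) qform_blk ?gt_eqF//.
have [wE|wN0] := eqVneq w 0; last first.
  by rewrite ltr_pwDl//; [exact: pS|rewrite mulr_ge0 ?sqr_ge0// ltW].
rewrite wE qform0 mul0mx mxE mulr0 addr0 add0r mulr_gt0// lt_def sqr_ge0 andbT.
rewrite sqrf_eq0; apply: contra w0 => /eqP ->.
by rewrite wE raddf0 row_mx0.
Qed.

Let det_blk d (Y : 'M[R]_d) v x : x != 0 ->
  \det (blk Y v x) = x * \det (schur Y v x).
Proof.
move=> x0.
have -> : blk Y v x =
    block_mx (schur Y v x) v^T 0 x%:M *m block_mx 1%:M 0 (x^-1 *: v) 1%:M.
  rewrite mulmx_block !mulmx0 !mul0mx !mulmx1 !add0r /blk; congr block_mx.
    by rewrite /schur -scalemxAr subrK.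
  by rewrite mul_scalar_mx scalerA divff// scale1r.
by rewrite det_mulmx det_ublock det_lblock !det1 !mulr1 det_scalar1 mulrC.
Qed.

(** The cast replaces the size [d + 1] of the block matrix by [d.+1], on which the inductions
    run. *)
Definition border d (Y : 'M[R]_d) (v : 'rV[R]_d) (x : R) : 'M[R]_d.+1 :=
  castmx (addn1 d, addn1 d) (blk Y v x).

Let pdmx_castmx m n (e : m = n) (A : 'M[R]_m) :
  pdmx n (castmx (e, e) A) <-> pdmx m A.
Proof. by case: n / e; rewrite castmx_id. Qed.

Let det_castmx m n (e : m = n) (A : 'M[R]_m) : \det (castmx (e, e) A) = \det A.
Proof. by case: n / e; rewrite castmx_id. Qed.

Let trace_castmx m n (e : m = n) (A : 'M[R]_m) : \tr (castmx (e, e) A) = \tr A.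
Proof. by case: n / e; rewrite castmx_id. Qed.

Lemma pdmx_border d (Y : 'M[R]_d) v x :
  pdmx d.+1 (border Y v x) <-> 0 < x /\ pdmx d (schur Y v x).
Proof. by rewrite /border pdmx_castmx; exact: pdmx_blk. Qed.

Lemma det_border d (Y : 'M[R]_d) v x : x != 0 ->
  \det (border Y v x) = x * \det (schur Y v x).
Proof. by rewrite /border det_castmx; exact: det_blk. Qed.

Lemma mxtrace_border d (Y : 'M[R]_d) v x : \tr (border Y v x) = \tr Y + x.
Proof. by rewrite /border trace_castmx mxtrace_block mxtrace_scalar mulr1n. Qed.

Lemma border_ll d (Y : 'M[R]_d) v x (i j : 'I_d) :
  border Y v x (lift ord_max i) (lift ord_max j) = Y i j.
Proof.
rewrite castmxE/= (_ : cast_ord _ _ = lshift 1 i); last first.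
  by apply/val_inj => /=; rewrite /bump leqNgt ltn_ord.
rewrite (_ : cast_ord _ _ = lshift 1 j); last first.
  by apply/val_inj => /=; rewrite /bump leqNgt ltn_ord.
by rewrite block_mxEul.
Qed.

Lemma border_lm d (Y : 'M[R]_d) v x (i : 'I_d) :
  border Y v x (lift ord_max i) ord_max = v 0 i.
Proof.
rewrite castmxE/= (_ : cast_ord _ _ = lshift 1 i); last first.
  by apply/val_inj => /=; rewrite /bump leqNgt ltn_ord.
rewrite (_ : cast_ord _ _ = rshift d 0); last first.
  by apply/val_inj => /=; rewrite addn0.
by rewrite block_mxEur mxE.
Qed.

Lemma border_ml d (Y : 'M[R]_d) v x (i : 'I_d) :
  border Y v x ord_max (lift ord_max i) = v 0 i.
Proof.
rewrite castmxE/= (_ : cast_ord _ (lift _ _) = lshift 1 i); last first.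
  by apply/val_inj => /=; rewrite /bump leqNgt ltn_ord.
rewrite (_ : cast_ord _ _ = rshift d 0); last first.
  by apply/val_inj => /=; rewrite addn0.
by rewrite block_mxEdl.
Qed.

Lemma border_mm d (Y : 'M[R]_d) v x : border Y v x ord_max ord_max = x.
Proof.
rewrite castmxE/= (_ : cast_ord _ _ = rshift d 0); last first.
  by apply/val_inj => /=; rewrite addn0.
by rewrite block_mxEdr mxE eqxx mulr1n.
Qed.

Definition borderE := (border_ll, border_lm, border_ml, border_mm).

Definition ulmx d (X : 'M[R]_d.+1) : 'M[R]_d :=
  \matrix_(i, j) X (lift ord_max i) (lift ord_max j).

Definition lastrow d (X : 'M[R]_d.+1) : 'rV[R]_d :=
  \row_i X ord_max (lift ord_max i).

Lemma symmetric_border d (X : 'M[R]_d.+1) : X^T = X ->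
  X = border (ulmx X) (lastrow X) (X ord_max ord_max).
Proof.
move=> sX; apply/matrixP => i j.
case: (unliftP ord_max i) => [i' ->|->]; case: (unliftP ord_max j) => [j' ->|->];
  rewrite borderE ?mxE//.
by rewrite -[in LHS]sX mxE.
Qed.

(** The induction hypothesis concerns the Schur complement and not the block [Y], because it is
    along the complement that the determinant factors. *)
Lemma pdmx_ind (P : forall d, 'M[R]_d -> Prop) :
  (forall X : 'M[R]_0, P 0 X) ->
  (forall d (Y : 'M[R]_d) v x, 0 < x -> pdmx d (schur Y v x) ->
     P d (schur Y v x) -> P d.+1 (border Y v x)) ->
  forall d X, pdmx d X -> P d X.
Proof.
move=> P0 PS; elim=> [X _|d ih X pX]; first exact: P0.
have [sX _] := pX; rewrite (symmetric_border sX) in pX *.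
by move/pdmx_border : pX => [x0 pS]; apply: PS => //; exact: ih.
Qed.

Lemma mxtrace_schur d (Y : 'M[R]_d) v x :
  \tr Y = \tr (schur Y v x) + x^-1 * qform 1%:M v.
Proof.
rewrite /schur linearB linearZ/= mxtrace_mulC /qform mulmx1.
by rewrite [in \tr (v *m _)](mx11_scalar (v *m v^T)) mxtrace_scalar mulr1n subrK.
Qed.

Lemma det_pdmx_gt0 d (X : 'M[R]_d) : pdmx d X -> 0 < \det X.
Proof.
move: d X; apply: pdmx_ind => [X|d Y v x x0 _ ih]; first by rewrite det_mx00.
by rewrite det_border ?gt_eqF// mulr_gt0.
Qed.

(** The determinant is the product of the corners met in the Schur recursion, and the corner and the
    trace of the complement are both at most the trace. *)
Lemma det_pdmx_le d (X : 'M[R]_d) : pdmx d X -> \det X <= \tr X ^+ d.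
Proof.
move: d X; apply: pdmx_ind => [X|d Y v x x0 pS ih].
  by rewrite det_mx00 expr0.
have tS : 0 <= \tr (schur Y v x) by exact/mxtrace_psdmx_ge0/pdmx_psdmx.
have q0 : 0 <= x^-1 * qform 1%:M v.
  rewrite mulr_ge0 ?invr_ge0 ?(ltW x0)//.
  exact: (pdmx_psdmx (pdmx1 d)).2.
have tx : \tr (schur Y v x) <= \tr (border Y v x).
  by rewrite mxtrace_border (mxtrace_schur Y v x); lra.
rewrite det_border ?gt_eqF// exprS ler_pM ?(ltW x0)//.
- exact/ltW/det_pdmx_gt0.
- by rewrite mxtrace_border (mxtrace_schur Y v x); lra.
- by apply: (le_trans ih); rewrite lerXn2r// nnegrE; lra.
Qed.

Lemma border_sub1 d (Y : 'M[R]_d) v x :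
  border Y v x - 1%:M = border (Y - 1%:M) v (x - 1).
Proof.
have eB n (A B : 'M[R]_n) i j : (A - B) i j = A i j - B i j by rewrite !mxE.
have e1 n i j : (1%:M : 'M[R]_n) i j = (i == j)%:R by rewrite mxE.
apply/matrixP => i j; rewrite eB e1.
case: (unliftP ord_max i) => [i' ->|->]; case: (unliftP ord_max j) => [j' ->|->];
  rewrite !borderE ?eB ?e1 ?(inj_eq (@lift_inj _ _)) ?eqxx//.
- by rewrite eq_sym (negbTE (neq_lift _ _)) subr0.
- by rewrite (negbTE (neq_lift _ _)) subr0.
Qed.

(** The corner exceeds 1, and the Schur complement still dominates the identity, because removing
    [x^-1 *: (v^T *m v)] costs less than removing [(x - 1)^-1 *: (v^T *m v)]. *)
Lemma det_pdmx_ge1 d (X : 'M[R]_d) : pdmx d (X - 1%:M) -> 1 <= \det X.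
Proof.
elim: d X => [X _|d ih X pX1]; first by rewrite det_mx00.
have pX : pdmx d.+1 X.
  by rewrite -(subrK 1%:M X) addrC; apply: pdmxD pX1; exact/pdmx_psdmx/pdmx1.
have [sX _] := pX; rewrite (symmetric_border sX) in pX pX1 *.
move: (ulmx X) (lastrow X) (X _ _) pX pX1 => Y v x /pdmx_border[x0 [sS pS]].
rewrite border_sub1 => /pdmx_border[x1 [sS1 pS1]].
rewrite subr_gt0 in x1.
rewrite det_border ?gt_eqF// -[leLHS]mulr1 ler_pM ?(ltW x1)//.
apply: ih; split=> [|w w0]; first by rewrite linearB/= sS trmx1.
have := pS1 w w0; rewrite -!/(qform _ _) /schur.
rewrite !qformD !qformN !qformZ qform_rank1.
set b := _ ^+ 2 => h.
suff : x^-1 * b <= (x - 1)^-1 * b by move: h; lra.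
by rewrite ler_wpM2r ?sqr_ge0// lef_pV2 ?posrE ?subr_gt0//; lra.
Qed.

Lemma mxtrace_mul_rank1 d (Theta : 'M[R]_d) (u : 'rV[R]_d) :
  \tr (Theta *m (u^T *m u)) = qform Theta u.
Proof.
rewrite mulmxA mxtrace_mulC mulmxA /qform.
by rewrite [in LHS](mx11_scalar (u *m _ *m _)) mxtrace_scalar mulr1n.
Qed.

(** [X] is a rank one matrix plus its Schur complement padded with zeros. The trace against [Theta]
    splits accordingly into a value of the form of [Theta] and the same pairing one size smaller. *)
Lemma mxtrace_mul_ge0 d (Theta X : 'M[R]_d) : psdmx d Theta -> pdmx d X ->
  0 <= \tr (Theta *m X).
Proof.
move=> pT pX; move: d X pX Theta pT.
apply: pdmx_ind => [X Theta _|d Y v x x0 pS ih Theta pT].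
  by rewrite /mxtrace big_ord0.
pose w : 'rV[R]_d.+1 := \row_i (if unlift ord_max i is Some j then v 0 j else x).
have wl i : w 0 (lift ord_max i) = v 0 i by rewrite mxE liftK.
have wm : w 0 ord_max = x by rewrite mxE unlift_none.
have bE : border Y v x = border (schur Y v x) 0 0 + x^-1 *: (w^T *m w).
  have eE n (A : 'M[R]_n) (u : 'rV[R]_n) i j :
      (A + x^-1 *: (u^T *m u)) i j = A i j + x^-1 * (u 0 i * u 0 j).
    by rewrite mxE [in X in _ + X]mxE [in X in _ + _ * X]mxE big_ord1 mxE.
  apply/matrixP => i j; rewrite eE.
  case: (unliftP ord_max i) => [i' ->|->];
    case: (unliftP ord_max j) => [j' ->|->]; rewrite !borderE ?wl ?wm ?mxE.
  - by rewrite big_ord1 !mxE subrK.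
  - by rewrite add0r mulrC mulfK ?gt_eqF.
  - by rewrite add0r mulKf ?gt_eqF.
  - by rewrite add0r mulKf ?gt_eqF.
rewrite bE mulmxDr linearD/= -scalemxAr linearZ/= mxtrace_mul_rank1 addr_ge0//.
  have pU : psdmx d (ulmx Theta).
    have [sT qT] := pT; split.
      by apply/matrixP => i j; rewrite !mxE -[in LHS]sT mxE.
    move=> u; pose u' : 'rV[R]_d.+1 :=
      \row_i (if unlift ord_max i is Some j then u 0 j else 0).
    suff -> : (u *m ulmx Theta *m u^T) 0 0 = (u' *m Theta *m u'^T) 0 0 by exact: qT.
    rewrite !mxE (bigD1_ord ord_max)//= !mxE unlift_none mulr0 add0r.
    apply: eq_bigr => i _; rewrite !mxE liftK; congr (_ * _).
    rewrite (bigD1_ord ord_max)//= !mxE unlift_none mul0r add0r.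
    by apply: eq_bigr => j _; rewrite !mxE liftK.
  suff -> : \tr (Theta *m border (schur Y v x) 0 0) =
            \tr (ulmx Theta *m schur Y v x) by exact: ih.
  rewrite /mxtrace (bigD1_ord ord_max)//= mxE big1 ?add0r => [|j _]; last first.
    case: (unliftP ord_max j) => [j' ->|->]; rewrite !borderE ?mxE ?mulr0//.
  apply: eq_bigr => i _; rewrite !mxE (bigD1_ord ord_max)//= !borderE mxE mulr0.
  by rewrite add0r; apply: eq_bigr => j _; rewrite !borderE !mxE.
rewrite mulr_ge0 ?invr_ge0 ?(ltW x0)//; exact: pT.2.
Qed.

End schur_complement.

(** * Measurability of matrix operations and of the cones *)

Lemma measurable_preimage d1 d2 (X : measurableType d1) (Y : measurableType d2)
  (f : X -> Y) (A : set Y) : measurable_fun [set: X] f -> measurable A ->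
  measurable (f @^-1` A).
Proof. by move=> mf mA; rewrite -[X in measurable X]setTI; exact: mf. Qed.

Section measurable_matrix.
Context {R : realType}.

Lemma measurable_mx_entry m n (i : 'I_m) (j : 'I_n) :
  measurable_fun [set: 'M[R]_(m, n)] (fun X => X i j : measurableTypeR R).
Proof.
apply: (measurability _ (RGenOpens.measurableE R)).
move=> _ [_ [a [b ->] <-]]; rewrite setTI measurable_mxE.
apply: sub_sigma_algebra; apply: open_comp => [X _|]; last exact: interval_open.
exact: coord_continuous.
Qed.

Section measurable_operations.
Context d (T : measurableType d).

Lemma measurable_mxentry m n (f : T -> 'M[R]_(m, n)) i j :
  measurable_fun [set: T] f ->
  measurable_fun [set: T] (fun t => f t i j : measurableTypeR R).
Proof. exact: (measurableT_comp (measurable_mx_entry i j)). Qed.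

Lemma measurable_mxD m n (f g : T -> 'M[R]_(m, n)) :
  measurable_fun [set: T] f -> measurable_fun [set: T] g ->
  measurable_fun [set: T] (fun t => f t + g t).
Proof.
move=> mf mg; apply: measurable_fun_mx => i j.
under eq_fun do rewrite mxE.
by apply: measurable_funD; exact: measurable_mxentry.
Qed.

Lemma measurable_mxM m n p (f : T -> 'M[R]_(m, n)) (g : T -> 'M[R]_(n, p)) :
  measurable_fun [set: T] f -> measurable_fun [set: T] g ->
  measurable_fun [set: T] (fun t => f t *m g t).
Proof.
move=> mf mg; apply: measurable_fun_mx => i j.
under eq_fun do rewrite mxE.
by apply: measurable_sum => k; apply: measurable_funM; exact: measurable_mxentry.
Qed.

Lemma measurable_trmx m n (f : T -> 'M[R]_(m, n)) :
  measurable_fun [set: T] f -> measurable_fun [set: T] (fun t => (f t)^T).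
Proof.
move=> mf; apply: measurable_fun_mx => i j.
by under eq_fun do rewrite mxE; exact: measurable_mxentry.
Qed.

Lemma measurable_mxZ m n (a : T -> measurableTypeR R) (f : T -> 'M[R]_(m, n)) :
  measurable_fun [set: T] a -> measurable_fun [set: T] f ->
  measurable_fun [set: T] (fun t => a t *: f t).
Proof.
move=> ma mf; apply: measurable_fun_mx => i j.
under eq_fun do rewrite mxE.
by apply: measurable_funM => //; exact: measurable_mxentry.
Qed.

Lemma measurable_mxtrace n (f : T -> 'M[R]_n) : measurable_fun [set: T] f ->
  measurable_fun [set: T] (fun t => \tr (f t) : measurableTypeR R).
Proof. by move=> mf; apply: measurable_sum => k; exact: measurable_mxentry. Qed.

Lemma measurable_det n (f : T -> 'M[R]_n) : measurable_fun [set: T] f ->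
  measurable_fun [set: T] (fun t => \det (f t) : measurableTypeR R).
Proof.
move=> mf; apply: measurable_sum => s; apply: measurable_funM => //.
by apply: measurable_prod => i _; exact: measurable_mxentry.
Qed.

Lemma measurable_mxtraceMl n (Theta : 'M[R]_n) (f : T -> 'M[R]_n) :
  measurable_fun [set: T] f ->
  measurable_fun [set: T] (fun t => \tr (Theta *m f t) : measurableTypeR R).
Proof.
by move=> mf; apply: measurable_mxtrace; apply: measurable_mxM.
Qed.

End measurable_operations.

Lemma measurable_ulmx d : measurable_fun [set: 'M[R]_d.+1] (@ulmx R d).
Proof.
apply: measurable_fun_mx => i j; under eq_fun do rewrite mxE.
exact: measurable_mx_entry.
Qed.

Lemma measurable_lastrow d : measurable_fun [set: 'M[R]_d.+1] (@lastrow R d).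
Proof.
apply: measurable_fun_mx => i j; under eq_fun do rewrite mxE.
exact: measurable_mx_entry.
Qed.

Lemma measurable_border d0 (T : measurableType d0) d (Y : T -> 'M[R]_d)
    (v : T -> 'rV[R]_d) (x : T -> measurableTypeR R) :
  measurable_fun [set: T] Y -> measurable_fun [set: T] v ->
  measurable_fun [set: T] x ->
  measurable_fun [set: T] (fun t => border (Y t) (v t) (x t)).
Proof.
move=> mY mv mx; apply: measurable_fun_mx => i j.
case: (unliftP ord_max i) => [i' ->|->]; case: (unliftP ord_max j) => [j' ->|->];
  under eq_fun do rewrite borderE; by [exact: measurable_mxentry|].
Qed.

(** The definition quantifies over uncountably many vectors. The Schur recursion replaces it by
    three measurable conditions: symmetry, a positive corner and a positive definite complement. *)
Lemma measurable_pdmx d : measurable (pdmx d : set 'M[R]_d).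
Proof.
elim: d => [|d ih].
  rewrite (_ : pdmx 0 = setT)//; apply/seteqP; split => // X _; split.
    by apply/matrixP => -[].
  by move=> v; rewrite [v]thinmx0 eqxx.
(* [S] turns symmetry into one scalar equation. [C] is the Schur complement multiplied by the
   corner, which keeps it polynomial in the entries. *)
pose S (X : 'M[R]_d.+1) := \sum_i \sum_j (X i j - X j i) ^+ 2.
pose C (X : 'M[R]_d.+1) :=
  X ord_max ord_max *: ulmx X + (- 1 : R) *: ((lastrow X)^T *m lastrow X).
have mm := @measurable_mx_entry d.+1 d.+1 ord_max ord_max.
have mS : measurable_fun [set: 'M[R]_d.+1] (S : _ -> measurableTypeR R).
  apply: measurable_sum => i; apply: measurable_sum => j.
  by apply: measurable_funX; apply: measurable_funB; exact: measurable_mx_entry.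
have mC : measurable_fun [set: 'M[R]_d.+1] C.
  apply: measurable_mxD; apply: measurable_mxZ => //; first exact: measurable_ulmx.
  apply: measurable_mxM; last exact: measurable_lastrow.
  by apply: measurable_trmx; exact: measurable_lastrow.
have S0 X : S X = 0 <-> X^T = X.
  split=> [S0|sX]; last first.
    rewrite /S big1// => i _; rewrite big1// => j _.
    by rewrite -[in X i j]sX mxE subrr expr0n.
  apply/matrixP => i j; rewrite mxE; apply/esym/eqP; rewrite -subr_eq0.
  rewrite -sqrf_eq0; apply/eqP.
  have S1 : \sum_j (X i j - X j i) ^+ 2 = 0.
    apply: (psumr_eq0P _ S0) => // k _.
    by apply: sumr_ge0 => l _; exact: sqr_ge0.
  by apply: (psumr_eq0P _ S1) => // k _; exact: sqr_ge0.
rewrite (_ : pdmx d.+1 = S @^-1` [set 0] `&`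
    ((fun X : 'M[R]_d.+1 => X ord_max ord_max) @^-1` `]0, +oo[%classic `&`
     C @^-1` pdmx d)).
  by apply: measurableI; [|apply: measurableI]; apply: measurable_preimage.
have CE x (Y : 'M[R]_d) v : x != 0 ->
    x *: Y + (- 1 : R) *: (v^T *m v) = x *: schur Y v x.
  by move=> x0; rewrite /schur scalerBr scalerA divff// scale1r scaleN1r.
apply/seteqP; split => X.
- move=> pX; have [sX _] := pX; split; first exact/S0.
  move: pX; rewrite [X in pdmx _ X](symmetric_border sX) => /pdmx_border[x0 pS].
  split; first by rewrite /= in_itv/= x0.
  by rewrite /C/= CE ?gt_eqF//; exact: pdmxZ.
- move=> [/S0 sX [/=]]; rewrite in_itv/= andbT => x0.
  rewrite /C CE ?gt_eqF// (symmetric_border sX) => pC; apply/pdmx_border.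
  rewrite -(symmetric_border sX) in pC.
  split => //; have := @pdmxZ R _ (X ord_max ord_max)^-1 _ _ pC.
  by rewrite scalerA mulVf ?gt_eqF// scale1r invr_gt0; exact.
Qed.

(** Reduces the closed cone to the open one by countably many translations; both measurability and
    inequalities are transferred in this way. *)
Lemma psdmxP d (X : 'M[R]_d) :
  psdmx d X <-> forall n, pdmx d (X + (n.+1%:R^-1)%:M).
Proof.
split=> [pX n|pX].
  by apply: pdmxD => //; rewrite -scalemx1; apply: pdmxZ (pdmx1 d).
split.
  have [s0 _] := pX 0; move: s0; rewrite linearD/= tr_scalar_mx.
  by move/addIr.
move=> v; rewrite leNgt; apply/negP => qv.
have v0 : v != 0.
  by apply: contraTneq qv => ->; rewrite -/(qform _ _) qform0 ltxx.
have N0 := qform1_gt0 v0.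
(* Some [n] satisfies [qform 1%:M v / (n + 1) < - qform X v], so the perturbed matrix would be
   negative at [v]. *)
have : 0 < - qform X v / qform 1%:M v by rewrite divr_gt0// oppr_gt0.
move=> /ltr_add_invr[n]; rewrite add0r ltr_pdivlMr// => nv.
have [_ /(_ _ v0)] := pX n; rewrite -/(qform _ _) -scalemx1 qformD qformZ.
by move: nv; set e := _ * qform 1%:M v; lra.
Qed.

Lemma measurable_psdmx d : measurable (psdmx d : set 'M[R]_d).
Proof.
rewrite (_ : psdmx d = \bigcap_n
    ((fun X : 'M[R]_d => X + (n.+1%:R^-1)%:M) @^-1` pdmx d)); last first.
  by apply/seteqP; split => X; [move=> /psdmxP h n _; exact: h|
    move=> h; apply/psdmxP => n; exact: h].
apply: bigcapT_measurable => n; apply: measurable_preimage.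
  by apply: measurable_mxD.
exact: measurable_pdmx.
Qed.

Lemma measurable_trsphere d : measurable (trsphere d : set 'M[R]_d).
Proof.
rewrite (_ : trsphere d = psdmx d `&` (fun X => \tr X) @^-1` [set 1])//.
apply: measurableI; first exact: measurable_psdmx.
apply: (@measurable_preimage _ _ _ (measurableTypeR R)) => //.
exact: measurable_mxtrace.
Qed.

End measurable_matrix.

(** * Integration against Lebesgue measure on symmetric matrices *)

Section sym_integral.
Context {R : realType}.
Let T := measurableTypeR R.
Notation leb := (@lebesgue_measure R).
Notation lt := (@lebesgue_tuple R).

Lemma integral_lebesgue_sym d (f : 'M[R]_d -> \bar R) :
  (forall X, 0 <= f X)%E -> measurable_fun [set: 'M[R]_d] f ->
  (\int[lebesgue_sym d]_X f X =
   \int[lt (symdim d)]_t f (sym_of_tuple t))%E.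
Proof.
move=> f0 mf.
by rewrite [LHS](ge0_integral_pushforward (@measurable_sym_of_tuple R d)).
Qed.

Lemma sym_index_sym i j : sym_index i j = sym_index j i.
Proof. by rewrite /sym_index maxnC minnC. Qed.

Lemma sym_of_tuple_surj d (Z : 'M[R]_d) : Z^T = Z ->
  exists z : (symdim d).-tuple T, sym_of_tuple z = Z.
Proof.
(* The sum inverts [sym_index]: it has at most one term, because the index is injective on pairs
   with [i <= j]. *)
move=> sZ; exists [tuple \sum_(p : 'I_d * 'I_d |
  (p.1 <= p.2)%N && (sym_index p.1 p.2 == k)) Z p.1 p.2 | k < symdim d].
apply/matrixP; suff le_case (i j : 'I_d) : (i <= j)%N ->
    nth (0 : R) [tuple \sum_(p : 'I_d * 'I_d |
      (p.1 <= p.2)%N && (sym_index p.1 p.2 == k)) Z p.1 p.2 | k < symdim d]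
      (sym_index i j) = Z i j.
  move=> i j; rewrite mxE; case/orP: (leq_total i j) => ij; first exact: le_case.
  by rewrite sym_index_sym le_case// -[in LHS]sZ mxE.
move=> ij; rewrite -(tnth_nth _ _ (Ordinal (ltn_sym_index i j))) tnth_mktuple/=.
rewrite (big_pred1 (i, j))// => -[k l] /=.
apply/andP/eqP => [[kl /eqP e]|[-> ->]//].
by have [/val_inj -> /val_inj ->] := sym_index_inj kl ij e.
Qed.

Lemma integral_lebesgue_sym_affine d (a : R) (Z : 'M[R]_d)
    (f : 'M[R]_d -> \bar R) : 0 < a -> Z^T = Z ->
  (forall X, 0 <= f X)%E -> measurable_fun [set: 'M[R]_d] f ->
  ((a ^+ symdim d)%:E * \int[lebesgue_sym d]_X f (a *: X + Z)%R =
   \int[lebesgue_sym d]_X f X)%E.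
Proof.
move=> a0 sZ f0 mf; have [z <-] := sym_of_tuple_surj sZ.
rewrite !integral_lebesgue_sym//; last first.
  apply: (measurableT_comp mf); apply: measurable_mxD => //.
  exact: measurable_mxZ.
rewrite -[RHS](integral_lebesgue_tuple_affine z a0)//; last first.
  exact: (measurableT_comp mf (@measurable_sym_of_tuple R d)).
congr (_ * _)%E; apply: eq_integral => t _; congr f.
apply/matrixP => i j; rewrite !mxE.
by rewrite -!(tnth_nth _ _ (Ordinal (ltn_sym_index i j))) tnth_mktuple.
Qed.

Let symseq d (s : seq R) : 'M[R]_d := \matrix_(i, j) nth 0 s (sym_index i j).

Let rowseq d (s : seq R) : 'rV[R]_d := \row_j nth 0 s j.

(** Since the upper triangle is listed column by column, appending a column and a corner to the list
    is bordering the matrix. *)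
Let symseqS d (s v : seq R) x : size s = symdim d -> size v = d ->
  symseq d.+1 (s ++ (v ++ [:: x])) = border (symseq d s) (rowseq d v) x.
Proof.
move=> ss sv; apply/matrixP => i j.
have liftE (k : 'I_d) : lift ord_max k = k :> nat.
  by rewrite /= /bump leqNgt ltn_ord.
have nthE (k : 'I_d) : nth 0 (s ++ v ++ [:: x]) (symdim d + k) = nth 0 v k.
  by rewrite nth_cat ss ltnNge leq_addr/= addKn nth_cat sv ltn_ord.
have kd (k : 'I_d) := ltnW (ltn_ord k).
case: (unliftP ord_max i) => [i' ->|->]; case: (unliftP ord_max j) => [j' ->|->];
  rewrite borderE !mxE ?liftE/=.
- by rewrite nth_cat ss ltn_sym_index.
- by rewrite /sym_index (maxn_idPr (kd i')) (minn_idPl (kd i')) nthE.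
- by rewrite /sym_index (maxn_idPl (kd j')) (minn_idPr (kd j')) nthE.
- by rewrite /sym_index maxnn minnn nth_cat ss ltnNge leq_addr/= addKn nth_cat sv
    ltnn subnn.
Qed.

Let measurable_nth n k :
  measurable_fun [set: n.-tuple T] (fun t : n.-tuple T => nth (0 : R) t k : T).
Proof.
have [kn|nk] := ltnP k n.
  rewrite (_ : (fun _ => _) = @tnth _ T ^~ (Ordinal kn)).
    exact: measurable_tnth.
  by apply/funext => t; rewrite (tnth_nth 0).
rewrite (_ : (fun _ => _) = cst 0); first exact: measurable_cst.
by apply/funext => t; rewrite nth_default ?size_tuple.
Qed.

Let measurable_symseq d n :
  measurable_fun [set: n.-tuple T] (fun t : n.-tuple T => symseq d t).
Proof.
apply: measurable_fun_mx => i j; under eq_fun do rewrite mxE.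
exact: measurable_nth.
Qed.

Definition row_of_tuple d (t : d.-tuple T) : 'rV[R]_d := \row_j tnth t j.

(** The corner is integrated last and the block [Y] first, so that for fixed [x] and [v] the block
    can be translated to its Schur complement. *)
Lemma integral_lebesgue_symS d (f : 'M[R]_d.+1 -> \bar R) :
  (forall X, 0 <= f X)%E -> measurable_fun [set: 'M[R]_d.+1] f ->
  (\int[lebesgue_sym d.+1]_X f X =
   \int[leb]_x \int[lt d]_v \int[lebesgue_sym d]_Y
     f (border Y (row_of_tuple v) x))%E.
Proof.
move=> f0 mf; rewrite integral_lebesgue_sym//.
pose F s := f (symseq d.+1 s).
have F0 s : (0 <= F s)%E by exact: f0.
have mF k : measurable_fun [set: k.-tuple T] (fun t : k.-tuple T => F t).
  exact: (measurableT_comp mf (@measurable_symseq d.+1 k)).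
rewrite -[LHS]/(\int[lt (symdim d.+1)]_t F t)%E symdimS.
rewrite integral_lebesgue_tuple_cat//.
rewrite (tonelli (fun (s : (symdim d).-tuple T) (u : d.+1.-tuple T) => F (s ++ u)));
  [|by []|]; last first.
  apply: (measurableT_comp (mF (symdim d + d.+1)%N)).
  exact: measurable_cat_tuple measurable_fst measurable_snd.
pose G (u : seq R) := (\int[lt (symdim d)]_s F (s ++ u))%E.
have G0 u : (0 <= G u)%E by exact: integral_ge0.
have mG k : measurable_fun [set: k.-tuple T] (fun t : k.-tuple T => G t).
  apply: (measurable_fun_integral
    (fun (u : k.-tuple T) (s : (symdim d).-tuple T) => F (s ++ u))) => //.
  have mc : measurable_fun [set: k.-tuple T * (symdim d).-tuple T]
      (fun p => [tuple of p.2 ++ p.1] : (symdim d + k).-tuple T).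
    exact: measurable_cat_tuple measurable_snd measurable_fst.
  exact: (measurableT_comp (mF (symdim d + k)%N) mc).
rewrite -[LHS]/(\int[lt d.+1]_t G t)%E -addn1 integral_lebesgue_tuple_cat//.
have GE u : G u = (\int[lt (symdim d)]_s F (s ++ u))%E by [].
clearbody G.
have mGc (v : d.-tuple T) k :
    measurable_fun [set: k.-tuple T] (fun t : k.-tuple T => G (v ++ t)).
  have mc : measurable_fun [set: k.-tuple T]
      (fun t => [tuple of v ++ t] : (d + k).-tuple T).
    by apply: measurable_cat_tuple.
  exact: (measurableT_comp (mG (d + k)%N) mc).
under eq_integral => v _ do
  rewrite (integral_lebesgue_tuple1 (F := fun t => G (v ++ t)))//.
have mGvx : measurable_fun [set: d.-tuple T * T] (fun p => G (p.1 ++ [:: p.2])).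
  have mx : measurable_fun [set: d.-tuple T * T]
      (fun p : d.-tuple T * T => [tuple of p.2 :: [tuple]] : 1.-tuple T).
    by apply: measurable_cons => //; exact: measurable_cst.
  exact: (measurableT_comp (mG (d + 1)%N) (measurable_cat_tuple measurable_fst mx)).
have G0' (v : d.-tuple T) (x : T) : (0 <= G (v ++ [:: x]))%E by exact: G0.
transitivity (\int[leb]_x \int[lt d]_v G (v ++ [:: x]))%E.
  exact: (@tonelli _ _ _ _ _ leb _ G0' mGvx (lt d)).
apply: eq_integral => x _; apply: eq_integral => v _.
rewrite GE integral_lebesgue_sym//; last first.
  by apply: (measurableT_comp mf); exact: measurable_border.
apply: eq_integral => s _; rewrite /F symseqS ?size_tuple//.
congr (f (border _ _ _)).
by apply/rowP => j; rewrite !mxE (tnth_nth 0).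
Qed.

End sym_integral.

(** * Gamma and Gaussian integrals on the line *)

Section gamma_integral_finite.
Context {R : realType}.
Notation leb := (@lebesgue_measure R).
Let T := measurableTypeR R.

Lemma continuous_powR (b x : R) : 0 < x -> {for x, continuous (fun y => y `^ b)}.
Proof.
move=> x0; apply/differentiable_continuous/derivable1_diffP.
by apply: derivable_powR; rewrite in_itv/= x0.
Qed.

(** The interval is exhausted by the intervals from [1/(n+2)] to 1, nondegenerate for every [n], on
    which the fundamental theorem of calculus bounds the integral by [1/(b+1)]. *)
Lemma integral_powR_01 (b : R) : -1 < b ->
  (\int[leb]_(x in `]0%R, 1%R]) (x `^ b)%:E < +oo)%E.
Proof.
move=> b1; have b10 : 0 < b + 1 by lra.
pose F n := `[(n.+2%:R : R)^-1, 1%R]%classic.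
have n1 n : (n.+2%:R : R)^-1 < 1 by rewrite invf_lt1 ?ltr1n ?ltr0n.
have n0 n : 0 < (n.+2%:R : R)^-1 by rewrite invr_gt0 ltr0n.
have mp D : measurable_fun D (fun x : T => (x `^ b)%:E).
  apply/measurable_EFinP; apply: measurable_funTS; exact: measurable_powR.
have ndF : nondecreasing_seq F.
  move=> m n mn; apply/subsetPset => x; rewrite /F/= !in_itv/= => /andP[mx ->].
  by rewrite andbT (le_trans _ mx)// lef_pV2 ?posrE ?ltr0n// ler_nat !ltnS.
have FE : \bigcup_n F n = `]0%R, 1%R]%classic.
  apply/seteqP; split=> [x [n _]|x].
    by rewrite /F/= !in_itv/= => /andP[nx ->]; rewrite (lt_le_trans (n0 n) nx).
  rewrite /= in_itv/= => /andP[x0 x1].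
  have /ltr_add_invr[k] := x0; rewrite add0r => kx.
  exists k => //; rewrite /F/= in_itv/= x1 andbT (le_trans _ (ltW kx))//.
  by rewrite lef_pV2 ?posrE ?ltr0n// ler_nat.
have cF : (\int[leb]_(x in F n) (x `^ b)%:E @[n --> \oo] -->
    \int[leb]_(x in \bigcup_n F n) (x `^ b)%:E)%E.
  apply: ge0_nondecreasing_set_cvg_integral => // n.
    exact: measurable_itv.
  by move=> x _; rewrite lee_fin powR_ge0.
rewrite -FE -(cvg_lim _ cF)//.
apply: (@le_lt_trans _ _ ((b + 1)^-1)%:E); last exact: ltry.
apply: lime_le; first by apply/cvg_ex; eexists; exact: cF.
apply: nearW => n.
pose G (x : R) := (b + 1)^-1 * x `^ (b + 1).
have dG (x : R) : 0 < x -> is_derive x 1 G (x `^ b).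
  move=> x0; rewrite /G; have := is_derive1_powR (b + 1) x0 => dp.
  rewrite (_ : x `^ b = (b + 1)^-1 * ((b + 1) * x `^ (b + 1 - 1))).
    exact: is_deriveZ.
  by rewrite mulKf ?gt_eqF// addrK.
have cG (x : R) : 0 < x -> {for x, continuous G}.
  move=> x0; apply/differentiable_continuous/derivable1_diffP.
  by have [] := dG x x0.
rewrite (@continuous_FTC2 R (fun x => x `^ b) G)//.
- rewrite -EFinB lee_fin /G powR1 mulr1 gerBl.
  by rewrite mulr_ge0 ?powR_ge0// invr_ge0 ltW.
- apply: continuous_in_subspaceT => x; rewrite inE/= in_itv/= => /andP[nx _].
  by apply: continuous_powR; exact: lt_le_trans (n0 n) nx.
- split=> [x||].
  + by rewrite in_itv/= => /andP[nx _]; have [] := dG x (lt_trans (n0 n) nx).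
  + by apply: cvg_at_right_filter; exact: cG.
  + by apply: cvg_at_left_filter; exact: cG.
- move=> x; rewrite in_itv/= => /andP[nx _]; rewrite derive1E.
  by have [_ ->] := dG x (lt_trans (n0 n) nx).
Qed.

Let measurable_gam (b : R) D :
  measurable_fun D (fun x : T => (expR (- x) * x `^ b)%:E).
Proof.
apply/measurable_EFinP; apply: measurable_funTS; apply: measurable_funM.
  by apply: measurableT_comp => //; exact: measurable_funN.
exact: measurable_powR.
Qed.

Lemma integral_gamma_fin (b : R) : -1 < b ->
  (\int[leb]_(x in `]0%R, +oo[) (expR (- x) * x `^ b)%:E < +oo)%E.
Proof.
move=> b1.
have g0 x : (0 <= (expR (- x) * x `^ b)%:E)%E.
  by rewrite lee_fin mulr_ge0 ?expR_ge0 ?powR_ge0.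
rewrite (_ : `]0%R, +oo[%classic = `]0%R, 1%R] `|` `]1%R, +oo[); last first.
  by rewrite -itv_bndbnd_setU// bnd_simp.
rewrite ge0_integral_setU//=; last first.
  apply/disj_set2P/seteqP; split => // x [] /=; rewrite !in_itv/= andbT.
  by move=> /andP[_ x1] x2; have := le_lt_trans x1 x2; rewrite ltxx.
apply: lte_add_pinfty.
  apply: le_lt_trans (integral_powR_01 b1); apply: ge0_le_integral => //=.
  - apply/measurable_EFinP; apply: measurable_funTS; exact: measurable_powR.
  - move=> x; rewrite in_itv/= => /andP[x0 _].
    by rewrite lee_fin ler_piMl ?powR_ge0// -expR0 ler_expR oppr_le0 ltW.
(* Past 1 the comparison is with the exponential density of rate 1/2. The inequality [ln y < y] at
   [y = x/(2B)] gives [B ln x <= x/2 + B ln (2B)], whence [C]; its factor 2 cancels the rate in the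
   density. *)
pose B := `|b| + 1; have B0 : 0 < B by rewrite /B ltr_wpDl.
pose C := 2 * expR (B * ln (2 * B)).
have C0 : 0 <= C by rewrite mulr_ge0 ?expR_ge0.
apply: (@le_lt_trans _ _ (\int[leb]_(x in setT)
    (C%:E * (exponential_pdf (2^-1 : R) x)%:E))%E).
  apply: (@le_trans _ _ (\int[leb]_(x in `]1%R, +oo[)
    (C%:E * (exponential_pdf (2^-1 : R) x)%:E))%E); last first.
    apply: ge0_subset_integral => //=.
      apply: measurable_funeM; apply/measurable_EFinP.
      exact: measurable_exponential_pdf.
    by move=> x _; rewrite -EFinM lee_fin mulr_ge0// exponential_pdf_ge0.
  apply: ge0_le_integral => //=.
  - apply: measurable_funeM; apply/measurable_EFinP; apply: measurable_funTS.
    exact: measurable_exponential_pdf.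
  - move=> x; rewrite in_itv/= andbT => x1; have x0 : 0 < x by lra.
    rewrite exponential_pdfE ?(ltW x0)// -EFinM lee_fin /powR gt_eqF// -expRD.
    rewrite /C mulrACA divff// mul1r -expRD ler_expR.
    have lx0 : 0 <= ln x by rewrite ln_ge0// ltW.
    have h1 : b * ln x <= B * ln x.
      by rewrite ler_wpM2r// (le_trans (ler_norm b))// /B lerDl.
    have h2 : ln x <= x / (2 * B) + ln (2 * B).
      have B2 : 0 < 2 * B by lra.
      rewrite -[in leLHS](divfK (lt0r_neq0 B2) x) lnM ?posrE ?divr_gt0//.
      by rewrite lerD2r ltW// ln_sublinear// divr_gt0.
    have h3 : B * ln x <= B * (x / (2 * B) + ln (2 * B)) by rewrite ler_wpM2l// ltW.
    have h4 : B * (x / (2 * B)) = x / 2 by field; rewrite gt_eqF.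
    by move: h3; rewrite mulrDr h4; lra.
rewrite ge0_integralZl//; last 2 first.
- by apply/measurable_EFinP; exact: measurable_exponential_pdf.
- by move=> x _; rewrite lee_fin exponential_pdf_ge0.
by rewrite integral_exponential_pdf ?mule1 ?ltry// invr_gt0.
Qed.

Lemma integral_gamma_gt0 (b : R) :
  (0 < \int[leb]_(x in `]0%R, +oo[) (expR (- x) * x `^ b)%:E)%E.
Proof.
have g0 x : (0 <= (expR (- x) * x `^ b)%:E)%E.
  by rewrite lee_fin mulr_ge0 ?expR_ge0 ?powR_ge0.
(* A lower bound on []1, 2]], where [0 <= ln x <= 2]. *)
pose c := expR (- 2 - `|b| * 2).
apply: (@lt_le_trans _ _ (\int[leb]_(x in `]1%R, 2%R]) (cst c%:E x))%E).
  rewrite integral_cst//= lebesgue_measure_itv/= lte_fin ltr1n -EFinB -EFinM.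
  by rewrite lte_fin mulr_gt0 ?expR_gt0// subr_gt0 ltr1n.
apply: (@le_trans _ _ (\int[leb]_(x in `]1%R, 2%R]) (expR (- x) * x `^ b)%:E)%E).
  apply: ge0_le_integral => //=.
  - by move=> x _; rewrite lee_fin expR_ge0.
  - move=> x; rewrite in_itv/= => /andP[x1 x2]; have x0 : 0 < x by lra.
    rewrite lee_fin /powR gt_eqF// -expRD ler_expR /c.
    have l0 : 0 <= ln x by rewrite ln_ge0// ltW.
    have l2 : ln x <= 2 by rewrite (le_trans (ltW (ln_sublinear x0))).
    have : `|b * ln x| <= `|b| * 2 by rewrite normrM ler_wpM2l// ger0_norm.
    by rewrite ler_norml => /andP[h _]; lra.
apply: ge0_subset_integral; [exact: measurable_itv|exact: measurable_itv| | |].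
- exact: measurable_gam.
- by move=> x _; exact: g0.
- by move=> x /=; rewrite !in_itv/= andbT => /andP[x1 _]; lra.
Qed.

Lemma integral_gauss_scaled (x : R) : 0 < x ->
  (\int[leb]_t (expR (- (t ^+ 2 / x)))%:E = (Num.sqrt x * Num.sqrt pi)%:E)%E.
Proof.
move=> x0; have sx : 0 < Num.sqrt x by rewrite sqrtr_gt0.
have sx1 : 0 < (Num.sqrt x)^-1 by rewrite invr_gt0.
have h := @integral_affine R (Num.sqrt x)^-1 0 (fun t => (gauss_fun t)%:E) sx1.
rewrite EFinM -[X in (_ * X)%E]integralT_gauss -h; last 2 first.
- by move=> t; rewrite lee_fin gauss_fun_ge0.
- by apply/measurable_EFinP; exact: measurable_gauss_fun.
rewrite muleA -EFinM divff ?gt_eqF// mul1e; apply: eq_integral => t _.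
rewrite /gauss_fun addr0 exprMn exprVn sqr_sqrtr ?(ltW x0)//.
by rewrite [_^-1 * _]mulrC.
Qed.

Lemma integral_gauss_tuple n (x : R) : 0 < x ->
  (\int[@lebesgue_tuple R n]_v (expR (- ((\sum_i tnth v i ^+ 2) / x)))%:E =
   ((Num.sqrt x * Num.sqrt pi) ^+ n)%:E)%E.
Proof.
move=> x0; pose f n (v : n.-tuple T) := (expR (- ((\sum_i tnth v i ^+ 2) / x)))%:E.
have mf m : measurable_fun [set: m.-tuple T] (f m).
  apply/measurable_EFinP; apply: measurableT_comp => //.
  apply: measurable_funN; apply: measurable_funM => //.
  by apply: measurable_sum => i; apply: measurable_funX; exact: measurable_tnth.
have f0 m v : (0 <= f m v)%E by rewrite lee_fin expR_ge0.
rewrite -[LHS]/(\int[lebesgue_tuple n]_v f n v)%E.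
elim: n => [|n ih].
  rewrite (_ : (fun v => f 0 v) = cst 1%E).
    by rewrite integral_cst//= diracT mule1.
  by apply/funext => v; rewrite /f big_ord0 mul0r oppr0 expR0.
rewrite integral_lebesgue_tupleS//.
under eq_integral => t _.
  have -> : (\int[lebesgue_tuple n]_v f n.+1 [tuple of t :: v] =
      (expR (- (t ^+ 2 / x)))%:E * \int[lebesgue_tuple n]_v f n v)%E.
    rewrite -ge0_integralZl;
      [|by []|exact: mf|by move=> *; exact: f0|by rewrite lee_fin expR_ge0].
    apply: eq_integral => v _; rewrite /f -EFinM -expRD big_ord_recl tnth0.
    rewrite (eq_bigr (fun i => tnth v i ^+ 2)) => [|i _]; last by rewrite tnthS.
    by rewrite mulrDl opprD.
  over.
rewrite ih ge0_integralZr//.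
- by rewrite integral_gauss_scaled// -EFinM exprS.
- apply/measurable_EFinP; apply: measurableT_comp => //.
  by apply: measurable_funN; apply: measurable_funM => //; exact: measurable_funX.
Qed.

End gamma_integral_finite.

(** * The multivariate Gamma integral is positive and finite *)

Section siegel.
Context {R : realType}.
Let T := measurableTypeR R.
Notation leb := (@lebesgue_measure R).

(** Integrand of the multivariate Gamma function, with [a] in the place of [eta - (d+1)/2]; in this
    parametrisation the exponent stays fixed when the size decreases. *)
Definition siegel_density d (a : R) (X : 'M[R]_d) : R :=
  \1_(pdmx d) X * (expR (- \tr X) * (\det X) `^ a).

Lemma siegel_density_ge0 d a (X : 'M[R]_d) : 0 <= siegel_density a X.
Proof.
by rewrite /siegel_density indicE !mulr_ge0 ?expR_ge0 ?powR_ge0.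
Qed.

Lemma measurable_siegel_density d (a : R) :
  measurable_fun [set: 'M[R]_d] (@siegel_density d a : _ -> measurableTypeR R).
Proof.
apply: measurable_funM; first by apply: measurable_indic; exact: measurable_pdmx.
apply: measurable_funM.
  by apply: measurableT_comp => //; apply: measurable_funN; exact: measurable_mxtrace.
apply: (@measurableT_comp _ _ _ _ _ _ (fun x : T => x `^ a : T)).
  exact: measurable_powR.
exact: measurable_det.
Qed.

Definition siegel_integral d (a : R) : \bar R :=
  (\int[lebesgue_sym d]_X (siegel_density a X)%:E)%E.

(** After the translation the Schur complement is [Y] itself, the determinant is [x * \det Y] and
    the trace gains [|v|^2 / x]. The density splits into a Gamma factor in [x], a Gaussian in [v]
    and the density one size smaller. *)
Lemma siegel_density_border d a (Y : 'M[R]_d) v (x : R) :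
  siegel_density a (border (Y + x^-1 *: (v^T *m v)) v x) =
  \1_(`]0%R, +oo[%classic) x * (expR (- x) * x `^ a) *
    expR (- (qform 1%:M v / x)) * siegel_density a Y.
Proof.
have sY : schur (Y + x^-1 *: (v^T *m v)) v x = Y by rewrite /schur addrK.
rewrite /siegel_density !indicE; have [x0|x0] := ltP 0 x; last first.
  rewrite memNset ?mul0r; last first.
    by move=> /pdmx_border[]; rewrite ltNge x0.
  by rewrite memNset ?mul0r//= in_itv/= andbT ltNge x0.
rewrite (mem_set (A := `]0, +oo[%classic)) ?mul1r; last by rewrite /= in_itv/= x0.
have [pY|pY] := boolP (Y \in pdmx d); last first.
  rewrite memNset ?mul0r ?mulr0// => /pdmx_border[_].
  by rewrite sY => /mem_set; rewrite (negbTE pY).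
rewrite mem_set ?mul1r; last by apply/pdmx_border; rewrite sY; split => //; exact/set_mem.
rewrite det_border ?gt_eqF// sY powRM ?(ltW x0)//; last first.
  exact/ltW/det_pdmx_gt0/set_mem.
rewrite mxtrace_border (mxtrace_schur _ v x) sY !opprD !expRD [x^-1 * _]mulrC.
ring.
Qed.

(** The Gaussian integral over [v] equals [(pi x)^(d/2)], which raises the exponent of [x] from [a]
    to [a + d/2]. *)
Lemma siegel_integralS d (a : R) : -1 < a ->
  (siegel_integral d.+1 a = siegel_integral d a *
    (\int[leb]_(x in `]0%R, +oo[) (expR (- x) * x `^ (a + d%:R / 2))%:E *
     (Num.sqrt pi ^+ d)%:E))%E.
Proof.
move=> a1.
have ms n : measurable_fun [set: 'M[R]_n] (EFin \o @siegel_density n a).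
  by apply/measurable_EFinP; exact: measurable_siegel_density.
have s0 n (X : 'M[R]_n) : (0 <= (siegel_density a X)%:E)%E.
  by rewrite lee_fin siegel_density_ge0.
have I0 n : (0 <= siegel_integral n a)%E by exact: integral_ge0.
rewrite {1}/siegel_integral integral_lebesgue_symS//.
pose h (x : R) := \1_(`]0%R, +oo[%classic) x * (expR (- x) * x `^ a).
have h0 x : 0 <= h x by rewrite /h indicE !mulr_ge0 ?expR_ge0 ?powR_ge0.
have qE (v : d.-tuple T) : qform 1%:M (row_of_tuple v) = \sum_i tnth v i ^+ 2.
  by rewrite qform1; apply: eq_bigr => i _; rewrite mxE.
have mq (x : R) : measurable_fun [set: d.-tuple T] (fun v : d.-tuple T =>
    expR (- (qform 1%:M (row_of_tuple v) / x)) : T).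
  under eq_fun do rewrite qE.
  apply: measurableT_comp => //; apply: measurable_funN; apply: measurable_funM => //.
  by apply: measurable_sum => i; apply: measurable_funX; exact: measurable_tnth.
transitivity (\int[leb]_x ((h x * (Num.sqrt x * Num.sqrt pi) ^+ d)%:E *
    siegel_integral d a))%E.
  apply: eq_integral => x _.
  transitivity (\int[lebesgue_tuple d]_v ((h x)%:E *
      (expR (- (qform 1%:M (row_of_tuple v) / x)))%:E * siegel_integral d a))%E.
    apply: eq_integral => v _.
    move: (row_of_tuple v) => u.
    rewrite -[LHS](@integral_lebesgue_sym_affine R d 1 (x^-1 *: (u^T *m u))
      (fun Y => (siegel_density a (border Y u x))%:E) ltr01); last 3 first.
    - by rewrite linearZ/= trmx_mul trmxK.
    - by move=> Y; exact: s0.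
    - by apply: (measurableT_comp (ms d.+1)); exact: measurable_border.
    rewrite expr1n mul1e.
    under eq_integral do rewrite scale1r siegel_density_border -/(h x) EFinM.
    rewrite ge0_integralZl; [|by []|exact: ms|by move=> *; exact: s0|].
      by rewrite EFinM.
    by rewrite lee_fin mulr_ge0 ?expR_ge0.
  under eq_integral do rewrite -muleA.
  rewrite ge0_integralZl//; last 3 first.
  - apply: emeasurable_funM => //; apply/measurable_EFinP; exact: mq.
  - by move=> v _; rewrite mule_ge0// lee_fin expR_ge0.
  - by rewrite lee_fin.
  rewrite ge0_integralZr//; last by apply/measurable_EFinP; exact: mq.
  rewrite muleA; congr (_ * _)%E.
  have [x0|x0] := ltP 0 x; last first.
    rewrite /h indicE memNset ?mul0r ?mul0e//.
    by rewrite /= in_itv/= andbT ltNge x0.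
  rewrite [RHS]EFinM; congr (_ * _)%E; rewrite -[RHS](integral_gauss_tuple d x0).
  by apply: eq_integral => v _; rewrite qE.
have mh : measurable_fun [set: T] (h : T -> T).
  apply: measurable_funM; first by apply: measurable_indic.
  apply: measurable_funM; last exact: measurable_powR.
  by apply: measurableT_comp => //; exact: measurable_funN.
have msq : measurable_fun [set: T] (@Num.sqrt R : T -> T).
  by apply: continuous_measurable_fun; exact: sqrt_continuous.
rewrite ge0_integralZr//; last 2 first.
- apply/measurable_EFinP/measurable_funM => //.
  by apply: measurable_funX; apply: measurable_funM.
- by move=> x _; rewrite lee_fin mulr_ge0// exprn_ge0// mulr_ge0 ?sqrtr_ge0.
rewrite muleC; congr (_ * _)%E; rewrite -ge0_integralZr//; last 2 first.
- apply/measurable_EFinP; apply: measurable_funTS; apply: measurable_funM.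
    by apply: measurableT_comp => //; exact: measurable_funN.
  exact: measurable_powR.
- by move=> x _; rewrite lee_fin mulr_ge0 ?expR_ge0 ?powR_ge0.
rewrite [RHS]integral_mkcond; apply: eq_integral => x _.
rewrite patchE /h indicE; case: ifPn => [|_]; last by rewrite mul0r mul0r.
rewrite inE/= in_itv/= andbT => x0.
rewrite -EFinM mul1r exprMn mulrA; congr (_ * _)%:E.
rewrite -mulrA; congr (_ * _); rewrite powRD; last by rewrite (gt_eqF x0) implybT.
congr (_ * _); rewrite -powR12_sqrt ?(ltW x0)// -powR_mulrn ?powR_ge0// -powRrM.
by rewrite mulrC.
Qed.

Lemma siegel_integral_gt0_fin d (a : R) : -1 < a ->
  (0 < siegel_integral d a < +oo)%E.
Proof.
move=> a1; elim: d => [|d /andP[ih0 ihy]].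
  rewrite /siegel_integral integral_lebesgue_sym//=; last 2 first.
  - by move=> X; rewrite lee_fin siegel_density_ge0.
  - by apply/measurable_EFinP; exact: measurable_siegel_density.
  rewrite (@integral_lebesgue_tuple0 R (fun t => (siegel_density a
    (\matrix_(i < 0, j < 0) nth 0 t (sym_index i j) : 'M[R]_0))%:E)).
  rewrite /siegel_density indicE mem_set; last first.
    by split=> [|v]; [apply/matrixP => -[]|rewrite [v]thinmx0 eqxx].
  by rewrite det_mx00 powR1 /mxtrace big_ord0 oppr0 expR0 !mulr1 lte_fin ltr01 ltry.
rewrite siegel_integralS//.
set b := a + d%:R / 2; have b1 : -1 < b.
  by rewrite /b (lt_le_trans a1)// lerDl divr_ge0.
have g0 := integral_gamma_gt0 b; have gy := integral_gamma_fin b1.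
have p0 : 0 < Num.sqrt (@pi R) ^+ d by rewrite exprn_gt0// sqrtr_gt0 pi_gt0.
apply/andP; split; first by rewrite mule_gt0// mule_gt0// lte_fin.
rewrite lte_mul_pinfty ?(ltW ih0)//; first by rewrite ge0_fin_numE ?(ltW ih0).
by rewrite lte_mul_pinfty ?(ltW g0) ?ltry// ge0_fin_numE ?(ltW g0).
Qed.

End siegel.

(** * Differences of measures and stationary laws by regeneration *)

Section probability_of_measure.
Context d (T : measurableType d) (R : realType).
Variables (mu : {measure set T -> \bar R}).
Hypothesis mu1 : mu setT = 1%E.

Definition probability_of_measure of mu setT = 1%E : set T -> \bar R := mu.

HB.instance Definition _ := Measure.copy (probability_of_measure mu1) mu.

HB.instance Definition _ :=
  Measure_isProbability.Build _ _ _ (probability_of_measure mu1) mu1.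

End probability_of_measure.

Section measure_difference.
Context d (T : measurableType d) (R : realType).
Variables mu nu : {measure set T -> \bar R}.
Hypothesis nu_le_mu : forall A, measurable A -> (nu A <= mu A)%E.
Hypothesis mu_fin : (mu setT < +oo)%E.
Local Open Scope ereal_scope.

(** The comparison of [nu] with [mu] is assumed on measurable sets, while a measure must be
    nonnegative on every set; the maximum with 0 covers the others. *)
Definition measure_diff
  of (forall A, measurable A -> nu A <= mu A) & mu setT < +oo :=
  fun A => maxe 0 (mu A - nu A).

Local Notation diff := (measure_diff nu_le_mu mu_fin).

Let mu_fin_num A : measurable A -> mu A \is a fin_num.
Proof.
move=> mA; rewrite ge0_fin_numE//; apply: le_lt_trans mu_fin.
by apply: le_measure => //; rewrite inE.
Qed.

Let nu_fin_num A : measurable A -> nu A \is a fin_num.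
Proof.
move=> mA; rewrite ge0_fin_numE//; apply: le_lt_trans (nu_le_mu mA) _.
by rewrite -ge0_fin_numE// mu_fin_num.
Qed.

Let diffE A : measurable A -> diff A = mu A - nu A.
Proof.
by move=> mA; apply/max_idPr; rewrite sube_ge0 ?nu_fin_num//; exact: nu_le_mu.
Qed.

Let diff0 : diff set0 = 0.
Proof. by rewrite diffE// !measure0 sube0. Qed.

Let diff_ge0 A : 0 <= diff A.
Proof. by rewrite le_max lexx. Qed.

Let diff_sigma_additive : semi_sigma_additive diff.
Proof.
move=> F mF tF mUF; rewrite diffE//.
rewrite (_ : (fun n => _) = (fun n => \sum_(0 <= i < n) mu (F i)) \-
    (fun n => \sum_(0 <= i < n) nu (F i))); last first.
  apply/funext => n /=; rewrite -fin_num_sumeN => [|i _]; last exact: nu_fin_num.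
  by rewrite -big_split/=; apply: eq_bigr => i _; rewrite diffE.
apply: cvgeB; first by rewrite fin_num_adde_defr// mu_fin_num.
  exact: measure_semi_sigma_additive.
exact: measure_semi_sigma_additive.
Qed.

HB.instance Definition _ := isMeasure.Build _ _ _ diff
  diff0 diff_ge0 diff_sigma_additive.

Lemma measure_diffK A : measurable A -> diff A + nu A = mu A.
Proof. by move=> mA; rewrite diffE// subeK// nu_fin_num. Qed.

End measure_difference.

Section stationary.
Context d (T : measurableType d) (R : realType).
Variables (K : T -> {measure set T -> \bar R}).
Hypothesis mK : forall U, measurable U -> measurable_fun [set: T] (fun x => K x U).
Hypothesis K1 : forall x, K x setT = 1%E.
Variables (lam : {measure set T -> \bar R}) (s V : T -> R).
Hypotheses (s0 : forall x, 0 <= s x) (V0 : forall x, 0 <= V x).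
Hypothesis ms : measurable_fun [set: T] (EFin \o s).
Hypothesis mV : measurable_fun [set: T] (EFin \o V).
Local Open Scope ereal_scope.
Hypothesis lamT_gt0 : 0 < lam setT.
Hypothesis lamV : \int[lam]_x (V x)%:E < +oo.
Hypothesis minor : forall x A, measurable A -> (s x)%:E * lam A <= K x A.
Hypothesis drift : forall x,
  \int[K x]_y (V y)%:E + 1 <= (V x)%:E + (s x)%:E * \int[lam]_y (V y)%:E.

Let slam x : {measure set T -> \bar R} := mscale (NngNum (s0 x)) lam.

Let slam_le x A : measurable A -> slam x A <= K x A.
Proof. exact: minor. Qed.

Let KT x : K x setT < +oo.
Proof. by rewrite K1 ltry. Qed.

(** Nummelin splitting: with weight [s x] the chain restarts from [lam], and [Q x] is the rest of
    [K x]. *)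
Let Q x : {measure set T -> \bar R} := measure_diff (slam_le x) (KT x).

Let QE x A : measurable A -> Q x A + (s x)%:E * lam A = K x A.
Proof. exact: measure_diffK. Qed.

Let mQ U : measurable U -> measurable_fun [set: T] (fun x => Q x U).
Proof.
move=> mU; apply: measurable_maxe => //; apply: emeasurable_funB; first exact: mK.
exact: emeasurable_funM.
Qed.

Let lamV_fin : \int[lam]_x (V x)%:E \is a fin_num.
Proof. by rewrite ge0_fin_numE// integral_ge0// => x _; rewrite lee_fin. Qed.

Let integral_Q f x : (forall y, 0 <= f y) -> measurable_fun setT f ->
  \int[K x]_y f y = \int[Q x]_y f y + (s x)%:E * \int[lam]_y f y.
Proof.
move=> f0 mf; transitivity (\int[measure_add (Q x) (slam x)]_y f y).
  apply: eq_measure_integral => A mA _; rewrite -QE//.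
  by rewrite [RHS]measure_addE.
by rewrite ge0_integral_measure_add// ge0_integral_mscale.
Qed.

(** Removing the minorising part cancels exactly the growth that [drift] allows, so [V] decreases by
    at least 1 under [Q]. *)
Let driftQ x : \int[Q x]_y (V y)%:E + 1 <= (V x)%:E.
Proof.
have := drift x; rewrite integral_Q//.
rewrite addeAC leeD2rE// fin_numM//.
Qed.

Fixpoint excursion n : {measure set T -> \bar R} :=
  if n is n'.+1 then mixture (excursion n') mQ else lam.

Let V0E x : 0 <= (V x)%:E.
Proof. by rewrite lee_fin. Qed.

(** Each step lowers the integral of [V] by at least the mass still alive. The expected length of a
    cycle is therefore at most the integral of [V] against [lam]. *)
Let excursion_mass N :
  \sum_(0 <= n < N) excursion n setT + \int[excursion N]_x (V x)%:E <=
  \int[lam]_x (V x)%:E.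
Proof.
elim: N => [|N ih]; first by rewrite big_nil add0e.
apply: le_trans ih; rewrite big_nat_recr//= -addeA leeD2l//.
rewrite integral_mixture// -[X in X + _]mul1e -integral_cst// -ge0_integralD//.
- apply: ge0_le_integral => //.
  + by move=> x _; rewrite adde_ge0// integral_ge0.
  + apply: emeasurable_funD; first exact: measurable_cst.
    exact: (measurable_fun_integral_kernel mQ).
  + by move=> x _; rewrite addeC; exact: driftQ.
- by move=> x _; exact: integral_ge0.
- exact: (measurable_fun_integral_kernel mQ).
Qed.

(* Occupation measure of one regeneration cycle: start from [lam] and move by
   the residual kernel [Q x = K x - s x lam] until the cycle ends. *)
Let occ : {measure set T -> \bar R} := mseries excursion 0.

Let occT_fin : occ setT < +oo.
Proof.
apply: le_lt_trans lamV; rewrite /occ /= /mseries.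
apply: lime_le; first exact: is_cvg_nneseries.
apply: nearW => N; apply: le_trans (excursion_mass N).
by rewrite leeDl// integral_ge0.
Qed.

Let occ_fin A : measurable A -> occ A \is a fin_num.
Proof.
move=> mA; rewrite ge0_fin_numE//; apply: le_lt_trans occT_fin.
by apply: le_measure => //; rewrite inE.
Qed.

(** Shift of the series by one: an excursion starts from [lam], and every later term is the previous
    one moved by [Q]. *)
Let occE A : measurable A -> occ A = lam A + \int[occ]_x Q x A.
Proof.
move=> mA; rewrite ge0_integral_measure_series//; last exact: mQ.
rewrite /occ /= /mseries nneseries_recl//; congr (_ + _).
by rewrite -[LHS](nneseries_addn 1) => [|n]; [apply: eq_eseriesr => n _; rewrite addn1|].
Qed.

Let occK A : measurable A ->
  \int[occ]_x K x A = \int[occ]_x Q x A + (\int[occ]_x (s x)%:E) * lam A.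
Proof.
move=> mA; rewrite -ge0_integralZr//; last by move=> x _; rewrite lee_fin.
rewrite -ge0_integralD//; first by apply: eq_integral => x _; rewrite QE.
- exact: mQ.
- by move=> x _; rewrite mule_ge0// lee_fin.
- exact: emeasurable_funM.
Qed.

(** A cycle ends with probability 1: [K] preserves the total mass of [occ], so after cancelling the
    finite contribution of [Q] the mass of [lam] must equal itself times the integral of [s], and it
    is positive and finite. *)
Let occs : \int[occ]_x (s x)%:E = 1.
Proof.
have h : occ setT = \int[occ]_x Q x setT + (\int[occ]_x (s x)%:E) * lam setT.
  rewrite -occK//; under eq_integral do rewrite K1.
  by rewrite integral_cst// mul1e.
have QT : \int[occ]_x Q x setT \is a fin_num.
  have := occ_fin measurableT; rewrite occE//.
  by rewrite fin_numD => /andP[].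
have lT : lam setT \is a fin_num.
  by have := occ_fin measurableT; rewrite occE// fin_numD => /andP[].
move: h; rewrite occE// [RHS]addeC => /(congr1 (fun z => z - \int[occ]_x Q x setT)).
rewrite !addeK//.
move: lT lamT_gt0; case: (lam setT) => // l _; rewrite lte_fin => l0.
have : 0 <= \int[occ]_x (s x)%:E by apply: integral_ge0 => x _; rewrite lee_fin.
case: (\int[occ]_x (s x)%:E) => [r _|_|//].
  rewrite -EFinM => -[lE]; congr EFin.
  by apply: (mulIf (lt0r_neq0 l0)); rewrite mul1r -lE.
by rewrite mulyr gtr0_sg// mul1e.
Qed.

(** The occupation measure is invariant, since by [occs] the regenerated part of one step of [K] is
    exactly [lam], the measure that [Q] fails to reproduce. It is divided by its finite total
    mass. *)
Lemma exists_stationary_probability : exists P : probability T R,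
  forall A, measurable A -> P A = \int[P]_x K x A.
Proof.
have occT0 : (0 < fine (occ setT))%R.
  rewrite fine_gt0// occT_fin andbT (lt_le_trans lamT_gt0)// occE//.
  by rewrite leeDl// integral_ge0.
have c0 : (0 <= (fine (occ setT))^-1)%R by rewrite invr_ge0 ltW.
pose P0 : {measure set T -> \bar R} := mscale (NngNum c0) occ.
have P01 : P0 setT = 1.
  rewrite -[LHS]/((fine (occ setT))^-1%:E * occ setT).
  by rewrite -[X in _ * X]fineK ?occ_fin// -EFinM mulVf ?gt_eqF.
exists (probability_of_measure P01) => A mA.
transitivity (\int[P0]_x K x A); last by [].
rewrite ge0_integral_mscale//; last exact: mK.
rewrite occK// occs mul1e addeC -occE//.
Qed.

End stationary.

(** * Convolution powers and compound Poisson laws *)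

Section convolution.
Context {R : realType} {d : nat}.
Let M := 'M[R]_d.
Local Open Scope ereal_scope.

Lemma measurable_addl (x : M) : measurable_fun [set: M] (fun y => x + y)%R.
Proof. exact: measurable_mxD. Qed.

Lemma measurable_shift_measure (m : {finite_measure set M -> \bar R}) U :
  measurable U -> measurable_fun [set: M] (fun x => m [set y | U (x + y)%R]).
Proof.
move=> mU.
have mA : measurable ((fun p : M * M => p.1 + p.2)%R @^-1` U).
  by apply: measurable_preimage => //; exact: measurable_mxD.
have := @measurable_fun_xsection _ _ _ _ _ m _ mA.
apply: eq_measurable_fun => x _ /=; congr (m _).
by apply/seteqP; split => y; rewrite /xsection/= inE.
Qed.

Section conv_def.
Variables m1 m2 : {finite_measure set M -> \bar R}.

Let k (x : M) : {measure set M -> \bar R} := image_measure m2 (measurable_addl x).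

Let mk U : measurable U -> measurable_fun [set: M] (fun x => k x U).
Proof. exact: measurable_shift_measure. Qed.

Definition conv : set M -> \bar R := mixture m1 mk.

HB.instance Definition _ := Measure.copy conv (mixture m1 mk).

Lemma convE A : conv A = \int[m1]_x m2 [set y | A (x + y)%R].
Proof. by []. Qed.

Lemma integral_conv f : (forall x, 0 <= f x) -> measurable_fun [set: M] f ->
  \int[conv]_x f x = \int[m1]_x \int[m2]_y f (x + y)%R.
Proof.
move=> f0 mf; rewrite [LHS]integral_mixture//; apply: eq_integral => x _.
by rewrite integral_image_measure.
Qed.

Let conv_fin : fin_num_fun conv.
Proof.
have cT : conv setT = m2 setT * m1 setT.
  by rewrite convE -integral_cst//; apply: eq_integral => x _; congr (m2 _).
apply: lty_fin_num_fun; rewrite -[ltLHS]/(conv setT) cT.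
rewrite lte_mul_pinfty//; first exact: fin_num_measure.
by rewrite -ge0_fin_numE// fin_num_measure.
Qed.

HB.instance Definition _ := Measure_isFinite.Build _ _ _ conv conv_fin.

End conv_def.

Fixpoint mpow (m : {finite_measure set M -> \bar R}) n :
    {finite_measure set M -> \bar R} :=
  if n is n'.+1 then conv m (mpow m n') else \d_(0%R : M).

Lemma mpow1 (m : {finite_measure set M -> \bar R}) A : measurable A -> mpow m 1 A = m A.
Proof.
move=> mA; rewrite [LHS]convE; transitivity (\int[m]_x (\1_A x)%:E); last first.
  by rewrite integral_indic// setIT.
apply: eq_integral => x _; rewrite /= /dirac !indicE.
congr ((nat_of_bool _)%:R%:E).
by apply/idP/idP; rewrite !inE/= addr0.
Qed.

Lemma mpow_support (m : {finite_measure set M -> \bar R}) (S : set M) n : measurable S -> S 0%R ->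
  (forall x y, S x -> S y -> S (x + y)%R) -> m (~` S) = 0 -> mpow m n (~` S) = 0.
Proof.
move=> mS S0 SD mS0; have mC := measurableC mS.
elim: n => [|n ih]; first by rewrite /= /dirac indicE memNset// => /(_ S0).
have mshift x : measurable [set y | (~` S) (x + y)%R].
  exact: (measurable_preimage (measurable_addl x) mC).
rewrite [LHS]convE.
rewrite (ge0_negligible_integral mC measurableT _ _ mS0)//; last first.
  exact: (measurable_shift_measure (mpow m n) mC).
rewrite setTD setCK.
apply: integral0_eq => x Sx; apply/eqP; rewrite eq_le measure_ge0 andbT -ih.
apply: (le_measure (mpow m n)); rewrite ?inE; [exact: mshift|exact: mC|].
by move=> y /= nS Sy; apply: nS; exact: SD.
Qed.

Section multiplicative.
Variables (m : {finite_measure set M -> \bar R}) (f : M -> R) (r : R).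
Hypotheses (f0 : forall x, (0 <= f x)%R)
  (mf : measurable_fun [set: M] (EFin \o f)) (f1 : f 0%R = 1%R)
  (fD : forall x y, f (x + y)%R = (f x * f y)%R)
  (mr : \int[m]_x (f x)%:E = r%:E).

Let f0E x : 0 <= (f x)%:E. Proof. by rewrite lee_fin. Qed.

Lemma integral_mpow n : \int[mpow m n]_x (f x)%:E = (r ^+ n)%:E.
Proof.
elim: n => [|n ih]; first by rewrite integral_dirac// diracT mul1e f1.
rewrite [LHS]integral_conv//.
under eq_integral => x _.
  under eq_integral do rewrite fD EFinM.
  rewrite ge0_integralZl// ih; over.
by rewrite /= ge0_integralZr// ?mr -?EFinM ?exprS// lee_fin; move: mr;
  case: n {ih} => // n _; rewrite exprn_ge0// -lee_fin -mr integral_ge0.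
Qed.

End multiplicative.

Section compound_poisson.
Variable m : {finite_measure set M -> \bar R}.

Let mass : R := fine (m setT).

Let weight_ge0 n : (0 <= expR (- mass) / n`!%:R)%R.
Proof. by rewrite divr_ge0 ?expR_ge0. Qed.

(** The jump measure is not normalised: the factor [mass^n] of the Poisson weights is contained in
    [mpow m n]. *)
Definition compound_poisson : {measure set M -> \bar R} :=
  mseries (fun n => mscale (NngNum (weight_ge0 n)) (mpow m n)) 0.

(** A multiplicative function turns convolution powers into powers of [r], and the series becomes
    exponential. Growing exponentials are covered too, as long as their integral [r] is finite. *)
Lemma integral_compound_poisson (f : M -> R) (r : R) :
  (forall x, (0 <= f x)%R) -> measurable_fun [set: M] (EFin \o f) ->
  f 0%R = 1%R -> (forall x y, f (x + y)%R = (f x * f y)%R) ->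
  \int[m]_x (f x)%:E = r%:E ->
  \int[compound_poisson]_x (f x)%:E = (expR (r - fine (m setT)))%:E.
Proof.
move=> f0 mf f1 fD mr.
have r0 : (0 <= r)%R.
  by rewrite -lee_fin -mr; apply: integral_ge0 => x _; rewrite lee_fin.
rewrite ge0_integral_measure_series//; last by move=> x _; rewrite lee_fin.
transitivity (\sum_(n <oo) ((expR (- mass))%:E * (exp_coeff r n)%:E)).
  apply: eq_eseriesr => n _; rewrite ge0_integral_mscale//; last first.
    by move=> x _; rewrite lee_fin.
  by rewrite (integral_mpow f0 mf f1 fD mr)/= -!EFinM /exp_coeff/= mulrA mulrAC.
rewrite nneseriesZl; last first.
  by move=> n _; rewrite lee_fin /exp_coeff/= divr_ge0 ?exprn_ge0.
rewrite addrC expRD EFinM; congr (_ * _).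
rewrite (_ : expR r = limn (series (exp_coeff r)))// -EFin_lim; last exact: is_cvg_series_exp_coeff.
by apply/congr_lim/funext => n/=; rewrite /series/= -sumEFin.
Qed.

Lemma compound_poissonT : compound_poisson setT = 1.
Proof.
transitivity (\int[compound_poisson]_x ((cst 1%R : M -> R) x)%:E).
  by rewrite -[LHS]mul1e -integral_cst.
rewrite (@integral_compound_poisson (cst 1%R) (fine (m setT)))//.
- by rewrite subrr expR0.
- by apply/measurable_EFinP; exact: measurable_cst.
- by move=> x y; rewrite /= mulr1.
- by rewrite -[LHS]/(\int[m]_x cst 1 x) integral_cst// mul1e fineK// fin_num_measure.
Qed.

(** Only the term with exactly one jump is kept. This passes lower bounds on the jump density to the
    law of the sum. *)
Lemma compound_poisson_ge A : measurable A ->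
  (expR (- fine (m setT)))%:E * m A <= compound_poisson A.
Proof.
move=> mA; rewrite -(mpow1 m mA).
pose u n := (expR (- mass) / n`!%:R)%:E * mpow m n A.
have -> : compound_poisson A = \sum_(n <oo) u n by [].
have u0 n : 0 <= u n by rewrite mule_ge0// lee_fin.
rewrite (@nneseriesD1 _ _ 1%N)//=.
by rewrite {1}/u (_ : 1`!%:R = 1%R :> R)// divr1 leeDl// nneseries_ge0.
Qed.

Lemma compound_poisson_support (S : set M) : measurable S -> S 0%R ->
  (forall x y, S x -> S y -> S (x + y)%R) -> m (~` S) = 0 ->
  compound_poisson (~` S) = 0.
Proof.
move=> mS S0 SD mS0; rewrite /compound_poisson/= /mseries.
apply: eseries0 => n _ _.
rewrite -[LHS]/((expR (- mass) / n`!%:R)%:E * mpow m n (~` S)).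
by rewrite mpow_support// mule0.
Qed.

End compound_poisson.

Lemma conv_powE (Q : probability M R) n A : measurable A ->
  conv_pow Q n A = mpow Q n A.
Proof.
elim: n A => // n ih A mA; rewrite [RHS]convE; apply: eq_integral => x _.
exact: (ih _ (measurable_preimage (measurable_addl x) mA)).
Qed.

End convolution.

(** * The Laplace transform determines a law on the cone *)

(** The case of the open cone, applied to [X] plus a multiple of the identity too small for the
    trace of [Theta] to compensate a negative pairing. *)
Lemma mxtrace_mul_psdmx_ge0 {R : realType} d (Theta X : 'M[R]_d) :
  psdmx d Theta -> psdmx d X -> 0 <= \tr (Theta *m X).
Proof.
move=> pT pX; rewrite leNgt; apply/negP => neg.
have tT : 0 < 1 + \tr Theta by rewrite ltr_pwDl// mxtrace_psdmx_ge0.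
have : 0 < - \tr (Theta *m X) / (1 + \tr Theta) by rewrite divr_gt0// oppr_gt0.
move=> /ltr_add_invr[n]; rewrite add0r ltr_pdivlMr// => nv.
have /(mxtrace_mul_ge0 pT) := (psdmxP X).1 pX n.
rewrite mulmxDr linearD/= mul_mx_scalar linearZ/=.
have : 0 < n.+1%:R^-1 :> R by rewrite invr_gt0 ltr0n.
move: nv; rewrite mulrDr mulr1.
by move: (n.+1%:R^-1 * \tr Theta) (n.+1%:R^-1 : R) => v w; lra.
Qed.

Section laplace_uniqueness.
Context {R : realType} {d : nat}.
Notation M := 'M[R]_d.
Let T := measurableTypeR R.
Notation D := (psdmx d : set M).

Definition expfun (Theta X : M) : R := expR (- \tr (Theta *m X)).

Lemma measurable_expfun Theta : measurable_fun [set: M] (expfun Theta : M -> T).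
Proof.
apply: measurableT_comp => //; apply: measurable_funN.
by apply: measurable_mxtraceMl.
Qed.

Lemma expfun_ge0 Theta X : 0 <= expfun Theta X.
Proof. exact: expR_ge0. Qed.

Lemma expfun_le1 Theta X : psdmx d Theta -> psdmx d X -> expfun Theta X <= 1.
Proof.
by move=> pT pX; rewrite -expR0 ler_expR oppr_le0 mxtrace_mul_psdmx_ge0.
Qed.

Lemma expfunDl Theta Psi X : expfun (Theta + Psi) X = expfun Theta X * expfun Psi X.
Proof. by rewrite /expfun mulmxDl linearD/= opprD expRD. Qed.

Lemma expfunDr Theta X Y : expfun Theta (X + Y) = expfun Theta X * expfun Theta Y.
Proof. by rewrite /expfun mulmxDr linearD/= opprD expRD. Qed.

Lemma expfunr0 Theta : expfun Theta 0 = 1.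
Proof. by rewrite /expfun mulmx0 linear0 oppr0 expR0. Qed.

Lemma expfun0l X : expfun 0 X = 1.
Proof. by rewrite /expfun mul0mx linear0 oppr0 expR0. Qed.

Variables P Q : probability M R.
Hypotheses (PD : P (~` D) = 0%E) (QD : Q (~` D) = 0%E).
Hypothesis PQ : forall Theta, psdmx d Theta -> laplace P Theta = laplace Q Theta.

Let mD : measurable D.
Proof. exact: measurable_psdmx. Qed.

Let integralD (mu : probability M R) (f : M -> R) : mu (~` D) = 0%E ->
  (forall X, 0 <= f X) -> measurable_fun [set: M] (f : M -> T) ->
  (\int[mu]_X (f X)%:E = \int[mu]_(X in D) (f X)%:E)%E.
Proof.
move=> muD f0 mf; rewrite (ge0_negligible_integral _ measurableT _ _ muD)//.
- by rewrite setTD setCK.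
- exact: measurableC.
- exact/measurable_EFinP.
- by move=> X _; rewrite lee_fin.
Qed.

(** Functions that may be inserted into both Laplace integrals. Asking for equality at every [Theta]
    makes the class stable under multiplication by [expfun Psi], and the bounds allow dominated
    convergence. *)
Let test (f : M -> R) := [/\ measurable_fun [set: M] (f : M -> T),
  forall X, D X -> 0 <= f X <= 1 &
  forall Theta, psdmx d Theta ->
    (\int[P]_(X in D) (f X * expfun Theta X)%:E =
     \int[Q]_(X in D) (f X * expfun Theta X)%:E)%E].

Let integrable01 (mu : probability M R) (f : M -> R) :
  measurable_fun [set: M] (f : M -> T) -> (forall X, D X -> 0 <= f X <= 1) ->
  mu.-integrable D (EFin \o f).
Proof.
move=> mf f01; apply: (@le_integrable _ _ _ mu D mD _ (EFin \o cst 1)).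
- by apply/measurable_EFinP; exact: measurable_funTS.
- move=> X DX /=; have /andP[f0 f1] := f01 _ DX.
  by rewrite normr1 lee_fin ger0_norm.
- by apply: finite_measure_integrable_cst.
Qed.

Let mulexp01 f Theta X : test f -> psdmx d Theta -> D X ->
  0 <= f X * expfun Theta X <= 1.
Proof.
move=> [_ f01 _] pT DX; have /andP[f0 f1] := f01 _ DX.
by rewrite mulr_ge0 ?expfun_ge0// mulr_ile1 ?expfun_ge0// expfun_le1.
Qed.

Let measurable_mulexp f Theta : measurable_fun [set: M] (f : M -> T) ->
  measurable_fun [set: M] (fun X => f X * expfun Theta X : T).
Proof. by move=> mf; apply: measurable_funM => //; exact: measurable_expfun. Qed.

Let test1 : test (cst 1).
Proof.
split=> [//|X _|Theta pT]; first by rewrite /= ler01 lexx.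
under eq_integral do rewrite mul1r.
under [RHS]eq_integral do rewrite mul1r.
rewrite -!integralD//; first exact: PQ;
  by [exact: measurable_expfun|move=> X; exact: expfun_ge0].
Qed.

Let test_sub f g : test f -> test g -> (forall X, D X -> g X <= f X) ->
  test (fun X => f X - g X).
Proof.
move=> tf tg gf; have [mf f01 fE] := tf; have [mg g01 gE] := tg.
split; first exact: measurable_funB.
  move=> X DX; have /andP[f0 f1] := f01 _ DX; have /andP[g0 g1] := g01 _ DX.
  by rewrite subr_ge0 gf//= lerBlDr (le_trans f1)// lerDl.
move=> Theta pT.
have intg (mu : probability M R) : (\int[mu]_(X in D) ((f X - g X) * expfun Theta X)%:E =
    \int[mu]_(X in D) (f X * expfun Theta X)%:E -
    \int[mu]_(X in D) (g X * expfun Theta X)%:E)%E.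
  rewrite -integralB//; first by apply: eq_integral => X _; rewrite mulrBl.
    apply: integrable01; first exact: measurable_mulexp.
    by move=> X DX; exact: mulexp01.
  apply: integrable01; first exact: measurable_mulexp.
  by move=> X DX; exact: mulexp01.
by rewrite !intg fE// gE.
Qed.

Let test_exp f Psi : test f -> psdmx d Psi -> test (fun X => f X * expfun Psi X).
Proof.
move=> tf pPsi; have [mf f01 fE] := tf.
split; [exact: measurable_mulexp|by move=> X DX; exact: mulexp01|].
move=> Theta pT; under eq_integral do rewrite -mulrA -expfunDl.
under [RHS]eq_integral do rewrite -mulrA -expfunDl.
by apply: fE; exact: psdmxD.
Qed.

Let test_1exp f Psi : test f -> psdmx d Psi ->
  test (fun X => f X * (1 - expfun Psi X)).
Proof.
move=> tf pPsi; have := test_sub tf (test_exp tf pPsi).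
under [X in _ -> test X]eq_fun do rewrite mulrBr mulr1.
apply=> X DX; have [_ /(_ _ DX) /andP[f0 _] _] := tf.
by rewrite ler_piMr// expfun_le1.
Qed.

Let test_1exp_pow f Psi n : test f -> psdmx d Psi ->
  test (fun X => f X * (1 - expfun Psi X) ^+ n).
Proof.
move=> tf pPsi; elim: n => [|n ih].
  by under [X in test X]eq_fun do rewrite expr0 mulr1.
under [X in test X]eq_fun do rewrite exprSr mulrA.
exact: test_1exp.
Qed.

Let test_lim (f_ : (M -> R)^nat) f : (forall n, test (f_ n)) ->
  measurable_fun [set: M] (f : M -> T) ->
  (forall X, D X -> f_ n X @[n --> \oo] --> f X) -> test f.
Proof.
move=> tf mf ff.
have f01 X : D X -> 0 <= f X <= 1.
  move=> DX; rewrite -(cvg_lim _ (ff _ DX))//.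
  have cf : cvgn (fun n => f_ n X) by apply/cvg_ex; eexists; exact: ff.
  apply/andP; split.
    by apply: limr_ge => //; apply: nearW => n; have [_ /(_ _ DX)/andP[]] := tf n.
  by apply: limr_le => //; apply: nearW => n; have [_ /(_ _ DX)/andP[]] := tf n.
split => // Theta pT.
have cvgmu (mu : probability M R) :
    (\int[mu]_(X in D) (f_ n X * expfun Theta X)%:E @[n --> \oo] -->
     \int[mu]_(X in D) (f X * expfun Theta X)%:E)%E.
  have [] := @dominated_convergence _ _ _ mu D mD
    (fun n X => (f_ n X * expfun Theta X)%:E) (fun X => (f X * expfun Theta X)%:E)
    (EFin \o cst 1) => //.
  - move=> n; apply/measurable_EFinP; apply: measurable_funTS.
    by apply: measurable_mulexp; have [] := tf n.
  - by apply/measurable_EFinP; apply: measurable_funTS; exact: measurable_mulexp.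
  - apply/aeW => X DX; apply: cvg_EFin; first exact: nearW.
    by apply: cvgMr_tmp; exact: ff.
  - exact: finite_measure_integrable_cst.
  - apply/aeW => X n DX /=; have /andP[h0 h1] := mulexp01 (tf n) pT DX.
    by rewrite lee_fin ger0_norm.
rewrite -(cvg_lim _ (cvgmu P))// -(cvg_lim _ (cvgmu Q))//.
by apply/congr_lim/funext => n; have [_ _] := tf n; exact.
Qed.

Let invn_cvg0 : (n%:R : R)^-1 @[n --> \oo] --> (0 : R).
Proof.
rewrite -(cvg_shiftn 1); under eq_fun do rewrite addn1.
exact: cvg_harmonic.
Qed.

Let expR_ln2 n : 2 ^+ n = expR (n%:R * ln 2) :> R.
Proof. by rewrite mulr_natl -lnXn// lnK// posrE exprn_gt0. Qed.

(* With p_n(u) = (1 - e^(-n u))^(n 2^n), p_n tends to the indicator of u > ln 2. *)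
Let sharp n (u : R) := (1 - expR (- (n%:R * u))) ^+ (n * 2 ^ n).

(** Bernoulli's inequality bounds the defect by [n 2^n exp(-n u) = n exp(-n c)], and
    [exp y >= y^2 / 2] bounds this by [2 / (c^2 n)]. *)
Let sharp_cvg1 u : ln 2 < u -> sharp n u @[n --> \oo] --> (1 : R).
Proof.
move=> u2; pose c := u - ln 2; have c0 : 0 < c by rewrite subr_gt0.
have u0 : 0 < u by rewrite (lt_trans _ u2)// ln_gt0// ltr1n.
have en n : expR (- (n%:R * u)) <= 1 by rewrite -expR0 ler_expR oppr_le0 mulr_ge0// ltW.
have bern (y : R) k : 0 <= y <= 1 -> 1 - k%:R * y <= (1 - y) ^+ k.
  move=> /andP[y0 y1]; elim: k => [|k ih]; first by rewrite mul0r subr0 expr0.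
  rewrite exprS; apply: (@le_trans _ _ ((1 - y) * (1 - k%:R * y))).
    rewrite -subr_ge0 -natr1.
    have -> : (1 - y) * (1 - k%:R * y) - (1 - (k%:R + 1) * y) = k%:R * y ^+ 2 by ring.
    by rewrite mulr_ge0// sqr_ge0.
  by rewrite ler_wpM2l// subr_ge0.
apply: (@squeeze_cvgr _ _ _ _ (fun n => 1 - (2 / c ^+ 2) * n%:R^-1) (cst 1)).
- exists 1%N => // n /= n1.
  have n0 : 0 < n%:R :> R by rewrite ltr0n.
  apply/andP; split; last first.
    by apply: exprn_ile1; [rewrite subr_ge0 en|rewrite gerBl expR_ge0].
  rewrite /sharp; apply: le_trans (bern _ _ _); last by rewrite expR_ge0 en.
  rewrite lerB// natrM natrX.
  have -> : n%:R * 2 ^+ n * expR (- (n%:R * u)) = n%:R * (expR (n%:R * c))^-1 :> R.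
    rewrite -mulrA; congr (_ * _); rewrite -expRN /c mulrBr opprB.
    by rewrite expRD expR_ln2.
  rewrite -[X in _ <= X]mulrC -[leRHS]mul1r.
  have h : (n%:R * c) ^+ 2 / 2 <= expR (n%:R * c).
    have nc0 : 0 <= n%:R * c by rewrite mulr_ge0 ?(ltW n0) ?(ltW c0).
    by apply: le_trans (expR_ge1Dxn 1 nc0); rewrite lerDr.
  have p0 : 0 < (n%:R * c) ^+ 2 / 2 by rewrite divr_gt0// exprn_gt0// mulr_gt0.
  apply: (@le_trans _ _ (n%:R * ((n%:R * c) ^+ 2 / 2)^-1)).
    by rewrite ler_wpM2l ?(ltW n0)// lef_pV2 ?posrE ?expR_gt0.
  rewrite le_eqVlt; apply/orP; left; apply/eqP.
  by field; rewrite !gt_eqF.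
- rewrite -[X in _ --> X]subr0; apply: cvgB; first exact: cvg_cst.
  rewrite -[X in _ --> X](mulr0 (2 / c ^+ 2)); apply: cvgMl_tmp.
  exact: invn_cvg0.
- exact: cvg_cst.
Qed.

(** By [1 - y <= exp(-y)] the power is at most [exp(- n 2^n exp(-n u))], where [2^n exp(-n u) >= 1];
    what remains is [exp(-n) <= 1/n]. *)
Let sharp_cvg0 u : 0 <= u <= ln 2 -> sharp n u @[n --> \oo] --> (0 : R).
Proof.
move=> /andP[u0 u2].
have en n : expR (- (n%:R * u)) <= 1 by rewrite -expR0 ler_expR oppr_le0 mulr_ge0.
apply: (@squeeze_cvgr _ _ _ _ (cst 0) (fun n => n%:R^-1)).
- exists 1%N => // n /= n1.
  have n0 : 0 < n%:R :> R by rewrite ltr0n.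
  rewrite /sharp exprn_ge0 ?subr_ge0//=.
  apply: (@le_trans _ _ (expR (- n%:R))); last first.
    rewrite expRN lef_pV2 ?posrE ?expR_gt0//.
    by apply: le_trans (expR_ge1Dx _); rewrite lerDr.
  apply: (@le_trans _ _ (expR (- expR (- (n%:R * u))) ^+ (n * 2 ^ n))).
    rewrite lerXn2r ?nnegrE ?subr_ge0 ?expR_ge0//.
    exact: expR_ge1Dx.
  rewrite -expRM_natl ler_expR mulrN lerN2 natrM natrX -mulrA ler_peMr ?(ltW n0)//.
  by rewrite expR_ln2 -expRD -[leLHS]expR0 ler_expR -mulrBr mulr_ge0 ?subr_ge0 ?(ltW n0).
- exact: cvg_cst.
- exact: invn_cvg0.
Qed.

Let halfspace (Theta : M) (a : R) : set M := [set X | a < \tr (Theta *m X)].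

Let measurable_halfspace Theta a : measurable (halfspace Theta a).
Proof.
rewrite (_ : halfspace Theta a = (fun X => \tr (Theta *m X)) @^-1` `]a, +oo[%classic).
  apply: (@measurable_preimage _ _ _ T) => //.
  by apply: measurable_mxtraceMl.
by apply/seteqP; split => X; rewrite /halfspace/= in_itv/= andbT.
Qed.

Let measurable_mulindic f A : measurable_fun [set: M] (f : M -> T) -> measurable A ->
  measurable_fun [set: M] (fun X => f X * \1_A X : T).
Proof. by move=> mf mA; apply: measurable_funM => //; exact: measurable_indic. Qed.

Let test_halfspace f Theta a : test f -> psdmx d Theta -> 0 < a ->
  test (fun X => f X * \1_(halfspace Theta a) X).
Proof.
move=> tf pT a0; have [mf _ _] := tf.
have l2 : 0 < ln 2 :> R by rewrite ln_gt0// ltr1n.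
(* Rescaling by [t] moves the threshold [a] to the threshold [ln 2] of [sharp]. *)
pose t := ln 2 / a; have t0 : 0 < t by rewrite divr_gt0.
apply: (@test_lim (fun n X => f X * sharp n (t * \tr (Theta *m X)))).
- move=> n; have := @test_1exp_pow f ((n%:R * t) *: Theta) (n * 2 ^ n) tf.
  rewrite /sharp /expfun.
  under eq_fun do rewrite -scalemxAl linearZ/= -mulrA.
  by apply; apply: psdmxZ => //; rewrite mulr_ge0// ltW.
- exact: measurable_mulindic.
- move=> X DX; apply: cvgMl_tmp; rewrite indicE.
  have tr0 := mxtrace_mul_psdmx_ge0 pT DX.
  have at2 (u : R) : (a < u) = (ln 2 < t * u).
    by rewrite /t mulrAC ltr_pdivlMr// ltr_pM2l.
  have [aX|Xa] := ltP a (\tr (Theta *m X)).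
    by rewrite mem_set//; apply: sharp_cvg1; rewrite -at2.
  rewrite memNset; last by rewrite /halfspace/= ltNge Xa.
  apply: sharp_cvg0; rewrite mulr_ge0 ?(ltW t0)//=.
  by rewrite leNgt -at2 -leNgt.
Qed.

(** Asking that the indicator preserve all test functions, rather than be one, makes the class
    closed under intersections and hence a sigma-algebra. *)
Let good : set (set M) := [set A | measurable A /\
  forall f, test f -> test (fun X => f X * \1_A X)].

Let good_setC A : good A -> good (~` A).
Proof.
move=> [mA gA]; split; first exact: measurableC.
move=> f tf; have [_ f01 _] := tf.
have := test_sub tf (gA f tf).
rewrite (_ : (fun X => f X - f X * \1_A X) = (fun X => f X * \1_(~` A) X)).
  apply=> X DX; have /andP[f0 f1] := f01 _ DX.
  by rewrite indicE; case: (_ \in _); rewrite ?mulr1 ?mulr0.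
apply/funext => X; rewrite !indicE in_setC.
by case: (_ \in _); rewrite /= ?mulr1 ?mulr0 ?subrr ?subr0.
Qed.

Let good_setI A B : good A -> good B -> good (A `&` B).
Proof.
move=> [mA gA] [mB gB]; split; first exact: measurableI.
move=> f tf; have := gB _ (gA f tf).
rewrite (_ : (fun X => f X * \1_A X * \1_B X) = fun X => f X * \1_(A `&` B) X)//.
apply/funext => X; rewrite !indicE in_setI -mulrA.
by do 2 case: (_ \in _); rewrite ?mulr1 ?mulr0.
Qed.

Let good_bigcup (F : (set M)^nat) : (forall n, good (F n)) -> good (\bigcup_n F n).
Proof.
move=> gF; rewrite -[\bigcup_n _]setCK; apply: good_setC; rewrite setC_bigcup.
have mFC n : measurable (~` F n) by have [] := good_setC (gF n).
split; first exact: bigcapT_measurable.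
move=> f tf; have [mf _ _] := tf.
pose G n := \big[setI/setT]_(i < n) ~` F i.
have gG n : good (G n).
  rewrite /G; elim: n => [|n ih].
    rewrite big_ord0; split => // g tg.
    by under [X in test X]eq_fun do rewrite indicT mulr1.
  by rewrite big_ord_recr/=; apply: good_setI => //; exact: good_setC.
apply: (@test_lim (fun n X => f X * \1_(G n) X)).
- by move=> n; have [_] := gG n; exact.
- by apply: measurable_mulindic => //; exact: bigcapT_measurable.
- move=> X DX; apply: cvgMl_tmp; rewrite !indicE.
  have GE n : G n X <-> forall i, (i < n)%N -> ~ F i X.
    rewrite /G; elim: n => [|n ih]; first by rewrite big_ord0; split.
    rewrite big_ord_recr/=; split=> [[/ih h Fn] i|h].
      by rewrite ltnS leq_eqVlt => /predU1P[->//|]; exact: h.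
    by split; [apply/ih => i ilt; apply: h; rewrite ltnS ltnW|exact: h].
  have [XF|nXF] := boolP (X \in _).
    apply: cvg_near_cst; apply: nearW => n; rewrite indicE mem_set//.
    by apply/GE => i _; move/set_mem : XF; exact.
  have [n Fn] : exists n, F n X.
    apply: contrapT => nF; move/negP : nXF; apply; apply/mem_set => i _ Fi.
    by apply: nF; exists i.
  apply: cvg_near_cst; exists n.+1 => // m /= nm; rewrite indicE memNset//.
  by move=> /GE/(_ _ nm).
Qed.

Let good_sigma_algebra : sigma_algebra setT good.
Proof.
split.
- split => // f tf; have [mf f01 fE] := tf.
  under [X in test X]eq_fun do rewrite indic0 mulr0.
  have := test_sub tf tf; under eq_fun do rewrite subrr.
  by apply=> X _.
- by move=> A gA; rewrite setTD; exact: good_setC.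
- exact: good_bigcup.
Qed.

(** Truncation at 0 changes nothing on the cone and turns every superlevel set into the whole space
    or a half-space with nonnegative threshold, the ones accessible through [test_halfspace]. *)
Let symreal Theta (X : M) : R := Num.max 0 (\tr (Theta *m X)).

Let goodT := g_sigma_algebraType good.

Let good_measurable (A : set goodT) : measurable A -> good A.
Proof. by apply: smallest_sub => //; exact: good_sigma_algebra. Qed.

Let measurable_good (A : set goodT) : good A -> measurable A.
Proof. exact: sub_sigma_algebra. Qed.

Let measurable_symreal Theta : psdmx d Theta ->
  measurable_fun [set: goodT] (symreal Theta : goodT -> T).
Proof.
move=> pT; apply: (measurability _ (RGenOInfty.measurableE R)).
move=> _ [_ [a ->] <-]; rewrite setTI; apply: measurable_good.
have pos b : 0 < b -> good (halfspace Theta b).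
  by move=> b0; split=> [|f tf]; [exact: measurable_halfspace|exact: test_halfspace].
have preE : symreal Theta @^-1` `]a, +oo[ =
    if a < 0 then setT else halfspace Theta a.
  apply/seteqP; split=> X; rewrite /symreal/= in_itv/= andbT lt_max.
    by case: ifPn => // a0 /orP[a0'|//]; rewrite a0' in a0.
  by case: ifPn => //= _ ->.
rewrite preE; case: ifPn => [_|].
  by rewrite -setC0; apply: good_setC; have [] := good_sigma_algebra.
rewrite -leNgt le_eqVlt => /predU1P[<-|]; last exact: pos.
rewrite (_ : halfspace Theta 0 = \bigcup_n halfspace Theta n.+1%:R^-1).
  by apply: good_bigcup => n; apply: pos; rewrite invr_gt0 ltr0n.
apply/seteqP; split=> X.
  by move=> /ltr_add_invr[k]; rewrite add0r => kX; exists k.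
by move=> [k _]; apply: lt_trans; rewrite invr_gt0 ltr0n.
Qed.

Let polar i j : M := ((delta_mx 0 i + delta_mx 0 j : 'rV[R]_d)^T *m
  (delta_mx 0 i + delta_mx 0 j)).
Let diag i : M := ((delta_mx 0 i : 'rV[R]_d)^T *m delta_mx 0 i).

(** Polarisation: half of [q(e_i + e_j) - q(e_i) - q(e_j)] for the form [q] of [X]. All entries are
    recovered from pairings with rank one matrices, which lie in the closed cone. *)
Let reco (X : M) : M :=
  \matrix_(i, j) ((symreal (polar i j) X - symreal (diag i) X - symreal (diag j) X) / 2).

Let recoE X : D X -> reco X = X.
Proof.
move=> DX; have [sX _] := DX; apply/matrixP => i j; rewrite mxE.
have srE (u : 'rV[R]_d) : symreal (u^T *m u) X = qform X u.
  rewrite /symreal mxtrace_mulC mxtrace_mul_rank1; apply/max_idPr.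
  by have [_] := DX; exact.
rewrite /polar /diag !srE !qform_delta.
by rewrite -[in qform X (_ + delta_mx 0 j)](scale1r (delta_mx 0 j)) qform_delta2//; field.
Qed.

Let measurable_reco : measurable_fun [set: goodT] (reco : goodT -> M).
Proof.
apply: measurable_fun_mx => i j; under eq_fun do rewrite mxE.
apply: measurable_funM => //.
apply: measurable_funB; first apply: measurable_funB;
  apply: measurable_symreal; exact: psdmx_rank1.
Qed.

(** [reco] is the identity on the cone and measurable for the good sets, so every Borel set
    coincides on the cone with a good set. Multiplying the test function 1 by its indicator and
    taking [Theta = 0] compares the two masses. *)
Theorem laplace_unique A : measurable A -> P A = Q A.
Proof.
move=> mA.
have gB : good (reco @^-1` A).
  by apply: good_measurable; rewrite -[X in measurable X]setTI; exact: measurable_reco.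
have AE (mu : probability M R) : mu (~` D) = 0%E ->
    (mu A = \int[mu]_(X in D) (\1_(reco @^-1` A) X * expfun 0 X)%:E)%E.
  move=> muD; rewrite -[in LHS](setIT A) -integral_indic//.
  rewrite (integralD muD); [|by move=> X; rewrite indicE|exact: measurable_indic].
  apply: eq_integral => X /set_mem DX.
  by rewrite expfun0l mulr1 !indicE; congr (nat_of_bool _)%:R%:E;
    apply/idP/idP; rewrite !inE /= recoE.
rewrite !AE//; have [_ /(_ _ test1)[_ _ /(_ 0 (psdmx0 d))]] := gB.
under eq_integral do rewrite mul1r.
by move=> ->; under eq_integral do rewrite mul1r.
Qed.

End laplace_uniqueness.

(** * Polar coordinates and existence of the measure on the sphere *)

Section polar_coordinates.
Context {R : realType} (d : nat) (d_gt0 : (0 < d)%N).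
Notation M := 'M[R]_d.
Let T := measurableTypeR R.
Notation leb := (@lebesgue_measure R).
Notation ls := (@lebesgue_sym R d).
Notation N := (symdim d).

(** [lebesgue_sym] is declared as a measure without sigma-finiteness; the exchange takes place on
    the tuples whose image it is. *)
Lemma tonelli_sym (f : R -> M -> \bar R) : (forall x X, 0 <= f x X)%E ->
  measurable_fun [set: T * M] (fun p => f p.1 p.2) ->
  (\int[leb]_x \int[ls]_X f x X = \int[ls]_X \int[leb]_x f x X)%E.
Proof.
move=> f0 mf.
have mft : measurable_fun [set: T * N.-tuple T]
    (fun p => f p.1 (sym_of_tuple p.2)).
  have mp : measurable_fun [set: T * N.-tuple T]
      (fun p => (p.1, sym_of_tuple p.2) : T * M).
    apply/measurable_fun_pairP; split; first exact: measurable_fst.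
    exact: (measurableT_comp (@measurable_sym_of_tuple R d) measurable_snd).
  exact: (measurableT_comp mf mp).
transitivity (\int[leb]_x \int[lebesgue_tuple N]_t f x (sym_of_tuple t))%E.
  apply: eq_integral => x _; rewrite integral_lebesgue_sym//.
  exact: (measurableT_comp mf (measurable_pair1 x)).
rewrite [RHS]integral_lebesgue_sym//; last 2 first.
- by move=> X; exact: integral_ge0.
- apply: (measurable_fun_integral (m2 := leb) (fun X x => f x X)) => //.
  have ms : measurable_fun [set: M * T] (fun p : M * T => (p.2, p.1) : T * M).
    by apply/measurable_fun_pairP; split; [exact: measurable_snd|exact: measurable_fst].
  exact: (measurableT_comp mf ms).
exact: (tonelli (fun (x : T) t => f x (sym_of_tuple t)) (fun x t => f0 x _) mft leb).
Qed.

Lemma symdim_gt0 : (0 < N)%N.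
Proof. by case: d d_gt0 => // n _; rewrite symdimS addnS. Qed.

(** The weight has integral 1 along each ray, since [r^(N-1) r^-(N+1) = r^-2] integrates to 1 over
    [r >= 1]. Projecting this density to the sphere therefore yields [dU]. *)
Let g (X : M) : R :=
  \1_(pdmx d) X * \1_(`[1%R, +oo[%classic) (\tr X) * (\tr X)^-1 ^+ N.+1.

Let g_ge0 X : 0 <= g X.
Proof.
rewrite /g !indicE; have [/set_mem pX|_] := boolP (X \in pdmx d); last by rewrite !mul0r.
by rewrite !mulr_ge0// exprn_ge0// invr_ge0 mxtrace_psdmx_ge0//; exact: pdmx_psdmx.
Qed.

Let measurable_trace : measurable_fun [set: M] (fun X => \tr X : T).
Proof. exact: measurable_mxtrace. Qed.

Let measurable_inv : measurable_fun [set: T] (fun x : T => x^-1 : T).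
Proof.
rewrite -(setUv [set 0%R]); apply/measurable_funU => //; first exact: measurableC.
split; first exact: measurable_fun_set1.
apply: open_continuous_measurable_fun.
  rewrite (_ : ~` [set 0%R] = [set x | x != 0%R]); first exact: open_neq.
  by apply/seteqP; split=> x /eqP.
by move=> x /set_mem/eqP x0; exact: inv_continuous.
Qed.

Let measurable_itrace : measurable_fun [set: M] (fun X => (\tr X)^-1 : T).
Proof. exact: (measurableT_comp measurable_inv measurable_trace). Qed.

Let measurable_g : measurable_fun [set: M] (EFin \o g).
Proof.
apply/measurable_EFinP; apply: measurable_funM; last exact: measurable_funX.
apply: measurable_funM; first by apply: measurable_indic; exact: measurable_pdmx.
by apply: (measurableT_comp _ measurable_trace); exact: measurable_indic.
Qed.

Let proj (X : M) : M := (\tr X)^-1 *: X.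

Let measurable_proj : measurable_fun [set: M] proj.
Proof. exact: measurable_mxZ. Qed.

Let mu0 : {measure set M -> \bar R} :=
  image_measure (density_measure ls g_ge0 measurable_g) measurable_proj.

Let integral_mu0 f : (forall U, 0 <= f U)%E -> measurable_fun [set: M] f ->
  (\int[mu0]_U f U = \int[ls]_X ((g X)%:E * f (proj X)))%E.
Proof.
move=> f0 mf; rewrite integral_image_measure// integral_density_measure//.
exact: measurableT_comp.
Qed.

Lemma trace_pd_gt0 (X : M) : pdmx d X -> 0 < \tr X.
Proof. by case: d X d_gt0 => // n X _; exact: mxtrace_pdmx_gt0. Qed.

Let proj_sphere X : pdmx d X -> (trsphere d `&` pdmx d) (proj X).
Proof.
move=> pX; have t0 := trace_pd_gt0 pX.
have pP : pdmx d (proj X) by apply: pdmxZ => //; rewrite invr_gt0.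
split => //; split; first exact: pdmx_psdmx.
by rewrite /proj linearZ/= mulVf ?gt_eqF.
Qed.

Let h (r : R) : R := \1_(`]0%R, +oo[%classic) r * r ^+ N.-1.

Let h_ge0 r : 0 <= h r.
Proof.
rewrite /h indicE; have [/set_mem|_] := boolP (r \in _); last by rewrite mul0r.
by rewrite /= in_itv/= andbT => r0; rewrite mul1r exprn_ge0// ltW.
Qed.

Let measurable_h : measurable_fun [set: T] (h : T -> T).
Proof.
by apply: measurable_funM; [exact: measurable_indic|exact: measurable_funX].
Qed.

Let measurable_scale : measurable_fun [set: M * T] (fun p : M * T => p.2 *: p.1).
Proof. by apply: measurable_mxZ. Qed.

Let measurable_ray (f : M -> \bar R) : measurable_fun [set: M] f ->
  measurable_fun [set: M * T] (fun p : M * T => (h p.2)%:E * f (p.2 *: p.1))%E.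
Proof.
move=> mf; apply: emeasurable_funM; last exact: (measurableT_comp mf measurable_scale).
by apply/measurable_EFinP; exact: (measurableT_comp measurable_h).
Qed.

Let measurable_ray_integral (f : M -> \bar R) : (forall X, 0 <= f X)%E ->
  measurable_fun [set: M] f ->
  measurable_fun [set: M] (fun U => \int[leb]_r ((h r)%:E * f (r *: U)))%E.
Proof.
move=> f0 mf; apply: (measurable_fun_integral (m2 := leb)
  (fun (U : M) (r : T) => (h r)%:E * f (r *: U))%E); last exact: measurable_ray.
by move=> U r; rewrite mule_ge0// lee_fin.
Qed.

Let ray_integralE (E : set M) U :
  (\int[leb]_(r in `]0%R, +oo[) (\1_E (r *: U) * r ^+ N.-1)%:E =
   \int[leb]_r ((h r)%:E * (\1_E (r *: U))%:E))%E.
Proof.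
rewrite integral_mkcond; apply: eq_integral => r _.
rewrite patchE -EFinM /h [\1_(`]0%R, +oo[%classic) r]indicE.
by case: ifPn => _ /=; rewrite ?mul0r// mul1r mulrC.
Qed.

(** Substituting [r = s * \tr X] along the ray, exchanging the integrals and substituting
    [Y = s *: X] leaves each [Y] counted for [s] in []0, \tr Y]] with weight [(\tr Y)^-1], that is,
    once. *)
Lemma exists_polar_measure : exists mu : {measure set M -> \bar R}, polar_measure mu.
Proof.
exists mu0; split.
  have mS : measurable (~` (trsphere d `&` pdmx d) : set M).
    by apply: measurableC; apply: measurableI;
      [exact: measurable_trsphere|exact: measurable_pdmx].
  rewrite -[X in mu0 X]setIT -integral_indic// integral_mu0;
    [|by move=> U; rewrite lee_fin indicE|
      by apply/measurable_EFinP; exact: measurable_indic].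
  apply: integral0_eq => X _; rewrite -EFinM /g !indicE.
  have [/set_mem/proj_sphere pX|_] := boolP (X \in pdmx d); last by rewrite !mul0r.
  by rewrite [proj X \in _]memNset ?mulr0// => /(_ pX).
move=> E mE.
pose IE X := (\int[leb]_r ((h r)%:E * (\1_E (r *: X))%:E))%E.
have mE1 : measurable_fun [set: M] (EFin \o (\1_E : M -> T)).
  by apply/measurable_EFinP; exact: measurable_indic.
have IE0 X : (0 <= IE X)%E.
  by apply: integral_ge0 => r _; rewrite mule_ge0// lee_fin// indicE.
have mIE : measurable_fun [set: M] IE.
  by apply: (@measurable_ray_integral (EFin \o \1_E)) => // X; rewrite /= lee_fin indicE.
transitivity (\int[mu0]_(U in trsphere d) IE U)%E; last first.
  by apply: eq_integral => U _; rewrite /IE -ray_integralE.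
have mSp : measurable (trsphere d : set M) by exact: measurable_trsphere.
rewrite [RHS]integral_mkcond integral_mu0; last 2 first.
- by move=> U; apply: erestrict_ge0.
- by apply/(measurable_restrictT _ _).1 => //; apply: measurable_funTS.
(* What is left of [g] after [r = s * \tr X]: the Jacobian and the power [r^(N-1)] give back [N]
   powers of the trace. *)
pose p (X : M) : R := \1_(pdmx d) X * \1_(`[1%R, +oo[%classic) (\tr X) * (\tr X)^-1.
have p0 X : 0 <= p X.
  rewrite /p !indicE; have [/set_mem pX|_] := boolP (X \in pdmx d); last by rewrite !mul0r.
  by rewrite !mulr_ge0// invr_ge0 mxtrace_psdmx_ge0//; exact: pdmx_psdmx.
have mp : measurable_fun [set: M] (p : M -> T).
  apply: measurable_funM => //.
  apply: measurable_funM; first by apply: measurable_indic; exact: measurable_pdmx.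
  by apply: (measurableT_comp _ measurable_trace); exact: measurable_indic.
transitivity (\int[ls]_X \int[leb]_s ((p X)%:E * ((h s)%:E * (\1_E (s *: X))%:E)))%E;
  last first.
  apply: eq_integral => X _.
  have [pX|npX] := pselect (pdmx d X); last first.
    rewrite /g !indicE memNset// !mul0r mul0e integral0_eq// => s _.
    by rewrite /p indicE memNset// !mul0r mul0e.
  have t0 := trace_pd_gt0 pX.
  rewrite patchE mem_set; last by have [] := proj_sphere pX.
  rewrite ge0_integralZl//; last 3 first.
  - apply: (measurableT_comp (@measurable_ray _ mE1) (measurable_pair1 X)).
  - by move=> s _; rewrite mule_ge0// lee_fin// indicE.
  - by rewrite lee_fin.
  rewrite /IE -(@integral_affine R (\tr X) 0 _ t0); last 2 first.
  - by move=> s; rewrite mule_ge0// lee_fin// indicE.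
  - exact: (measurableT_comp (@measurable_ray _ mE1) (measurable_pair1 (proj X))).
  rewrite muleA -EFinM.
  have hE s : h (\tr X * s + 0) = (\tr X) ^+ N.-1 * h s.
    rewrite /h addr0 !indicE exprMn.
    have -> : (\tr X * s \in `]0%R, +oo[%classic) = (s \in `]0%R, +oo[%classic).
      by apply/idP/idP; rewrite !inE /= !in_itv/= !andbT pmulr_rgt0.
    by rewrite mulrCA.
  rewrite [X in (_ = _ * X)%E](_ : _ = \int[leb]_s ((\tr X ^+ N.-1)%:E *
      ((h s)%:E * (\1_E (s *: X))%:E)))%E; last first.
    apply: eq_integral => s _.
    by rewrite hE /proj scalerA addr0 mulrAC mulfV ?gt_eqF// mul1r EFinM -muleA.
  rewrite ge0_integralZl//; last 3 first.
  - apply: (measurableT_comp (@measurable_ray _ mE1) (measurable_pair1 X)).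
  - by move=> s _; rewrite mule_ge0// lee_fin// indicE.
  - by rewrite lee_fin exprn_ge0// ltW.
  rewrite muleA -EFinM; congr (_%:E * _)%E.
  rewrite /g /p -!mulrA; congr (_ * (_ * _)).
  rewrite exprS -mulrA -exprS prednK ?symdim_gt0// -exprMn mulVf ?gt_eqF//.
  by rewrite expr1n mulr1.
have meq : measurable_fun [set: T * M]
    (fun q : T * M => ((p q.2)%:E * ((h q.1)%:E * (\1_E (q.1 *: q.2))%:E))%E).
  apply: emeasurable_funM.
    by apply/measurable_EFinP; exact: (measurableT_comp mp).
  have ms : measurable_fun [set: T * M] (fun p : T * M => (p.2, p.1) : M * T).
    by apply/measurable_fun_pairP; split; [exact: measurable_snd|exact: measurable_fst].
  exact: (measurableT_comp (@measurable_ray _ mE1) ms).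
rewrite -(tonelli_sym (f := fun s X => ((p X)%:E * ((h s)%:E * (\1_E (s *: X))%:E))%E))//;
  last by move=> s X; rewrite !mule_ge0// lee_fin// indicE.
(* The integrand after [Y = s *: X]: the condition [\tr X >= 1] has become [\tr Y >= s], and the
   powers of [s] cancel. *)
pose q (s : R) (Y : M) : R := \1_(`]0%R, +oo[%classic) s * (\1_(pdmx d) Y *
  (\1_E Y * (\1_(`[s, +oo[%classic) (\tr Y) * (\tr Y)^-1))).
have q0 s Y : 0 <= q s Y.
  rewrite /q !indicE; have [/set_mem pY|_] := boolP (Y \in pdmx d);
    last by rewrite !(mul0r, mulr0).
  by rewrite !mulr_ge0// invr_ge0 mxtrace_psdmx_ge0//; exact: pdmx_psdmx.
have mge : measurable_fun [set: T * M] (fun c : T * M => \1_(`[c.1, +oo[%classic) (\tr c.2) : T).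
  rewrite (_ : (fun c : T * M => _) =
      (fun c : T * M => \1_(`[0%R, +oo[%classic) (\tr c.2 - c.1) : T)).
    apply: (@measurableT_comp _ _ _ _ _ _ (\1_(`[0%R, +oo[%classic) : T -> T)).
      exact: measurable_indic.
    apply: measurable_funB => //.
    exact: (measurableT_comp measurable_trace).
  apply/funext => c; rewrite !indicE; congr (nat_of_bool _)%:R.
  by apply/idP/idP; rewrite !inE/= !in_itv/= !andbT subr_ge0.
have mq : measurable_fun [set: T * M] (fun c => (q c.1 c.2)%:E).
  apply/measurable_EFinP; apply: measurable_funM.
    by apply: (measurableT_comp (measurable_indic _)).
  apply: measurable_funM.
    by apply: (measurableT_comp (measurable_indic _)) => //; exact: measurable_pdmx.
  apply: measurable_funM; first by apply: (measurableT_comp (measurable_indic _)).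
  apply: measurable_funM => //.
  exact: (measurableT_comp measurable_itrace).
transitivity (\int[leb]_s \int[ls]_Y (q s Y)%:E)%E; last first.
  apply: eq_integral => s _.
  have [s0|s0] := ltP 0 s; last first.
    have sN : s \in `]0%R, +oo[%classic = false.
      by apply/negbTE/negP; rewrite inE/= in_itv/= andbT ltNge s0.
    rewrite !integral0_eq// => X _; first by rewrite /h indicE sN mul0r mul0e mule0.
    by rewrite /q indicE sN mul0r.
  have sP : s \in `]0%R, +oo[%classic by rewrite inE/= in_itv/= s0.
  rewrite -(@integral_lebesgue_sym_affine R d s 0 _ s0)//; last 3 first.
  - by rewrite linear0.
  - by move=> X; rewrite lee_fin.
  - exact: (measurableT_comp mq (measurable_pair1 s)).
  rewrite -ge0_integralZl//; last 3 first.
  - have ma : measurable_fun [set: M] (fun X : M => s *: X + 0 : M).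
      by apply: measurable_mxD => //; exact: measurable_mxZ.
    exact: (measurableT_comp (measurableT_comp mq (measurable_pair1 s)) ma).
  - by move=> X _; rewrite lee_fin.
  - by rewrite lee_fin exprn_ge0// ltW.
  apply: eq_integral => X _; rewrite -!EFinM; congr EFin.
  rewrite /q /p /h !indicE sP !mul1r addr0.
  have pE : (s *: X \in pdmx d) = (X \in pdmx d).
    apply/idP/idP; rewrite !inE; last exact: pdmxZ.
    move=> /(@pdmxZ _ _ s^-1); rewrite invr_gt0 => /(_ s0).
    by rewrite scalerA mulVf ?gt_eqF// scale1r.
  rewrite pE linearZ/=.
  have -> : (s * \tr X \in `[s, +oo[%classic) = (\tr X \in `[1%R, +oo[%classic).
    by apply/idP/idP; rewrite !inE/= !in_itv/= !andbT ler_pMr.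
  rewrite invfM -[in s ^+ N](prednK symdim_gt0) exprSr.
  have s1 : s * s^-1 = 1 by rewrite divff ?gt_eqF.
  rewrite [LHS](_ : _ = (X \in pdmx d)%:R * ((s *: X \in E)%:R *
    ((\tr X \in `[1%R, +oo[%classic)%:R * (\tr X)^-1)) * s ^+ N.-1 * (s * s^-1)).
    by rewrite s1 mulr1; ring.
  ring.
rewrite (tonelli_sym (f := fun s Y => (q s Y)%:E))//.
transitivity (\int[ls]_Y (\1_(E `&` pdmx d) Y)%:E)%E.
  rewrite integral_indic// ?setIT//.
  by apply: measurableI => //; exact: measurable_pdmx.
apply: eq_integral => Y _.
have [pY|npY] := pselect (pdmx d Y); last first.
  rewrite indicE memNset; last by case.
  by rewrite integral0_eq// => s _; rewrite /q !indicE [Y \in pdmx d]memNset// mul0r mulr0.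
have t0 := trace_pd_gt0 pY.
transitivity (\int[leb]_s ((\1_E Y * (\tr Y)^-1)%:E *
    (\1_(`]0%R, \tr Y]%classic) s)%:E))%E.
  rewrite ge0_integralZl//; last 2 first.
  - by apply/measurable_EFinP; exact: measurable_indic.
  - by rewrite lee_fin mulr_ge0 ?invr_ge0 ?(ltW t0)// indicE.
  have -> : (\int[leb]_s (\1_(`]0%R, \tr Y]%classic) s)%:E = (\tr Y)%:E)%E.
    transitivity (leb `]0%R, \tr Y]%classic); first by rewrite integral_indic// setIT.
    by rewrite lebesgue_measure_itv/= lte_fin t0 -EFinB subr0.
  rewrite -EFinM.
  by rewrite mulfVK ?gt_eqF// !indicE in_setI [Y \in pdmx d]mem_set// andbT.
apply: eq_integral => s _; rewrite -EFinM /q !indicE [Y \in pdmx d]mem_set// mul1r.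
have -> : (s \in `]0%R, \tr Y]%classic) =
    (s \in `]0%R, +oo[%classic) && (\tr Y \in `[s, +oo[%classic).
  by apply/idP/andP => [|[]]; rewrite !inE/= !in_itv/= !andbT;
    [move=> /andP|move=> -> ->].
by rewrite -mulnb natrM; congr EFin; ring.
Qed.

Section polar_integral.
Variables (mu : {measure set M -> \bar R}) (polar_mu : polar_measure mu).

Let mSP : measurable (trsphere d `&` pdmx d : set M).
Proof.
by apply: measurableI; [exact: measurable_trsphere|exact: measurable_pdmx].
Qed.

Lemma polar_ae_eq (f1 f2 : M -> \bar R) :
  (forall U, 0 <= f1 U)%E -> (forall U, 0 <= f2 U)%E ->
  measurable_fun [set: M] f1 -> measurable_fun [set: M] f2 ->
  (forall U, trsphere d U -> pdmx d U -> f1 U = f2 U) ->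
  (\int[mu]_U f1 U = \int[mu]_U f2 U)%E.
Proof.
move=> f10 f20 mf1 mf2 f12; have [mu0' _] := polar_mu.
rewrite (ge0_negligible_integral _ measurableT _ _ mu0')//; last exact: measurableC.
rewrite [RHS](ge0_negligible_integral _ measurableT _ _ mu0')//; last exact: measurableC.
by rewrite setTD setCK; apply: eq_integral => U /set_mem[]; exact: f12.
Qed.

Let mhE : measurable_fun [set: T] (EFin \o h).
Proof. exact/measurable_EFinP. Qed.

Let hdens : {measure set T -> \bar R} := density_measure leb h_ge0 mhE.

Let mray (U : M) : measurable_fun [set: T] (fun r : T => r *: U).
Proof. by apply: measurable_mxZ. Qed.

Let ray (U : M) : {measure set M -> \bar R} := image_measure hdens (mray U).

Let integral_ray f U : (forall X, 0 <= f X)%E -> measurable_fun [set: M] f ->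
  (\int[ray U]_X f X = \int[leb]_r ((h r)%:E * f (r *: U)))%E.
Proof.
move=> f0 mf; rewrite integral_image_measure// integral_density_measure//.
exact: (measurableT_comp mf (mray U)).
Qed.

Let mE1 (E : set M) : measurable E -> measurable_fun [set: M] (EFin \o (\1_E : M -> T)).
Proof. by move=> mE; apply/measurable_EFinP; exact: measurable_indic. Qed.

Let ray_E E U : measurable E ->
  (ray U E = \int[leb]_r ((h r)%:E * (\1_E (r *: U))%:E))%E.
Proof.
move=> mE; rewrite -[in LHS](setIT E) -integral_indic//.
rewrite (@integral_ray (EFin \o \1_E))//; last exact: mE1.
by move=> X; rewrite /= lee_fin indicE.
Qed.

Let mkray E : measurable E -> measurable_fun [set: M] (fun U => ray U E).
Proof.
move=> mE; under eq_fun do rewrite ray_E//.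
apply: (@measurable_ray_integral (EFin \o \1_E)); last exact: mE1.
by move=> X; rewrite /= lee_fin indicE.
Qed.

(** [polar_measure] says that Lebesgue measure on the cone and the mixture of the ray measures agree
    on sets; [integral_mixture] passes from sets to functions. *)
Let polar_integral_h (f : M -> \bar R) : (forall X, 0 <= f X)%E ->
  measurable_fun [set: M] f ->
  (\int[ls]_(X in pdmx d) f X = \int[mu]_U \int[leb]_r ((h r)%:E * f (r *: U)))%E.
Proof.
move=> f0 mf; under [RHS]eq_integral do rewrite -integral_ray//.
rewrite -(integral_mixture mu mkray f0 mf).
have mP : measurable (pdmx d : set M) by exact: measurable_pdmx.
have i0 (X : M) : 0 <= \1_(pdmx d) X :> R by rewrite indicE.
have mi : measurable_fun [set: M] (EFin \o (\1_(pdmx d) : M -> T)) by exact: mE1.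
have [mu0' muE] := polar_mu.
transitivity (\int[density_measure ls i0 mi]_X f X)%E.
  rewrite [LHS]integral_mkcond integral_density_measure//; apply: eq_integral => X _.
  by rewrite patchE indicE; case: ifP => _; rewrite ?mul1e ?mul0e.
apply: eq_measure_integral => E mE _.
transitivity (ls (E `&` pdmx d)).
  by rewrite density_measureE// integral_indic// setIC.
rewrite (muE _ mE).
transitivity (\int[mu]_U ray U E)%E; last by [].
have mSp : measurable (trsphere d : set M) by exact: measurable_trsphere.
rewrite integral_mkcond; apply: polar_ae_eq.
- by move=> U; apply: erestrict_ge0 => V _; apply: integral_ge0 => r;
    rewrite /= in_itv/= andbT => r0; rewrite lee_fin mulr_ge0 ?exprn_ge0 ?(ltW r0).
- by move=> U; exact: measure_ge0.
- have mr : measurable_fun [set: M] (fun U =>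
      \int[leb]_(r in `]0%R, +oo[) (\1_E (r *: U) * r ^+ N.-1)%:E)%E.
    by under eq_fun do rewrite ray_integralE -ray_E//; exact: mkray.
  exact: ((measurable_restrictT _ mSp).1 (measurable_funTS mr)).
- exact: mkray.
- by move=> U SU pU; rewrite patchE mem_set// ray_integralE -ray_E.
Qed.

Lemma polar_integral (f : M -> \bar R) : (forall X, 0 <= f X)%E ->
  measurable_fun [set: M] f ->
  (\int[ls]_(X in pdmx d) f X = \int[mu]_U \int[leb]_r
     ((\1_(`]0%R, +oo[%classic) r * r ^+ N.-1)%:E * f (r *: U)))%E.
Proof. exact: polar_integral_h. Qed.

End polar_integral.

End polar_coordinates.

Lemma measurable_fun_powR d {T : measurableType d} {R : realType} (b : R)
    (g : T -> measurableTypeR R) : measurable_fun [set: T] g ->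
  measurable_fun [set: T] (fun x => g x `^ b : measurableTypeR R).
Proof.
move=> mg; apply: (@measurableT_comp _ _ _ _ _ _
  (fun x : measurableTypeR R => x `^ b : measurableTypeR R)) => //.
Qed.

(** * Levy densities with a general radial factor, in polar coordinates *)

Section levy_density.
Context {R : realType} (d : nat) (eta : R).
Notation M := 'M[R]_d.
Let T := measurableTypeR R.
Notation leb := (@lebesgue_measure R).
Notation ls := (@lebesgue_sym R d).

(** The radial factor is left free: [exp(-r)] gives the Levy density up to its constant,
    [exp(-r) r^(eta d)] the integrand of the multivariate Gamma function, and further choices the
    increments and the moments. *)
Definition levy_density (q : R -> R) (X : M) : R :=
  \1_(pdmx d) X * (q (\tr X) / \tr X `^ (eta * d%:R) *
    \det X `^ (eta - d.+1%:R / 2)).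

Definition sphere_density (U : M) : R :=
  \1_(trsphere d `&` pdmx d) U * \det U `^ (eta - d.+1%:R / 2).

Lemma levy_density_ge0 q X : (forall r, 0 <= q r) -> 0 <= levy_density q X.
Proof.
by move=> q0; rewrite /levy_density indicE !mulr_ge0 ?invr_ge0 ?powR_ge0.
Qed.

Lemma sphere_density_ge0 U : 0 <= sphere_density U.
Proof. by rewrite /sphere_density indicE mulr_ge0 ?powR_ge0. Qed.

Let measurable_pow_det : measurable_fun [set: M]
  (fun X => \det X `^ (eta - d.+1%:R / 2) : T).
Proof.
by apply: measurable_fun_powR; exact: measurable_det.
Qed.

Let measurable_radial (q : R -> R) : measurable_fun [set: T] (q : T -> T) ->
  measurable_fun [set: M] (fun X => q (\tr X) / \tr X `^ (eta * d%:R) *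
    \det X `^ (eta - d.+1%:R / 2) : T).
Proof.
move=> mq; have mt : measurable_fun [set: M] (fun X => \tr X : T).
  exact: measurable_mxtrace.
apply: measurable_funM; last exact: measurable_pow_det.
apply: measurable_funM; first exact: (measurableT_comp mq).
under eq_fun do rewrite -powRN.
exact: measurable_fun_powR.
Qed.

Lemma measurable_levy_density q : measurable_fun [set: T] (q : T -> T) ->
  measurable_fun [set: M] (levy_density q : M -> T).
Proof.
move=> mq; apply: measurable_funM; last exact: measurable_radial.
by apply: measurable_indic; exact: measurable_pdmx.
Qed.

Lemma measurable_sphere_density : measurable_fun [set: M] (sphere_density : M -> T).
Proof.
apply: measurable_funM; last exact: measurable_pow_det.
apply: measurable_indic.
by apply: measurableI; [exact: measurable_trsphere|exact: measurable_pdmx].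
Qed.

Lemma levy_densityM q p X :
  levy_density (fun r => q r * p r) X = levy_density q X * p (\tr X).
Proof. by rewrite /levy_density; ring. Qed.

Lemma levy_densityD q p X :
  levy_density (fun r => q r + p r) X = levy_density q X + levy_density p X.
Proof. by rewrite /levy_density; ring. Qed.

Hypothesis d_gt0 : (0 < d)%N.

Lemma polar_sphere_measure : polar_measure (sphere_measure d : {measure set M -> \bar R}).
Proof.
rewrite /sphere_measure; case: pselect => [h|]; first exact: projT2 (cid h).
by case; exact: exists_polar_measure.
Qed.

Lemma symdim_double : (symdim d)%:R = d%:R * d.+1%:R / 2 :> R.
Proof.
have : (symdim d).*2 = (d * d.+1)%N.
  by have := odd_double_half (d * d.+1); rewrite oddM/= andbN.
move=> /(congr1 (fun n => n%:R : R)); rewrite -muln2 !natrM => <-.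
by rewrite mulfK.
Qed.

(** The powers of [r] are [N - 1] from the volume, [- eta d] from the trace and [d (eta - (d+1)/2)]
    from the determinant. They add up to -1 because [N = d (d+1)/2]. *)
Lemma polar_density (q : R -> R) (f : M -> \bar R) : (forall r, 0 <= q r) ->
  measurable_fun [set: T] (q : T -> T) ->
  (forall X, 0 <= f X)%E -> measurable_fun [set: M] f ->
  (\int[ls]_X ((levy_density q X)%:E * f X) =
   \int[sphere_measure d]_U ((sphere_density U)%:E *
     \int[leb]_(r in `]0%R, +oo[) ((q r / r)%:E * f (r *: U))))%E.
Proof.
move=> q0 mq f0 mf.
pose F X := ((q (\tr X) / \tr X `^ (eta * d%:R) *
    \det X `^ (eta - d.+1%:R / 2))%:E * f X)%E.
have F0 X : (0 <= F X)%E by rewrite mule_ge0// lee_fin !mulr_ge0 ?invr_ge0 ?powR_ge0.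
have mF : measurable_fun [set: M] F.
  apply: emeasurable_funM => //; apply/measurable_EFinP; exact: measurable_radial.
transitivity (\int[ls]_(X in pdmx d) F X)%E.
  rewrite [RHS]integral_mkcond; apply: eq_integral => X _.
  rewrite patchE /levy_density indicE /F; case: ifPn => _; first by rewrite mul1r.
  by rewrite !mul0r mul0e.
pose k (r : R) : R := \1_(`]0%R, +oo[%classic) r * (q r / r).
have mk : measurable_fun [set: T] (k : T -> T).
  rewrite (_ : k = (fun r => \1_(`]0%R, +oo[%classic) r * (q r * r `^ (- 1)))).
    apply: measurable_funM; first exact: measurable_indic.
    by apply: measurable_funM => //; exact: measurable_powR.
  apply/funext => r; rewrite /k indicE.
  have [/set_mem|_] := boolP (r \in _); last by rewrite !mul0r.
  by rewrite /= in_itv/= andbT => r0; rewrite powRN powRr1 ?ltW.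
have k0 r : 0 <= k r.
  rewrite /k indicE; have [/set_mem|_] := boolP (r \in _); last by rewrite mul0r.
  by rewrite /= in_itv/= andbT => r0; rewrite mul1r divr_ge0// ltW.
have kE U : (\int[leb]_(r in `]0%R, +oo[) ((q r / r)%:E * f (r *: U)) =
    \int[leb]_r ((k r)%:E * f (r *: U)))%E.
  rewrite integral_mkcond; apply: eq_integral => r _.
  rewrite patchE /k [\1_(`]0%R, +oo[%classic) r]indicE.
  by case: ifPn => _; rewrite ?mul1r// mul0r mul0e.
have mscale : measurable_fun [set: M * T] (fun p : M * T => p.2 *: p.1).
  exact: measurable_mxZ.
have mkf : measurable_fun [set: M * T] (fun p : M * T => (k p.2)%:E * f (p.2 *: p.1))%E.
  apply: emeasurable_funM; last exact: (measurableT_comp mf mscale).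
  by apply/measurable_EFinP; exact: (measurableT_comp mk).
have kf0 U r : (0 <= (k r)%:E * f (r *: U))%E by rewrite mule_ge0// lee_fin.
under [RHS]eq_integral do rewrite kE.
rewrite (polar_integral polar_sphere_measure F0 mF).
have mh : measurable_fun [set: M * T] (fun p : M * T =>
    (\1_(`]0%R, +oo[%classic) p.2 * p.2 ^+ (symdim d).-1)%:E * F (p.2 *: p.1))%E.
  apply: emeasurable_funM; last exact: (measurableT_comp mF mscale).
  apply/measurable_EFinP; apply: measurable_funM; last exact: measurable_funX.
  exact: (measurableT_comp (measurable_indic _)).
apply: (polar_ae_eq polar_sphere_measure).
- move=> U; apply: integral_ge0 => r _; rewrite mule_ge0// lee_fin indicE.
  have [/set_mem|_] := boolP (r \in _); last by rewrite mul0r.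
  by rewrite /= in_itv/= andbT => r0; rewrite mul1r exprn_ge0// ltW.
- by move=> U; rewrite mule_ge0 ?lee_fin ?sphere_density_ge0// integral_ge0.
- apply: (measurable_fun_integral (m2 := leb) (fun (U : M) (r : T) =>
    (\1_(`]0%R, +oo[%classic) r * r ^+ (symdim d).-1)%:E * F (r *: U))%E) => //.
  move=> U r; rewrite mule_ge0// lee_fin indicE.
  have [/set_mem|_] := boolP (r \in _); last by rewrite mul0r.
  by rewrite /= in_itv/= andbT => r0; rewrite mul1r exprn_ge0// ltW.
- apply: emeasurable_funM.
    by apply/measurable_EFinP; exact: measurable_sphere_density.
  exact: (measurable_fun_integral (m2 := leb) (fun (U : M) (r : T) =>
    (k r)%:E * f (r *: U))%E).
move=> U SU pU.
rewrite -ge0_integralZl//; last 2 first.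
- exact: (measurableT_comp mkf (measurable_pair1 U)).
- by rewrite lee_fin sphere_density_ge0.
apply: eq_integral => r _; rewrite /F !muleA -!EFinM; congr (_%:E * _)%E.
rewrite /sphere_density [\1_(trsphere d `&` pdmx d) U]indicE mem_set// mul1r /k indicE.
have [/set_mem|_] := boolP (r \in _); last by rewrite !mul0r mulr0.
rewrite /= in_itv/= andbT => r0; rewrite !mul1r.
rewrite linearZ/= SU.2 mulr1 detZ powRM ?exprn_ge0 ?(ltW r0) ?(ltW (det_pdmx_gt0 pU))//.
rewrite -!powR_mulrn ?(ltW r0)// -powRrM -powRN.
rewrite [LHS](_ : _ = q r * \det U `^ (eta - d.+1%:R / 2) * (r `^ (symdim d).-1%:R *
  r `^ (- (eta * d%:R)) * r `^ (d%:R * (eta - d.+1%:R / 2)))); last by ring.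
have rr : r != 0 by rewrite gt_eqF.
rewrite -!powRD ?rr ?implybT//.
rewrite (_ : _ + _ + _ = - 1); last first.
  by rewrite -subn1 natrB ?symdim_gt0// symdim_double; field.
by rewrite powRN powRr1 ?ltW//; ring.
Qed.

End levy_density.

Lemma integral_expR_half {R : realType} :
  (\int[@lebesgue_measure R]_(r in `]0%R, +oo[) (expR (- (r / 2)))%:E < +oo)%E.
Proof.
pose f (x : R) : \bar R := (\1_(`]0%R, +oo[%classic) x * expR (- x))%:E.
have f0 x : (0 <= f x)%E by rewrite lee_fin mulr_ge0 ?expR_ge0// indicE.
have mf : measurable_fun [set: measurableTypeR R] f.
  apply/measurable_EFinP; apply: measurable_funM; first exact: measurable_indic.
  by apply: measurableT_comp => //; exact: measurable_funN.
have h0 : 0 < 2^-1 :> R by rewrite invr_gt0.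
have fE : (\int[@lebesgue_measure R]_x f x < +oo)%E.
  have := @integral_gamma_fin R 0 (ltrN10 _); congr (_ < _)%E.
  rewrite [LHS]integral_mkcond; apply: eq_integral => x _.
  by rewrite patchE /f indicE powRr0 mulr1; case: ifP => _; rewrite ?mul1r ?mul0r.
move: fE; rewrite -(integral_affine 0 h0 f0 mf).
rewrite [X in (_ * X)%E](_ : _ =
  (\int[@lebesgue_measure R]_(r in `]0%R, +oo[) (expR (- (r / 2)))%:E)%E); last first.
  rewrite [RHS]integral_mkcond; apply: eq_integral => x _.
  rewrite patchE /f indicE addr0 [2^-1 * x]mulrC.
  have -> : (x / 2 \in `]0%R, +oo[%classic) = (x \in `]0%R, +oo[%classic).
    by apply/idP/idP; rewrite !inE /= !in_itv/= !andbT pmulr_lgt0.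
  by case: ifP => _; rewrite ?mul1r ?mul0r.
set I := (\int[_]_(r in _) _)%E => I2; rewrite ltey; apply/eqP => Ioo.
by move: I2; rewrite Ioo gt0_muley ?ltxx// lte_fin.
Qed.

(** * Mass of the sphere and the normalising constant *)

Section levy_mass.
Context {R : realType} (d : nat) (eta : R).
Hypotheses (d_gt0 : (0 < d)%N) (heta : (d%:R - 1) / 2 < eta).
Notation M := 'M[R]_d.
Let T := measurableTypeR R.
Notation leb := (@lebesgue_measure R).
Notation ls := (@lebesgue_sym R d).

Definition sphere_mass : \bar R :=
  (\int[sphere_measure d]_U (@sphere_density R d eta U)%:E)%E.

Lemma levy_integral (q : R -> R) : (forall r, 0 <= q r) ->
  measurable_fun [set: T] (q : T -> T) ->
  (\int[ls]_X (levy_density eta q X)%:E =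
   sphere_mass * \int[leb]_(r in `]0%R, +oo[) (q r / r)%:E)%E.
Proof.
move=> q0 mq; have := polar_density eta d_gt0 q0 mq (f := cst 1%E) (fun=> lee01).
move=> /(_ (measurable_cst _)).
under eq_integral do rewrite /= mule1.
move=> ->; set I := (X in (_ * X)%E).
transitivity (\int[sphere_measure d]_U ((@sphere_density R d eta U)%:E * I))%E.
  apply: eq_integral => U _; congr (_ * _)%E.
  by apply: eq_integral => r _; rewrite mule1.
rewrite ge0_integralZr//.
- by apply/measurable_EFinP; exact: measurable_sphere_density.
- by move=> U _; rewrite lee_fin sphere_density_ge0.
- apply: integral_ge0 => r; rewrite /= in_itv/= andbT => r0.
  by rewrite lee_fin divr_ge0// ltW.
Qed.

(** The hypothesis on [eta] is precisely the range of exponents in which the Siegel integral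
    converges. *)
Let exponent_gt : -1 < eta - d.+1%:R / 2.
Proof. by move: heta; rewrite -[d.+1%:R]natr1; lra. Qed.

Let gammaE : R := eta * d%:R - 1.

Let gammaE_gt : -1 < gammaE.
Proof.
rewrite /gammaE ltrBrDr addNr mulr_gt0 ?ltr0n//.
apply: le_lt_trans heta; rewrite divr_ge0// subr_ge0 ler1n; exact: d_gt0.
Qed.

Lemma siegel_polar : (siegel_integral d (eta - d.+1%:R / 2) = sphere_mass *
  \int[leb]_(r in `]0%R, +oo[) (expR (- r) * r `^ (eta * d%:R - 1))%:E)%E.
Proof.
have q0 r : 0 <= expR (- r) * r `^ (eta * d%:R) :> R by rewrite mulr_ge0 ?expR_ge0 ?powR_ge0.
have mq : measurable_fun [set: T] (fun r : T => expR (- r) * r `^ (eta * d%:R) : T).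
  apply: measurable_funM; last exact: measurable_powR.
  by apply: measurableT_comp => //; exact: measurable_funN.
transitivity (\int[ls]_X
    (levy_density eta (fun r => expR (- r) * r `^ (eta * d%:R)) X)%:E)%E.
  apply: eq_integral => X _; rewrite /siegel_density /levy_density indicE.
  have [/set_mem pX|_] := boolP (X \in _); last by rewrite !mul0r.
  by rewrite mulfK// gt_eqF// powR_gt0// trace_pd_gt0.
rewrite levy_integral//; congr (_ * _)%E; apply: eq_integral => r /set_mem.
rewrite /= in_itv/= andbT => r0; rewrite powRD ?(gt_eqF r0) ?implybT// powRN powRr1 ?ltW//.
by rewrite mulrA.
Qed.

(** [siegel_polar] writes a positive finite number as the mass times a positive radial integral. *)
Lemma sphere_mass_gt0_fin : (0 < sphere_mass < +oo)%E.
Proof.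
have /andP[s0 soo] := @siegel_integral_gt0_fin R d _ exponent_gt.
have g0 := integral_gamma_gt0 (eta * d%:R - 1).
have m0 : (0 <= sphere_mass)%E.
  by apply: integral_ge0 => U _; rewrite lee_fin sphere_density_ge0.
rewrite siegel_polar in s0 soo; apply/andP; split.
  rewrite lt_neqAle m0 andbT; apply/eqP => m00.
  by move: s0; rewrite -m00 mul0e ltxx.
rewrite ltey; apply/eqP => moo.
by move: soo; rewrite moo gt0_mulye ?ltxx.
Qed.

Lemma sphere_mass_fin_num : sphere_mass \is a fin_num.
Proof. by have /andP[/ltW ? ?] := sphere_mass_gt0_fin; rewrite ge0_fin_numE. Qed.

(** [mvGamma] factors as the mass of the sphere times [Gamma (eta * d)], so the constant is [omega]
    divided by that mass. *)
Lemma c_const_mass omega : c_const d eta omega * fine sphere_mass = omega.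
Proof.
have gf : (\int[leb]_(r in `]0%R, +oo[) (expR (- r) * r `^ (eta * d%:R - 1))%:E)%E
    \is a fin_num.
  by rewrite ge0_fin_numE ?(ltW (integral_gamma_gt0 _))// integral_gamma_fin.
have mvE : mvGamma d eta = fine sphere_mass * Gamma (eta * d%:R).
  rewrite -fineM ?sphere_mass_fin_num// -siegel_polar; congr fine.
  rewrite /siegel_integral [LHS]integral_mkcond; apply: eq_integral => X _.
  by rewrite patchE /siegel_density indicE; case: ifP => _; rewrite ?mul1r ?mul0r.
have G0 : Gamma (eta * d%:R) != 0.
  rewrite gt_eqF// /Gamma; apply: fine_gt0.
  by rewrite integral_gamma_gt0 -ge0_fin_numE ?(ltW (integral_gamma_gt0 _)).
have S0 : fine sphere_mass != 0.
  by rewrite gt_eqF// fine_gt0// sphere_mass_gt0_fin.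
by rewrite /c_const mvE; field; rewrite G0.
Qed.

Lemma c_const_gt0 omega : 0 < omega -> 0 < c_const d eta omega.
Proof.
have S0 : 0 < fine sphere_mass by rewrite fine_gt0// sphere_mass_gt0_fin.
by move=> w0; rewrite -(pmulr_lgt0 _ S0) c_const_mass.
Qed.

(** The factor [r] in the bound compensates [dr / r] at 0, and the rate 1/2 leaves room for an
    exponential moment of the increments. *)
Lemma levy_integral_fin (q : R -> R) : (forall r, 0 <= q r) ->
  measurable_fun [set: T] (q : T -> T) ->
  (forall r, 0 < r -> q r <= r * expR (- (r / 2))) ->
  (\int[ls]_X (levy_density eta q X)%:E < +oo)%E.
Proof.
move=> q0 mq qle; rewrite levy_integral// lte_mul_pinfty//.
- by have /andP[/ltW] := sphere_mass_gt0_fin.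
- exact: sphere_mass_fin_num.
apply: le_lt_trans (@integral_expR_half R).
have meR : measurable_fun (`]0%R, +oo[%classic : set T) (fun r : T => (expR (- (r / 2)))%:E).
  apply/measurable_EFinP; apply: measurable_funTS; apply: measurableT_comp => //.
  by apply: measurable_funN; exact: measurable_funM.
apply: ge0_le_integral => //.
- by move=> r /=; rewrite in_itv/= andbT => r0; rewrite lee_fin divr_ge0// ltW.
- have mp : measurable_fun (`]0%R, +oo[%classic : set T) (fun r : T => (q r * r `^ (- 1))%:E).
    apply/measurable_EFinP; apply: measurable_funTS; apply: measurable_funM; first exact: mq.
    exact: (@measurable_powR R (- 1)).
  apply: eq_measurable_fun mp => r /set_mem; rewrite /= in_itv/= andbT => r0.
  by rewrite powRN powRr1 ?ltW.
- move=> r /=; rewrite in_itv/= andbT => r0.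
  by rewrite lee_fin ler_pdivrMr// mulrC qle.
Qed.

End levy_mass.

(** * Laplace exponents of the Gamma measure and of its halving increment *)

Section exponent.
Context {R : realType} (d : nat) (eta : R).
Hypotheses (d_gt0 : (0 < d)%N) (heta : (d%:R - 1) / 2 < eta).
Notation M := 'M[R]_d.
Let T := measurableTypeR R.
Notation leb := (@lebesgue_measure R).
Notation ls := (@lebesgue_sym R d).

Definition gamma_radial (r : R) : R := expR (- r).

(* The absolute value only serves to make this nonnegative for [r < 0]. *)
Definition increment_radial (r : R) : R := expR (- r) * (1 - expR (- `|r|)).

Lemma gamma_radial_ge0 r : 0 <= gamma_radial r.
Proof. exact: expR_ge0. Qed.

Lemma increment_radial_ge0 r : 0 <= increment_radial r.
Proof. by rewrite mulr_ge0 ?expR_ge0// subr_ge0 -expR0 ler_expR oppr_le0. Qed.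

Lemma measurable_gamma_radial : measurable_fun [set: T] (gamma_radial : T -> T).
Proof. by apply: measurableT_comp => //; exact: measurable_funN. Qed.

Lemma measurable_increment_radial : measurable_fun [set: T] (increment_radial : T -> T).
Proof.
apply: measurable_funM; first exact: measurable_gamma_radial.
apply: measurable_funB => //; apply: measurableT_comp => //.
by apply: measurable_funN; exact: normr_measurable.
Qed.

Notation gamma_density := (@levy_density R d eta gamma_radial).
Notation increment_density := (@levy_density R d eta increment_radial).

Lemma increment_integral_fin :
  (\int[ls]_X (increment_density X)%:E < +oo)%E.
Proof.
apply: levy_integral_fin => //; first exact: increment_radial_ge0.
  exact: measurable_increment_radial.
move=> r r0; rewrite /increment_radial gtr0_norm// mulrC ler_pM ?expR_ge0//.
- by rewrite subr_ge0 -expR0 ler_expR oppr_le0 ltW.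
- by rewrite lerBlDl -lerBlDr; exact: expR_ge1Dx.
- by rewrite ler_expR lerN2 ler_pdivrMr// ler_pMr// ler1n.
Qed.

Lemma increment_exp_moment_fin :
  (\int[ls]_X (increment_density X * expR (\tr X / 2))%:E < +oo)%E.
Proof.
under eq_integral do rewrite -(levy_densityM eta increment_radial (fun t => expR (t / 2))).
apply: levy_integral_fin => //.
- by move=> r; rewrite mulr_ge0 ?expR_ge0 ?increment_radial_ge0.
- apply: measurable_funM; first exact: measurable_increment_radial.
  by apply: measurableT_comp => //; exact: measurable_funM.
move=> r r0; rewrite /increment_radial gtr0_norm// mulrAC -expRD mulrC.
rewrite (_ : - r + r / 2 = - (r / 2)); last by field.
rewrite ler_pM2r ?expR_gt0// lerBlDl -lerBlDr; exact: expR_ge1Dx.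
Qed.

Lemma gamma_trace_fin :
  (\int[ls]_X (gamma_density X * `|\tr X|)%:E < +oo)%E.
Proof.
under eq_integral do rewrite -(levy_densityM eta gamma_radial (fun t => `|t|)).
apply: levy_integral_fin => //.
- by move=> r; rewrite mulr_ge0 ?expR_ge0.
- by apply: measurable_funM; [exact: measurable_gamma_radial|exact: normr_measurable].
move=> r r0; rewrite gtr0_norm// mulrC ler_pM2l// ler_expR lerN2.
by rewrite ler_pdivrMr// ler_pMr// ler1n.
Qed.

Lemma levy_density_notin (q : R -> R) (X : M) : ~ pdmx d X -> levy_density eta q X = 0.
Proof. by move=> nX; rewrite /levy_density indicE memNset// mul0r. Qed.

Lemma one_sub_expfun_le (Theta X : M) : pdmx d X ->
  1 - expfun Theta X <= (\sum_i \sum_j `|Theta i j|) * `|\tr X|.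
Proof.
move=> pX; have psX := pdmx_psdmx pX.
apply: (@le_trans _ _ (\tr (Theta *m X))).
  by rewrite lerBlDl -lerBlDr; exact: expR_ge1Dx.
rewrite [`|\tr X|]ger0_norm ?mxtrace_psdmx_ge0//.
exact: le_trans (ler_norm _) (mxtrace_mul_le _ psX).
Qed.

Definition laplace_exponent (q : R -> R) (Theta : M) : \bar R :=
  (\int[ls]_X (levy_density eta q X * (1 - expfun Theta X))%:E)%E.

Section with_Theta.
Variable Theta : M.
Hypothesis pTheta : psdmx d Theta.

Lemma exponent_integrand_ge0 q X : (forall r, 0 <= q r) ->
  0 <= levy_density eta q X * (1 - expfun Theta X).
Proof.
move=> q0; have [pX|nX] := pselect (pdmx d X); last by rewrite levy_density_notin// mul0r.
rewrite mulr_ge0 ?levy_density_ge0// subr_ge0 expfun_le1//; exact: pdmx_psdmx.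
Qed.

Lemma measurable_exponent_integrand q : measurable_fun [set: T] (q : T -> T) ->
  measurable_fun [set: M] (fun X => (levy_density eta q X * (1 - expfun Theta X))%:E).
Proof.
move=> mq; apply/measurable_EFinP; apply: measurable_funM.
  exact: measurable_levy_density.
by apply: measurable_funB => //; exact: measurable_expfun.
Qed.

Lemma laplace_exponent_ge0 q : (forall r, 0 <= q r) -> (0 <= laplace_exponent q Theta)%E.
Proof.
by move=> q0; apply: integral_ge0 => X _; rewrite lee_fin exponent_integrand_ge0.
Qed.

Lemma gamma_exponent_le : (laplace_exponent gamma_radial Theta <=
  (\sum_i \sum_j `|Theta i j|)%:E * \int[ls]_X (gamma_density X * `|\tr X|)%:E)%E.
Proof.
rewrite -ge0_integralZl//; last 3 first.
- apply/measurable_EFinP; apply: measurable_funM.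
    by apply: measurable_levy_density; exact: measurable_gamma_radial.
  by apply: measurableT_comp => //; exact: measurable_mxtrace.
- by move=> X _; rewrite lee_fin mulr_ge0 ?levy_density_ge0//; exact: gamma_radial_ge0.
- by rewrite lee_fin; do 2 apply: sumr_ge0 => ? _.
apply: ge0_le_integral => //.
- by move=> X _; rewrite lee_fin exponent_integrand_ge0//; exact: gamma_radial_ge0.
- by apply: measurable_exponent_integrand; exact: measurable_gamma_radial.
- apply: emeasurable_funM => //; apply/measurable_EFinP; apply: measurable_funM.
    by apply: measurable_levy_density; exact: measurable_gamma_radial.
  by apply: measurableT_comp => //; exact: measurable_mxtrace.
move=> X _; rewrite -EFinM lee_fin mulrCA.
have [pX|nX] := pselect (pdmx d X); last by rewrite !levy_density_notin// !mul0r.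
by rewrite ler_wpM2l ?levy_density_ge0 ?one_sub_expfun_le//; exact: gamma_radial_ge0.
Qed.

Lemma increment_exponent_le : (laplace_exponent increment_radial Theta <=
  \int[ls]_X (increment_density X)%:E)%E.
Proof.
apply: ge0_le_integral => //.
- by move=> X _; rewrite lee_fin exponent_integrand_ge0//; exact: increment_radial_ge0.
- by apply: measurable_exponent_integrand; exact: measurable_increment_radial.
- apply/measurable_EFinP; apply: measurable_levy_density.
  exact: measurable_increment_radial.
move=> X _; rewrite lee_fin ler_piMr ?levy_density_ge0//; first exact: increment_radial_ge0.
by rewrite gerBl expfun_ge0.
Qed.

Lemma increment_integralD :
  (\int[ls]_X (increment_density X * expfun Theta X)%:E +
   laplace_exponent increment_radial Theta = \int[ls]_X (increment_density X)%:E)%E.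
Proof.
rewrite -ge0_integralD//; last 4 first.
- by move=> X _; rewrite lee_fin mulr_ge0 ?levy_density_ge0 ?expfun_ge0//;
    exact: increment_radial_ge0.
- apply/measurable_EFinP/measurable_funM; last exact: measurable_expfun.
  by apply: measurable_levy_density; exact: measurable_increment_radial.
- by move=> X _; rewrite lee_fin exponent_integrand_ge0//; exact: increment_radial_ge0.
- by apply: measurable_exponent_integrand; exact: measurable_increment_radial.
by apply: eq_integral => X _; rewrite -EFinD; congr EFin; ring.
Qed.

(** Apart from [q] the density is homogeneous of degree [- symdim d], the exponents of 2 adding up
    to 0, so its product with Lebesgue measure is invariant under dilation. *)
Lemma levy_density_scale2 (q : R -> R) X : pdmx d X ->
  2 ^+ symdim d * levy_density eta q (2 *: X) = levy_density eta (fun r => q (2 * r)) X.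
Proof.
move=> pX; have t0 := trace_pd_gt0 d_gt0 pX; have D0 := det_pdmx_gt0 pX.
have p2X : pdmx d (2 *: X) by exact: pdmxZ.
rewrite /levy_density !indicE !mem_set// !mul1r detZ linearZ/=.
rewrite powRM ?(ltW t0)// powRM ?exprn_ge0 ?(ltW D0)// -!powR_mulrn// -powRrM.
rewrite invfM -!powRN.
rewrite [LHS](_ : _ = (2 `^ (symdim d)%:R * 2 `^ (- (eta * d%:R)) *
  2 `^ (d%:R * (eta - d.+1%:R / 2))) * (q (2 * \tr X) * (\tr X) `^ (- (eta * d%:R)) *
  \det X `^ (eta - d.+1%:R / 2))); last by ring.
have two0 : (2 : R) != 0 by [].
rewrite -!powRD ?two0 ?implybT// symdim_double.
rewrite (_ : _ + _ + _ = 0); first by rewrite powRr0 mul1r.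
by field.
Qed.

(* Substituting [X = 2 Z] in the exponent at [Theta / 2] turns [e^{-r}] into
   [e^{-2r}], and [e^{-r} - e^{-2r}] is the radial part of the increment. *)
Lemma gamma_exponent_half : (laplace_exponent gamma_radial Theta =
  laplace_exponent gamma_radial (2^-1 *: Theta) +
  laplace_exponent increment_radial Theta)%E.
Proof.
pose q2 r : R := gamma_radial (2 * r).
have q20 r : 0 <= q2 r by exact: gamma_radial_ge0.
have mq2 : measurable_fun [set: T] (q2 : T -> T).
  by apply: (measurableT_comp measurable_gamma_radial); exact: measurable_funM.
have pT2 : psdmx d (2^-1 *: Theta) by apply: psdmxZ.
have -> : laplace_exponent gamma_radial (2^-1 *: Theta) = laplace_exponent q2 Theta.
  have mf : measurable_fun [set: M] (fun X =>
      (gamma_density X * (1 - expfun (2^-1 *: Theta) X))%:E).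
    apply/measurable_EFinP; apply: measurable_funM.
      by apply: measurable_levy_density; exact: measurable_gamma_radial.
    by apply: measurable_funB => //; exact: measurable_expfun.
  have f0 X : (0 <= (gamma_density X * (1 - expfun (2^-1 *: Theta) X))%:E)%E.
    have [pX|nX] := pselect (pdmx d X); last by rewrite levy_density_notin// mul0r.
    rewrite lee_fin mulr_ge0 ?levy_density_ge0//; first exact: gamma_radial_ge0.
    by rewrite subr_ge0 expfun_le1//; exact: pdmx_psdmx.
  rewrite /laplace_exponent.
  rewrite -(@integral_lebesgue_sym_affine R d 2 0 _ _ _ f0 mf)//; last by rewrite linear0.
  rewrite -ge0_integralZl//; last first.
    have ma : measurable_fun [set: M] (fun X : M => 2 *: X + 0 : M).
      by apply: measurable_mxD => //; exact: measurable_mxZ.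
    exact: (measurableT_comp mf ma).
  apply: eq_integral => X _; rewrite -EFinM addr0 mulrA; congr EFin.
  have [pX|nX] := pselect (pdmx d X); last first.
    rewrite !levy_density_notin ?mulr0 ?mul0r//.
    have h0 : 0 < 2^-1 :> R by rewrite invr_gt0.
    by move=> /(pdmxZ h0); rewrite scalerA mulVf// scale1r.
  rewrite levy_density_scale2//; congr (_ * (1 - expR (- _))).
  by rewrite -scalemxAl -scalemxAr scalerA mulVf// scale1r.
rewrite -ge0_integralD//; last 4 first.
- by move=> X _; rewrite lee_fin exponent_integrand_ge0.
- exact: measurable_exponent_integrand.
- by move=> X _; rewrite lee_fin exponent_integrand_ge0//; exact: increment_radial_ge0.
- by apply: measurable_exponent_integrand; exact: measurable_increment_radial.
apply: eq_integral => X _; rewrite -EFinD -mulrDl -levy_densityD; congr ((_ * _)%:E).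
have [pX|nX] := pselect (pdmx d X); last by rewrite !levy_density_notin.
rewrite /levy_density; congr (_ * (_ / _ * _)).
rewrite /increment_radial /q2 /gamma_radial gtr0_norm ?trace_pd_gt0//.
have -> : - (2 * \tr X) = - \tr X + - \tr X by ring.
by rewrite expRD; ring.
Qed.

End with_Theta.
End exponent.

(** * The finite jump measure and its compound Poisson law *)

Section jumps.
Context {R : realType} (d : nat) (eta : R).
Hypotheses (d_gt0 : (0 < d)%N) (heta : (d%:R - 1) / 2 < eta).
Variable kappa : R.
Hypothesis kappa_gt0 : 0 < kappa.
Notation M := 'M[R]_d.
Let T := measurableTypeR R.
Notation leb := (@lebesgue_measure R).
Notation ls := (@lebesgue_sym R d).
Notation increment_density := (@levy_density R d eta increment_radial).
Notation gamma_density := (@levy_density R d eta gamma_radial).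

Let kdens (X : M) : R := kappa * increment_density X.

Let kdens_ge0 X : 0 <= kdens X.
Proof.
by rewrite mulr_ge0 ?(ltW kappa_gt0) ?levy_density_ge0//; exact: increment_radial_ge0.
Qed.

Let measurable_kdens : measurable_fun [set: M] (EFin \o kdens).
Proof.
apply/measurable_EFinP; apply: measurable_funM => //.
by apply: measurable_levy_density; exact: measurable_increment_radial.
Qed.

Definition jump_measure of (0 < d)%N & (d%:R - 1) / 2 < eta : set M -> \bar R := density_measure ls kdens_ge0 measurable_kdens.

Local Notation jump := (jump_measure d_gt0 heta).

HB.instance Definition _ := Measure.copy jump
  (density_measure ls kdens_ge0 measurable_kdens).

Lemma integral_jump f : (forall X, 0 <= f X)%E -> measurable_fun [set: M] f ->
  (\int[jump]_X f X = kappa%:E * \int[ls]_X ((increment_density X)%:E * f X))%E.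
Proof.
move=> f0 mf; rewrite [LHS]integral_density_measure//.
rewrite -ge0_integralZl//; last 3 first.
- apply: emeasurable_funM => //; apply/measurable_EFinP.
  by apply: measurable_levy_density; exact: measurable_increment_radial.
- move=> X _; rewrite mule_ge0// lee_fin levy_density_ge0//.
  exact: increment_radial_ge0.
- by rewrite lee_fin ltW.
by apply: eq_integral => X _; rewrite EFinM muleA.
Qed.

Let jumpT : (jump setT < +oo)%E.
Proof.
rewrite -[X in (X < _)%E]mul1e -integral_cst//.
rewrite (integral_jump (f := cst 1%E))//.
under eq_integral do rewrite /= mule1.
rewrite lte_mul_pinfty// ?lee_fin ?(ltW kappa_gt0)//.
exact: increment_integral_fin.
Qed.

Let jump_fin : fin_num_fun jump.
Proof. exact: lty_fin_num_fun. Qed.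

HB.instance Definition _ := Measure_isFinite.Build _ _ _ jump jump_fin.

Lemma jump_pdmx : jump (~` pdmx d) = 0%E.
Proof.
have mp : measurable (~` pdmx d : set M) by apply: measurableC; exact: measurable_pdmx.
rewrite [LHS]density_measureE//; apply: integral0_eq => X nX.
by rewrite /kdens levy_density_notin ?mulr0.
Qed.

Lemma jump_psdmx : jump (~` psdmx d) = 0%E.
Proof.
apply/eqP; rewrite eq_le measure_ge0 andbT -jump_pdmx.
apply: le_measure; rewrite ?inE.
- by apply: measurableC; exact: measurable_psdmx.
- by apply: measurableC; exact: measurable_pdmx.
- exact: subsetC (@pdmx_psdmx R d).
Qed.

Definition jump_sum : probability M R := probability_of_measure (compound_poissonT jump).

Lemma jump_sum_psdmx : jump_sum (~` psdmx d) = 0%E.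
Proof.
apply: compound_poisson_support; [exact: measurable_psdmx|exact: psdmx0|
  exact: psdmxD|exact: jump_psdmx].
Qed.

(** Finiteness is the condition imposed on [Theta], so the formula also applies at minus half the
    identity and gives an exponential moment. *)
Let integral_jump_sum_exp (Theta : M) :
  (\int[ls]_X (increment_density X * expfun Theta X)%:E < +oo)%E ->
  (\int[jump_sum]_X (expfun Theta X)%:E =
   (expR (kappa * fine (\int[ls]_X (increment_density X * expfun Theta X)%:E) -
     fine (jump setT)))%:E)%E.
Proof.
set I := (X in (X < _)%E) => Ioo.
have I0 : (0 <= I)%E.
  apply: integral_ge0 => X _; rewrite lee_fin mulr_ge0 ?expfun_ge0 ?levy_density_ge0//.
  exact: increment_radial_ge0.
apply: (@integral_compound_poisson _ _ jump (expfun Theta)).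
- exact: expfun_ge0.
- by apply/measurable_EFinP; exact: measurable_expfun.
- exact: expfunr0.
- exact: expfunDr.
rewrite integral_jump//; last 2 first.
- by move=> X; rewrite lee_fin expfun_ge0.
- by apply/measurable_EFinP; exact: measurable_expfun.
by rewrite EFinM fineK// ge0_fin_numE.
Qed.

Lemma laplace_jump_sum (Theta : M) : psdmx d Theta ->
  (\int[jump_sum]_X (expfun Theta X)%:E =
   (expR (- (kappa * fine (laplace_exponent eta increment_radial Theta))))%:E)%E.
Proof.
move=> pT; have := increment_integralD eta pT.
set I := (X in (X + _)%E); set J := laplace_exponent _ _ _ => IJ.
have I0 : (0 <= I)%E.
  apply: integral_ge0 => X _; rewrite lee_fin mulr_ge0 ?expfun_ge0 ?levy_density_ge0//.
  exact: increment_radial_ge0.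
have J0 : (0 <= J)%E by apply: laplace_exponent_ge0 => //; exact: increment_radial_ge0.
have IJoo : (I + J < +oo)%E by rewrite IJ; exact: increment_integral_fin.
have Ioo : (I < +oo)%E by apply: le_lt_trans IJoo; rewrite leeDl.
have Joo : (J < +oo)%E by apply: le_lt_trans IJoo; rewrite leeDr.
rewrite integral_jump_sum_exp//; congr (expR _)%:E.
have -> : jump setT = (kappa%:E * (I + J))%E.
  rewrite IJ -[LHS]mul1e -integral_cst//.
  rewrite (integral_jump (f := cst 1%E))//.
  by under eq_integral do rewrite /= mule1.
have If : I \is a fin_num by rewrite ge0_fin_numE.
have Jf : J \is a fin_num by rewrite ge0_fin_numE.
by rewrite -/I -(fineK If) -(fineK Jf) -EFinD -EFinM /=; ring.
Qed.

(** [|t| <= 2 (exp(t/2) + exp(-t/2))] bounds the trace by the exponential integrals at half the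
    identity and at its opposite. *)
Lemma jump_sum_trace_fin : (\int[jump_sum]_X (`|\tr X|)%:E < +oo)%E.
Proof.
pose h : M := 2^-1 *: 1%:M.
have trh X : \tr (h *m X) = \tr X / 2.
  by rewrite -scalemxAl mul1mx linearZ/= mulrC.
have trNh X : \tr (- h *m X) = - (\tr X / 2) by rewrite mulNmx linearN/= trh.
have ph : psdmx d h by apply: psdmxZ => //; apply: pdmx_psdmx; exact: pdmx1.
have e1 : (\int[jump_sum]_X (expfun h X)%:E < +oo)%E.
  by rewrite laplace_jump_sum// ltry.
have e2 : (\int[jump_sum]_X (expfun (- h) X)%:E < +oo)%E.
  rewrite integral_jump_sum_exp ?ltry//.
  under eq_integral do rewrite /expfun trNh opprK.
  exact: increment_exp_moment_fin.
apply: (@le_lt_trans _ _ (\int[jump_sum]_X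
    (2%:E * ((expfun h X)%:E + (expfun (- h) X)%:E)))%E).
  apply: ge0_le_integral => //.
  - apply/measurable_EFinP; apply: measurableT_comp => //.
    exact: measurable_mxtrace.
  - apply: emeasurable_funM => //; apply: emeasurable_funD;
      by apply/measurable_EFinP; exact: measurable_expfun.
  move=> X _; rewrite -EFinD -EFinM lee_fin /expfun trh trNh opprK.
  have := expR_ge1Dx (\tr X / 2); have := expR_ge1Dx (- (\tr X / 2)).
  have := expR_ge0 (\tr X / 2); have := expR_ge0 (- (\tr X / 2)).
  move: (expR _) (expR _) => u v u0 v0 hu hv.
  rewrite ler_norml; apply/andP; split; lra.
rewrite ge0_integralZl//; last 2 first.
- by apply: emeasurable_funD; apply/measurable_EFinP; exact: measurable_expfun.
- by move=> X _; rewrite adde_ge0// lee_fin expfun_ge0.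
rewrite ge0_integralD//; last 4 first.
- by move=> X _; rewrite lee_fin expfun_ge0.
- by apply/measurable_EFinP; exact: measurable_expfun.
- by move=> X _; rewrite lee_fin expfun_ge0.
- by apply/measurable_EFinP; exact: measurable_expfun.
apply: lte_mul_pinfty; [by rewrite lee_fin|by []|].
exact: lte_add_pinfty e1 e2.
Qed.

End jumps.

(** * A common lower bound for translates of the jump density *)

Section minorization.
Context {R : realType} (d : nat) (eta : R).
Hypotheses (d_gt0 : (0 < d)%N) (heta : (d%:R - 1) / 2 < eta).
Notation M := 'M[R]_d.
Let T := measurableTypeR R.
Notation ls := (@lebesgue_sym R d).
Notation increment_density := (@levy_density R d eta increment_radial).

(** The constant is crude: the form of [W] is bounded through its [d^2] entries, each at most [c] in
    absolute value. *)
Lemma psdmx_scalar_sub c (W : M) : psdmx d W -> \tr W <= c ->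
  psdmx d ((d%:R ^+ 2 * c)%:M - W).
Proof.
move=> pW Wc; split; first by rewrite linearB/= tr_scalar_mx pW.1.
move=> v; rewrite -[X in _ <= X]/(qform _ v) qformD qformN -scalemx1 qformZ subr_ge0.
rewrite -mxtrace_mul_rank1.
apply: le_trans (ler_norm _) _; apply: le_trans (mxtrace_mul_le _ (psdmx_rank1 _)) _.
have -> : qform 1%:M v = \tr (v^T *m v) by rewrite -mxtrace_mul_rank1 mul1mx.
apply: ler_wpM2r; first exact: mxtrace_psdmx_ge0 (psdmx_rank1 _).
apply: (@le_trans _ _ (\sum_(i < d) \sum_(j < d) c)).
  by do 2 apply: ler_sum => ? _; apply: le_trans Wc; exact: psdmx_entry_le.
by rewrite !sumr_const !card_ord -[c *+ d]mulr_natl -[X in X <= _]mulr_natl mulrA expr2.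
Qed.

Let eta_gt0 : 0 < eta.
Proof. by apply: le_lt_trans heta; rewrite divr_ge0// subr_ge0 ler1n. Qed.

(** The exponent of the determinant may be negative but exceeds -1. Since [\det Y >= 1], the power
    is at least [1 / \det Y], hence at least [t^-d] by [det_pdmx_le]. The factor [1 - exp(-1)] comes
    from [\tr Y >= 1]. *)
Lemma increment_density_ge (Y : M) t : pdmx d (Y - 1%:M) -> \tr Y <= t ->
  (1 - expR (- 1)) * expR (- t) / (t `^ (eta * d%:R) * t `^ d%:R) <= increment_density Y.
Proof.
move=> pY1 Yt.
have pY : pdmx d Y by rewrite -(subrKC 1%:M Y); apply: pdmxD => //;
  apply: pdmx_psdmx; exact: pdmx1.
have tr1 : 1 <= \tr Y.
  have := trace_pd_gt0 d_gt0 pY1; rewrite linearB/= mxtrace1 subr_gt0 => /ltW.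
  by apply: le_trans; rewrite ler1n.
have tr0 : 0 < \tr Y by exact: lt_le_trans tr1.
have t0 : 0 < t by exact: lt_le_trans Yt.
have D1 := det_pdmx_ge1 pY1.
have D0 : 0 < \det Y by exact: lt_le_trans D1.
rewrite /levy_density indicE mem_set// mul1r powR_mulrn ?(ltW t0)//.
rewrite /increment_radial gtr0_norm// invfM.
rewrite mulrA mulrAC [X in _ <= X](_ : _ =
  (expR (- \tr Y) * (1 - expR (- \tr Y))) * \det Y `^ (eta - d.+1%:R / 2) /
  \tr Y `^ (eta * d%:R)); last by ring.
have e1 : expR (- 1) <= 1 :> R by rewrite -expR0 ler_expR oppr_le0.
have p0 : 0 < \tr Y `^ (eta * d%:R) by rewrite powR_gt0.
apply: ler_pM.
- by rewrite !mulr_ge0 ?expR_ge0 ?subr_ge0 ?invr_ge0 ?exprn_ge0// ltW.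
- by rewrite invr_ge0 powR_ge0.
- apply: ler_pM.
  + by rewrite mulr_ge0 ?expR_ge0 ?subr_ge0.
  + by rewrite invr_ge0 exprn_ge0 ?ltW.
  + rewrite mulrC ler_pM ?expR_ge0 ?subr_ge0 ?ler_expR ?lerN2//.
    by rewrite lerB// ler_expR lerN2.
  + apply: (@le_trans _ _ (\det Y `^ (- 1))).
      rewrite powRN powRr1 ?(ltW D0)// lef_pV2 ?posrE ?exprn_gt0//.
      apply: le_trans (det_pdmx_le pY) _.
      by apply: lerXn2r => //; rewrite nnegrE ltW.
    apply: ler_powR => //.
    by move: heta; rewrite -[d.+1%:R]natr1; lra.
- rewrite lef_pV2 ?posrE ?powR_gt0//; apply: ge0_ler_powR => //.
  + by rewrite mulr_ge0// ltW.
  + by rewrite nnegrE ltW.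
  + by rewrite nnegrE ltW.
Qed.

(** The bound of [increment_density_ge] at [t = \tr Z], on a set of [Z] where [Z - W] dominates the
    identity for every nonnegative [W] of trace at most [c]. One function thus lies below all these
    translates. *)
Definition minor_density (c : R) (Z : M) : R :=
  \1_(pdmx d) (Z - (d%:R ^+ 2 * c + 1)%:M) *
  ((1 - expR (- 1)) * expR (- \tr Z) / (\tr Z `^ (eta * d%:R) * \tr Z `^ d%:R)).

Lemma minor_density_le c (W Z : M) : psdmx d W -> \tr W <= c ->
  minor_density c Z <= increment_density (Z - W).
Proof.
move=> pW Wc; rewrite /minor_density indicE.
have [/set_mem pZ|_] := boolP (_ \in _); last first.
  by rewrite mul0r levy_density_ge0//; exact: increment_radial_ge0.
rewrite mul1r; apply: increment_density_ge.
  rewrite (_ : Z - W - 1%:M = (d%:R ^+ 2 * c)%:M - W + (Z - (d%:R ^+ 2 * c + 1)%:M)).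
    by apply: pdmxD => //; exact: psdmx_scalar_sub.
  by rewrite [(_ + 1)%:M]raddfD/= opprD addrA addrAC addrC !addrA -[in RHS]addrA;
    rewrite -addrAC; apply/matrixP => i j; rewrite !mxE; ring.
by rewrite linearB/= gerBl mxtrace_psdmx_ge0.
Qed.

Lemma minor_density_ge0 c Z : 0 <= minor_density c Z.
Proof.
rewrite /minor_density indicE !mulr_ge0 ?invr_ge0 ?mulr_ge0 ?powR_ge0 ?expR_ge0//.
Qed.

Lemma measurable_minor_density c : measurable_fun [set: M] (minor_density c : M -> T).
Proof.
have mt : measurable_fun [set: M] (fun X => \tr X : T) by exact: measurable_mxtrace.
have mp : measurable_fun [set: M] (fun Z : M => Z - (d%:R ^+ 2 * c + 1)%:M : M).
  exact: measurable_mxD.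
apply: measurable_funM.
  apply: (measurableT_comp _ mp).
  by apply: measurable_indic; exact: measurable_pdmx.
under eq_fun do rewrite invfM -!powRN.
apply: measurable_funM.
  apply: measurable_funM => //; apply: measurableT_comp => //.
  exact: measurable_funN.
by apply: measurable_funM; exact: measurable_fun_powR.
Qed.

(* Otherwise the translate of [siegel_density], which vanishes where
   [minor_density] does, would have integral zero. *)
Lemma minor_density_integral_gt0 c : 0 <= c ->
  (0 < \int[ls]_Z (minor_density c Z)%:E)%E.
Proof.
move=> c0; have I0 : (0 <= \int[ls]_Z (minor_density c Z)%:E)%E.
  by apply: integral_ge0 => Z _; rewrite lee_fin minor_density_ge0.
rewrite lt_neqAle I0 andbT; apply/eqP => /esym I00.
have mm : measurable_fun [set: M] (EFin \o minor_density c).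
  by apply/measurable_EFinP; exact: measurable_minor_density.
have ae0 : ae_eq ls setT (EFin \o minor_density c) (cst 0%E).
  apply/(ae_eq_integral_abs ls measurableT mm).
  rewrite -[RHS]I00; apply: eq_integral => Z _.
  by rewrite /= ger0_norm ?minor_density_ge0.
pose a := eta - d.+1%:R / 2.
have a1 : -1 < a by move: heta; rewrite /a -[d.+1%:R]natr1; lra.
have /andP[+ _] := @siegel_integral_gt0_fin R d a a1.
pose Z0 : M := - (d%:R ^+ 2 * c + 1)%:M.
have sZ0 : Z0^T = Z0 by rewrite /Z0 linearN/= tr_scalar_mx.
have s0 (X : M) : (0 <= (siegel_density a X)%:E :> \bar R)%E by rewrite lee_fin siegel_density_ge0.
have ms : measurable_fun [set: M] (fun X => (siegel_density a X)%:E).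
  by apply/measurable_EFinP; exact: measurable_siegel_density.
rewrite /siegel_integral -(integral_lebesgue_sym_affine ltr01 sZ0 s0 ms).
rewrite [X in (_ * X)%E](_ : _ = 0%E) ?mule0 ?ltxx//.
transitivity (\int[ls]_X cst (0 : \bar R)%E X)%E; last exact: integral0.
have mc : measurable_fun [set: M] (fun X : M => (siegel_density a (1 *: X + Z0))%:E).
  have ma : measurable_fun [set: M] (fun X : M => 1 *: X + Z0 : M).
    by apply: measurable_mxD => //; exact: measurable_mxZ.
  exact: (measurableT_comp ms ma).
apply: ae_eq_integral => //.
apply: filterS ae0 => Z /(_ I)/= h _; rewrite scale1r /siegel_density indicE.
have [/set_mem pZ|_] := boolP (_ \in _); last by rewrite mul0r.
have : 0 < minor_density c Z.
  have k0 : 0 < d%:R ^+ 2 * c + 1 by rewrite ltr_wpDl// mulr_ge0// exprn_ge0.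
  have pZ' : pdmx d Z.
    rewrite -(subrK (d%:R ^+ 2 * c + 1)%:M Z); apply: pdmxD; first exact: pdmx_psdmx.
    by rewrite -scalemx1; apply: pdmxZ => //; exact: pdmx1.
  have t0 := trace_pd_gt0 d_gt0 pZ'.
  rewrite /minor_density indicE mem_set// mul1r.
  rewrite mulr_gt0 ?invr_gt0 ?mulr_gt0 ?powR_gt0 ?expR_gt0//.
by case: h => ->; rewrite ltxx.
Qed.

End minorization.

(** * The halving chain: minorisation, drift and stationary law *)

Section stationary_law.
Context {R : realType} (d : nat) (eta : R).
Hypotheses (d_gt0 : (0 < d)%N) (heta : (d%:R - 1) / 2 < eta).
Variable kappa : R.
Hypothesis kappa_gt0 : 0 < kappa.
Notation M := 'M[R]_d.
Let T := measurableTypeR R.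
Notation ls := (@lebesgue_sym R d).
Notation increment_density := (@levy_density R d eta increment_radial).
Notation jump := (jump_measure kappa_gt0 d_gt0 heta).
Notation Y := (jump_sum d_gt0 heta kappa_gt0).

(** States off the cone are sent to 0, so that the kernel is defined on all matrices and one step
    leads into the cone almost surely. *)
Definition half_psd (x : M) : M := (2^-1 * \1_(psdmx d) x) *: x.

Lemma half_psdE x : psdmx d x -> half_psd x = 2^-1 *: x.
Proof. by move=> px; rewrite /half_psd indicE mem_set// mulr1. Qed.

Lemma psdmx_half_psd x : psdmx d (half_psd x).
Proof.
rewrite /half_psd indicE; have [/set_mem px|_] := boolP (x \in _).
  by rewrite mulr1; apply: psdmxZ.
by rewrite mulr0 scale0r; exact: psdmx0.
Qed.

Lemma measurable_half_psd : measurable_fun [set: M] half_psd.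
Proof.
apply: measurable_mxZ => //; apply: measurable_funM => //.
by apply: measurable_indic; exact: measurable_psdmx.
Qed.

Let norm_trace_half x : `|\tr (half_psd x)| <= `|\tr x| / 2.
Proof.
rewrite linearZ/= normrM mulrC ler_wpM2l// normrM gtr0_norm ?invr_gt0//.
rewrite ler_piMr// indicE ger0_norm//.
by case: (_ \in _).
Qed.

Let K (x : M) : {measure set M -> \bar R} :=
  image_measure Y (measurable_addl (half_psd x)).

Let mK U : measurable U -> measurable_fun [set: M] (fun x => K x U).
Proof.
move=> mU; have := measurable_shift_measure Y mU => mS.
exact: (measurableT_comp mS measurable_half_psd).
Qed.

Let K1 x : K x setT = 1%E.
Proof. by rewrite [LHS](probability_setT Y). Qed.

Let integral_K f x : (forall y, 0 <= f y)%E -> measurable_fun [set: M] f ->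
  (\int[K x]_y f y = \int[Y]_y f (half_psd x + y)%R)%E.
Proof. by move=> f0 mf; rewrite [LHS]integral_image_measure. Qed.

Let mu0 : R := fine (\int[Y]_y (`|\tr y|)%:E).
(** Beyond [c0] half of the trace exceeds [mu0 + 1], so halving alone pays for the mean increment
    and one further unit. *)
Let c0 : R := 2 * (mu0 + 1).

Let measurable_norm_trace : measurable_fun [set: M] (fun x => `|\tr x| : T).
Proof. by apply: measurableT_comp => //; exact: measurable_mxtrace. Qed.

Let mu0E : (\int[Y]_y (`|\tr y|)%:E = mu0%:E)%E.
Proof.
rewrite fineK// ge0_fin_numE; first exact: jump_sum_trace_fin.
by apply: integral_ge0 => y _; rewrite lee_fin.
Qed.

Let mu0_ge0 : 0 <= mu0.
Proof. by rewrite fine_ge0//; apply: integral_ge0 => y _; rewrite lee_fin. Qed.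

Let c0_ge0 : 0 <= c0.
Proof. by rewrite mulr_ge0// addr_ge0. Qed.

Let ldens (Z : M) : R := kappa * minor_density eta c0 Z.

Let ldens_ge0 Z : 0 <= ldens Z.
Proof. by rewrite mulr_ge0 ?(ltW kappa_gt0)// minor_density_ge0. Qed.

Let measurable_ldens : measurable_fun [set: M] (EFin \o ldens).
Proof.
by apply/measurable_EFinP; apply: measurable_funM => //; exact: measurable_minor_density.
Qed.

Let lam : {measure set M -> \bar R} := density_measure ls ldens_ge0 measurable_ldens.

Let integral_lam f : (forall y, 0 <= f y)%E -> measurable_fun [set: M] f ->
  (\int[lam]_y f y = \int[ls]_Z ((ldens Z)%:E * f Z))%E.
Proof. by move=> f0 mf; rewrite [LHS]integral_density_measure. Qed.

Let mass : R := fine (jump setT).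

Let s (x : M) : R := expR (- mass) * \1_[set y : M | `|\tr y| <= c0] x.

Let s_ge0 x : 0 <= s x.
Proof. by rewrite mulr_ge0 ?expR_ge0// indicE. Qed.

Let measurable_s : measurable_fun [set: M] (EFin \o s).
Proof.
apply/measurable_EFinP; apply: measurable_funM => //; apply: measurable_indic.
rewrite (_ : [set y | _] = (fun y : M => `|\tr y| : T) @^-1` `]-oo, c0]%classic).
  exact: measurable_preimage.
by apply/seteqP; split => y /=; rewrite in_itv.
Qed.

(** Keeping the event of a single jump costs [exp(-mass)]. The jump density translated by
    [half_psd x] lies above [minor_density], because halving keeps the trace at most [c0]. *)
Let minor x A : measurable A -> ((s x)%:E * lam A <= K x A)%E.
Proof.
move=> mA; rewrite /s indicE; have [/set_mem/= xc|_] := boolP (x \in _); last first.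
  by rewrite mulr0 mul0e measure_ge0.
rewrite mulr1; have mAx := measurable_preimage (measurable_addl (half_psd x)) mA.
apply: le_trans (compound_poisson_ge jump mAx).
rewrite lee_wpmul2l ?lee_fin ?expR_ge0//.
pose F (Z : M) : \bar R := ((kappa * increment_density (Z - half_psd x))%:E * (\1_A Z)%:E)%E.
have F0 Z : (0 <= F Z)%E.
  rewrite mule_ge0// lee_fin ?indicE// mulr_ge0 ?(ltW kappa_gt0)// levy_density_ge0//.
  exact: increment_radial_ge0.
have mi : measurable_fun [set: M] (EFin \o (\1_A : M -> T)).
  by apply/measurable_EFinP; exact: measurable_indic.
have minc : measurable_fun [set: M] (increment_density : M -> T).
  by apply: measurable_levy_density; exact: measurable_increment_radial.
have mF : measurable_fun [set: M] F.
  have ms : measurable_fun [set: M] (fun Z : M => Z - half_psd x : M).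
    exact: measurable_mxD.
  apply: emeasurable_funM => //; apply/measurable_EFinP; apply: measurable_funM => //.
  exact: (measurableT_comp minc ms).
have jumpE : (jump ((fun y : M => (half_psd x + y)%R) @^-1` A) = \int[ls]_Z F Z)%E.
  have sh : (half_psd x)^T = half_psd x by have [] := psdmx_half_psd x.
  rewrite -(integral_lebesgue_sym_affine ltr01 sh F0 mF) expr1n mul1e.
  have mB : measurable_fun [set: M]
      (EFin \o (\1_((fun y : M => (half_psd x + y)%R) @^-1` A) : M -> T)).
    by apply/measurable_EFinP; exact: measurable_indic.
  transitivity (\int[jump]_y (\1_((fun y : M => (half_psd x + y)%R) @^-1` A) y)%:E)%E.
    by rewrite integral_indic// setIT.
  rewrite integral_jump//.
  rewrite -ge0_integralZl//; last 3 first.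
  - apply: emeasurable_funM => //; exact/measurable_EFinP.
  - move=> y _; rewrite mule_ge0 ?lee_fin ?indicE// levy_density_ge0//.
    exact: increment_radial_ge0.
  - by rewrite lee_fin ltW.
  apply: eq_integral => y _; rewrite /F scale1r addrK -!EFinM mulrA; congr (_ * _)%:E.
  rewrite !indicE; congr (nat_of_bool _)%:R.
  by apply/idP/idP; rewrite !inE/= addrC.
rewrite [X in (_ <= X)%E]jumpE.
have -> : lam A = (\int[ls]_Z ((ldens Z)%:E * (\1_A Z)%:E))%E.
  rewrite -[LHS]/(lam A) -[X in lam X]setIT -integral_indic// integral_lam//.
apply: ge0_le_integral => //.
- by move=> Z _; rewrite mule_ge0// lee_fin// indicE.
- exact: emeasurable_funM.
move=> Z _; rewrite /F -!EFinM lee_fin ler_wpM2r ?indicE//.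
rewrite ler_wpM2l ?(ltW kappa_gt0)//; apply: minor_density_le => //.
  exact: psdmx_half_psd.
apply: le_trans (ler_norm _) _; apply: le_trans (norm_trace_half _) _.
by apply: le_trans xc; rewrite ler_pdivrMr// ler_peMr// ler1n.
Qed.

Let increment_trace_fin :
  (\int[ls]_X (increment_density X * `|\tr X|)%:E < +oo)%E.
Proof.
under eq_integral do rewrite -(levy_densityM eta increment_radial (fun t => `|t|)).
apply: levy_integral_fin => //.
- by move=> r; rewrite mulr_ge0 ?increment_radial_ge0.
- by apply: measurable_funM; [exact: measurable_increment_radial|exact: normr_measurable].
move=> r r0; rewrite /increment_radial gtr0_norm// mulrC ler_pM2l//.
apply: (@le_trans _ _ (expR (- r))); last first.
  by rewrite ler_expR lerN2 ler_pdivrMr// ler_peMr ?(ltW r0)// ler1n.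
by rewrite ler_piMr ?expR_ge0// gerBl expR_ge0.
Qed.

Let ldens_le Z : ldens Z <= kappa * increment_density Z.
Proof.
rewrite ler_wpM2l ?(ltW kappa_gt0)// -[in leRHS](subr0 Z).
by apply: minor_density_le => //; [exact: psdmx0|rewrite linear0].
Qed.

Let lamT_gt0 : (0 < lam setT)%E.
Proof.
rewrite -[X in (_ < X)%E]mul1e -integral_cst// integral_lam//.
under eq_integral do rewrite /= mule1 EFinM.
rewrite ge0_integralZl//; last 3 first.
- by apply/measurable_EFinP; exact: measurable_minor_density.
- by move=> Z _; rewrite lee_fin minor_density_ge0.
- by rewrite lee_fin ltW.
by rewrite mule_gt0 ?lte_fin// minor_density_integral_gt0.
Qed.

Let lam_trace_fin : (\int[lam]_y (`|\tr y|)%:E < +oo)%E.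
Proof.
rewrite integral_lam//; last exact/measurable_EFinP.
apply: (@le_lt_trans _ _ (kappa%:E *
    \int[ls]_X (increment_density X * `|\tr X|)%:E)%E); last first.
  by apply: lte_mul_pinfty; rewrite ?lee_fin ?(ltW kappa_gt0).
have mit : measurable_fun [set: M] (fun X => (increment_density X * `|\tr X|)%:E).
  apply/measurable_EFinP; apply: measurable_funM => //.
  by apply: measurable_levy_density; exact: measurable_increment_radial.
have it0 X : (0 <= (increment_density X * `|\tr X|)%:E)%E.
  by rewrite lee_fin mulr_ge0 ?levy_density_ge0//; exact: increment_radial_ge0.
rewrite -ge0_integralZl//; last by rewrite lee_fin ltW.
apply: ge0_le_integral => //.
- by move=> Z _; rewrite mule_ge0// lee_fin.
- by apply: emeasurable_funM => //; exact/measurable_EFinP.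
- exact: emeasurable_funM.
by move=> Z _; rewrite -!EFinM lee_fin mulrA ler_wpM2r.
Qed.

Let lamT_fin : lam setT \is a fin_num.
Proof.
rewrite ge0_fin_numE//.
rewrite -[X in (X < _)%E]mul1e -integral_cst// integral_lam//.
apply: (@le_lt_trans _ _ (kappa%:E * \int[ls]_X (increment_density X)%:E)%E); last first.
  apply: lte_mul_pinfty; rewrite ?lee_fin ?(ltW kappa_gt0)//.
  exact: increment_integral_fin.
have mi : measurable_fun [set: M] (fun X => (increment_density X)%:E).
  by apply/measurable_EFinP; apply: measurable_levy_density;
    exact: measurable_increment_radial.
have i0 X : (0 <= (increment_density X)%:E)%E.
  by rewrite lee_fin levy_density_ge0//; exact: increment_radial_ge0.
rewrite -ge0_integralZl//; last by rewrite lee_fin ltW.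
apply: ge0_le_integral => //.
- by move=> Z _; rewrite mule1 lee_fin.
- exact: emeasurable_funM.
- exact: emeasurable_funM.
by move=> Z _; rewrite mule1 -!EFinM lee_fin.
Qed.

(** Chosen so that [exp(-mass) * b * lam setT = mu0 + 1]. As a constant summand of [V] it makes the
    regeneration term pay for the drift where the trace is at most [c0]. *)
Let b : R := (mu0 + 1) / (expR (- mass) * fine (lam setT)).

Let lamT0 : 0 < fine (lam setT).
Proof. by rewrite fine_gt0// lamT_gt0 -ge0_fin_numE. Qed.

Let b_ge0 : 0 <= b.
Proof.
by rewrite divr_ge0 ?addr_ge0// mulr_ge0 ?expR_ge0// ltW.
Qed.

Let V (x : M) : R := `|\tr x| + b.

Let V_ge0 x : 0 <= V x. Proof. by rewrite addr_ge0. Qed.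

Let measurable_V : measurable_fun [set: M] (EFin \o V).
Proof. by apply/measurable_EFinP; apply: measurable_funD. Qed.

Let lamVE : (\int[lam]_x (V x)%:E = \int[lam]_x (`|\tr x|)%:E + (b * fine (lam setT))%:E)%E.
Proof.
rewrite EFinM fineK// -integral_cst// -ge0_integralD//.
exact/measurable_EFinP.
Qed.

Let drift x : (\int[K x]_y (V y)%:E + 1 <=
  (V x)%:E + (s x)%:E * \int[lam]_y (V y)%:E)%E.
Proof.
have half_le : (\int[K x]_y (V y)%:E <= (`|\tr x| / 2 + b + mu0)%:E)%E.
  rewrite integral_K//.
  apply: (@le_trans _ _ (\int[Y]_y (cst (`|\tr x| / 2 + b)%:E y + (`|\tr y|)%:E))%E).
    apply: ge0_le_integral => //.
    - by move=> y _; rewrite lee_fin.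
    - exact: (measurableT_comp measurable_V (measurable_addl (half_psd x))).
    - by apply: emeasurable_funD => //; exact/measurable_EFinP.
    move=> y _; rewrite /= -EFinD lee_fin /V addrAC lerD2r linearD/=.
    by apply: le_trans (ler_normD _ _) _; rewrite lerD2r norm_trace_half.
  rewrite ge0_integralD//; last 2 first.
  - by move=> y _; rewrite lee_fin addr_ge0// divr_ge0.
  - exact/measurable_EFinP.
  rewrite mu0E integral_cst// [X in (_ * X)%E](_ : _ = 1%E) ?mule1//.
  exact: (probability_setT Y).
apply: (le_trans (leeD half_le (lexx _))).
have lt0 : (0 <= \int[lam]_x (`|\tr x|)%:E)%E by apply: integral_ge0 => y _; rewrite lee_fin.
have [xc|xc] := leP `|\tr x| c0; last first.
  rewrite /s indicE memNset; last by apply/negP; rewrite /= -ltNge.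
  rewrite mulr0 mul0e adde0 -EFinD lee_fin /V.
  by move: xc; rewrite /c0; move: `|\tr x| => t; lra.
rewrite /s indicE mem_set// mulr1.
apply: (@le_trans _ _ ((V x)%:E + (expR (- mass))%:E * (b * fine (lam setT))%:E)%E).
  have -> : ((expR (- mass))%:E * (b * fine (lam setT))%:E = (mu0 + 1)%:E)%E.
    rewrite -EFinM /b; congr EFin; have := lamT0; have := expR_gt0 (- mass).
    by move: (fine _) (expR _) => l e e0 l0; field; rewrite !gt_eqF.
  rewrite -!EFinD lee_fin /V.
  by have : 0 <= `|\tr x| by []; move: `|\tr x| => t; lra.
by rewrite leeD2l// lee_wpmul2l ?lee_fin ?expR_ge0// lamVE leeDr.
Qed.

Lemma exists_stationary_law : exists P : probability M R,
  forall A, measurable A -> P A = (\int[P]_x Y [set y | A (half_psd x + y)%R])%E.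
Proof.
apply: (exists_stationary_probability mK K1 s_ge0 V_ge0 measurable_s measurable_V
  lamT_gt0 _ minor drift).
by rewrite lamVE; apply: lte_add_pinfty; rewrite ?ltry.
Qed.

End stationary_law.

(** * Laplace transform and support of the stationary law *)

Section gamma_law.
Context {R : realType} (d : nat) (eta : R).
Hypotheses (d_gt0 : (0 < d)%N) (heta : (d%:R - 1) / 2 < eta).
Notation M := 'M[R]_d.
Let T := measurableTypeR R.
Notation ls := (@lebesgue_sym R d).

Let Theta_sum (Theta : M) : R := \sum_i \sum_j `|Theta i j|.

Lemma gamma_exponent_fin (Theta : M) : psdmx d Theta ->
  laplace_exponent eta gamma_radial Theta \is a fin_num.
Proof.
move=> pT; rewrite ge0_fin_numE; last first.
  by apply: laplace_exponent_ge0 => //; exact: gamma_radial_ge0.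
apply: le_lt_trans (gamma_exponent_le eta pT) _.
apply: lte_mul_pinfty => //; last exact: gamma_trace_fin.
by rewrite lee_fin; do 2 apply: sumr_ge0 => ? _.
Qed.

Lemma increment_exponent_fin (Theta : M) : psdmx d Theta ->
  laplace_exponent eta increment_radial Theta \is a fin_num.
Proof.
move=> pT; rewrite ge0_fin_numE; last first.
  by apply: laplace_exponent_ge0 => //; exact: increment_radial_ge0.
apply: le_lt_trans (increment_exponent_le eta pT) _.
exact: increment_integral_fin.
Qed.

(** The product [u n * exp(h n)] does not depend on [n] and tends to 1. *)
Let halving_limit (u h D : nat -> R) :
  (forall n, u n = u n.+1 * expR (- D n)) -> (forall n, h n = h n.+1 + D n) ->
  u @ \oo --> (1 : R) -> h @ \oo --> (0 : R) -> u 0%N = expR (- h 0%N).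
Proof.
move=> uE hE u1 h0.
have inv n : u n * expR (h n) = u 0%N * expR (h 0%N).
  elim: n => [//|n <-]; rewrite (uE n) (hE n) expRD -!mulrA; congr (_ * _).
  by rewrite mulrCA -expRD addNr expR0 mulr1.
have lim1 : (fun n => u n * expR (h n)) @ \oo --> (1 : R).
  rewrite -[X in _ --> X](mulr1 1); apply: cvgM; first exact: u1.
  by rewrite -expR0; apply: continuous_cvg => //; exact: continuous_expR.
have lim2 : (fun n => u n * expR (h n)) @ \oo --> u 0%N * expR (h 0%N).
  by rewrite (funext inv); exact: cvg_cst.
have /(canRL (mulfK _)) : u 0%N * expR (h 0%N) = 1 by exact: (cvg_unique _ lim2 lim1).
by move=> ->; rewrite ?mul1r ?expRN// gt_eqF// expR_gt0.
Qed.

Let H (Theta : M) : R := fine (laplace_exponent eta gamma_radial Theta).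

Let Hhalf Theta : psdmx d Theta ->
  H Theta = H (2^-1 *: Theta) + fine (laplace_exponent eta increment_radial Theta).
Proof.
move=> pT; have pT2 : psdmx d (2^-1 *: Theta) by exact: psdmxZ.
by rewrite /H gamma_exponent_half// fineD ?gamma_exponent_fin ?increment_exponent_fin.
Qed.

Let dyadic n (Theta : M) : M := 2^-1 ^+ n *: Theta.

Let dyadic0 Theta : dyadic 0 Theta = Theta.
Proof. by rewrite /dyadic expr0 scale1r. Qed.

Let dyadicS n Theta : dyadic n.+1 Theta = 2^-1 *: dyadic n Theta.
Proof. by rewrite /dyadic exprS scalerA. Qed.

Let psdmx_dyadic n Theta : psdmx d Theta -> psdmx d (dyadic n Theta).
Proof. by apply: psdmxZ; rewrite exprn_ge0. Qed.

Let dyadic_cvg0 : (fun n => 2^-1 ^+ n : R) @ \oo --> (0 : R).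
Proof. by apply: cvg_expr; rewrite gtr0_norm ?invf_lt1 ?ltr1n. Qed.

(** The bound [gamma_exponent_le] is linear in the absolute values of the entries of [Theta], which
    are multiplied by [2^-n]. *)
Let H_cvg0 Theta : psdmx d Theta -> (fun n => H (dyadic n Theta)) @ \oo --> (0 : R).
Proof.
move=> pT; pose C : R := Theta_sum Theta *
  fine (\int[ls]_X (levy_density eta gamma_radial X * `|\tr X|)%:E)%E.
have gt := gamma_trace_fin d_gt0 heta.
have Hle n : 0 <= H (dyadic n Theta) <= 2^-1 ^+ n * C.
  have pn := psdmx_dyadic n pT; apply/andP; split.
    by apply: fine_ge0; apply: laplace_exponent_ge0 => //; exact: gamma_radial_ge0.
  rewrite -lee_fin /H fineK ?gamma_exponent_fin//.
  apply: le_trans (gamma_exponent_le eta pn) _.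
  rewrite /C mulrA !EFinM fineK; last first.
    rewrite ge0_fin_numE//; apply: integral_ge0 => X _.
    by rewrite lee_fin mulr_ge0 ?levy_density_ge0//; exact: gamma_radial_ge0.
  rewrite -EFinM lee_wpmul2r//.
    apply: integral_ge0 => X _.
    by rewrite lee_fin mulr_ge0 ?levy_density_ge0//; exact: gamma_radial_ge0.
  rewrite lee_fin /Theta_sum mulr_sumr; apply: ler_sum => i _.
  rewrite mulr_sumr; apply: ler_sum => j _.
  by rewrite mxE normrM ger0_norm ?exprn_ge0.
apply: (@squeeze_cvgr _ _ _ _ (cst 0) (fun n => 2^-1 ^+ n * C)).
- by near=> n; exact: Hle.
- exact: cvg_cst.
- by rewrite -[X in _ --> X](mul0r C); apply: cvgMl; exact: dyadic_cvg0.
Unshelve. all: by end_near. Qed.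

Section law.
Variable kappa : R.
Hypothesis kappa_gt0 : 0 < kappa.
Notation jump := (jump_measure kappa_gt0 d_gt0 heta).
Notation Y := (jump_sum d_gt0 heta kappa_gt0).
Variable P : probability M R.
Hypothesis stationaryP : forall A, measurable A ->
  P A = (\int[P]_x Y [set y | A (half_psd x + y)%R])%E.

Let K (x : M) : {measure set M -> \bar R} :=
  image_measure Y (measurable_addl (half_psd x)).

Let mK U : measurable U -> measurable_fun [set: M] (fun x => K x U).
Proof.
move=> mU; have := measurable_shift_measure Y mU => mS.
exact: (measurableT_comp mS (@measurable_half_psd R d)).
Qed.

Let integral_stationary f : (forall y, 0 <= f y)%E -> measurable_fun [set: M] f ->
  (\int[P]_x f x = \int[P]_x \int[Y]_y f (half_psd x + y)%R)%E.
Proof.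
move=> f0 mf; transitivity (\int[mixture P mK]_x f x)%E.
  by apply: eq_measure_integral => A mA _; exact: stationaryP.
rewrite (integral_mixture P mK f0 mf); apply: eq_integral => x _.
exact: integral_image_measure.
Qed.

Let mnpsd : measurable (~` psdmx d : set M).
Proof. by apply: measurableC; exact: measurable_psdmx. Qed.

Let mnpd : measurable (~` pdmx d : set M).
Proof. by apply: measurableC; exact: measurable_pdmx. Qed.

Lemma stationary_psdmx : P (~` psdmx d) = 0%E.
Proof.
rewrite stationaryP//; apply: integral0_eq => x _; apply/eqP.
rewrite eq_le measure_ge0 andbT -(jump_sum_psdmx d_gt0 heta kappa_gt0).
apply: le_measure; rewrite ?inE//.
  exact: (measurable_preimage (measurable_addl (half_psd x)) mnpsd).
by move=> y /= ny py; apply: ny; apply: psdmxD => //; exact: psdmx_half_psd.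
Qed.

Let jump_gt0 : (0 < jump setT)%E.
Proof.
rewrite -[X in (_ < X)%E]mul1e -integral_cst// integral_jump//.
under eq_integral do rewrite /= mule1.
apply: mule_gt0; rewrite ?lte_fin//.
apply: lt_le_trans (minor_density_integral_gt0 d_gt0 heta (lexx 0)) _.
apply: ge0_le_integral => //.
- by move=> X _; rewrite lee_fin minor_density_ge0.
- by apply/measurable_EFinP; exact: measurable_minor_density.
- by apply/measurable_EFinP; apply: measurable_levy_density;
    exact: measurable_increment_radial.
move=> X _; rewrite lee_fin -[in leRHS](subr0 X).
by apply: minor_density_le => //; [exact: psdmx0|rewrite linear0].
Qed.

(** A single jump has positive probability, and the jump measure is carried by the open cone. *)
Let jump_sum_npd : (Y (~` pdmx d) < 1)%E.
Proof.
have mpd : measurable (pdmx d : set M) by exact: measurable_pdmx.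
have jpd : jump (pdmx d) = jump setT.
  rewrite -(setUv (pdmx d)) measureU//; last by rewrite setICr.
  by rewrite -[X in (_ + X)%E]/(jump _) jump_pdmx adde0.
have Yf : Y (pdmx d) \is a fin_num by exact: fin_num_measure.
have Y0 : (0 < Y (pdmx d))%E.
  apply: lt_le_trans (compound_poisson_ge jump mpd).
  by apply: mule_gt0; rewrite ?lte_fin ?expR_gt0// [X in (_ < X)%E]jpd.
rewrite (probability_setC Y mpd) -(fineK Yf) -EFinB lte_fin gtrBl.
by rewrite -lte_fin fineK.
Qed.

(* From the cone one step of the chain enters the interior with a fixed
   positive probability and never leaves it. *)
Lemma stationary_pdmx : P (~` pdmx d) = 0%E.
Proof.
set q := Y (~` pdmx d).
have KT x : (K x (~` pdmx d) <= q * (\1_(~` pdmx d) x)%:E)%E.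
  rewrite indicE; have [pd|npd] := pselect (pdmx d x).
    rewrite memNset ?mule0//.
    rewrite -(jump_sum_psdmx d_gt0 heta kappa_gt0).
    rewrite -[X in (X <= _)%E]/(Y ((fun y : M => (half_psd x + y)%R) @^-1` (~` pdmx d))).
    apply: (le_measure Y); rewrite ?inE//.
      exact: (measurable_preimage (measurable_addl (half_psd x)) mnpd).
    move=> y /= ny py; apply: ny; rewrite addrC; apply: pdmxD => //.
    by rewrite half_psdE; [exact: pdmxZ|exact: pdmx_psdmx].
  rewrite mem_set// mule1.
  rewrite -[X in (X <= _)%E]/(Y ((fun y : M => (half_psd x + y)%R) @^-1` (~` pdmx d))).
  apply: (le_measure Y); rewrite ?inE//.
    exact: (measurable_preimage (measurable_addl (half_psd x)) mnpd).
  by move=> y /= ny py; apply: ny; apply: pdmxD => //; exact: psdmx_half_psd.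
have Pf : P (~` pdmx d) \is a fin_num by exact: fin_num_measure.
have qf : q \is a fin_num by exact: fin_num_measure.
have le : (P (~` pdmx d) <= q * P (~` pdmx d))%E.
  rewrite {1}stationaryP//.
  apply: (@le_trans _ _ (\int[P]_x (q * (\1_(~` pdmx d) x)%:E))%E).
    apply: ge0_le_integral => //; first exact: mK.
    by apply: emeasurable_funM => //; apply/measurable_EFinP; exact: measurable_indic.
    by move=> x _; exact: KT.
  rewrite ge0_integralZl//; last 2 first.
  - by apply/measurable_EFinP; exact: measurable_indic.
  - exact: measure_ge0.
  by rewrite integral_indic// setIT.
have v1 : fine q < 1 by rewrite -lte_fin (fineK qf).
have u0 : 0 <= fine (P (~` pdmx d)) by rewrite fine_ge0.
have uv : fine (P (~` pdmx d)) <= fine q * fine (P (~` pdmx d)).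
  by rewrite -lee_fin EFinM (fineK qf) (fineK Pf).
rewrite -(fineK Pf); congr EFin; apply/eqP; rewrite eq_le u0 andbT.
move: v1 u0 uv; move: (fine q) (fine (P _)) => v u v1 u0 uv.
rewrite -(pmulr_rle0 u (_ : 0 < 1 - v)) ?subr_gt0//.
by rewrite mulrBl mul1r subr_le0.
Qed.

Let phi Theta : R := fine (\int[P]_x (expfun Theta x)%:E).

Let phiE Theta : psdmx d Theta -> (\int[P]_x (expfun Theta x)%:E = (phi Theta)%:E)%E.
Proof.
move=> pT; rewrite fineK// ge0_fin_numE; last first.
  by apply: integral_ge0 => x _; rewrite lee_fin expfun_ge0.
have mE : measurable_fun [set: M] (fun x => (expfun Theta x)%:E).
  by apply/measurable_EFinP; exact: measurable_expfun.
rewrite (ge0_negligible_integral mnpsd measurableT mE _ stationary_psdmx); last first.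
  by move=> x _; rewrite lee_fin expfun_ge0.
rewrite setTD setCK.
apply: (@le_lt_trans _ _ (\int[P]_(x in psdmx d) cst 1%:E x)%E).
  apply: ge0_le_integral => //.
  - exact: measurable_psdmx.
  - by move=> x _; rewrite lee_fin expfun_ge0.
  - exact: measurable_funTS.
  by move=> x px; rewrite lee_fin expfun_le1.
rewrite integral_cst; last exact: measurable_psdmx.
rewrite mul1e; apply: (@le_lt_trans _ _ 1%E); last exact: ltry.
by apply: probability_le1; exact: measurable_psdmx.
Qed.

(** One step of stationarity: [expfun] is multiplicative, so the halved state and the jump
    contribute separate factors. *)
Let phi_half Theta : psdmx d Theta -> phi Theta = phi (2^-1 *: Theta) *
  expR (- (kappa * fine (laplace_exponent eta increment_radial Theta))).
Proof.
move=> pT; have pT2 : psdmx d (2^-1 *: Theta) by exact: psdmxZ.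
set e := expR _.
suff E : (\int[P]_x (expfun Theta x)%:E =
    \int[P]_x (expfun (2^-1 *: Theta) x)%:E * e%:E)%E.
  by move: E; rewrite (phiE pT) (phiE pT2) => -[].
have mE Psi : measurable_fun [set: M] (fun x => (expfun Psi x)%:E).
  by apply/measurable_EFinP; exact: measurable_expfun.
have e0 Psi (x : M) : (0 <= (expfun Psi x)%:E :> \bar R)%E by rewrite lee_fin expfun_ge0.
transitivity (\int[P]_x ((expfun Theta (half_psd x))%:E * e%:E))%E.
  rewrite (integral_stationary (e0 Theta) (mE Theta)); apply: eq_integral => x _.
  rewrite -(laplace_jump_sum d_gt0 heta kappa_gt0 pT) -ge0_integralZl//.
  by apply: eq_integral => y _; rewrite expfunDr EFinM.
have e_ge0 : (0 <= e%:E)%E by rewrite lee_fin expR_ge0.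
have mEh : measurable_fun [set: M] (fun x => (expfun Theta (half_psd x))%:E).
  exact: (measurableT_comp (mE Theta) (@measurable_half_psd R d)).
clearbody e.
rewrite (ge0_integralZr P measurableT mEh (fun x _ => e0 Theta (half_psd x)) e_ge0).
suff -> : (\int[P]_x (expfun Theta (half_psd x))%:E =
    \int[P]_x (expfun (2^-1 *: Theta) x)%:E)%E by [].
rewrite (ge0_negligible_integral mnpsd measurableT mEh
  (fun x _ => e0 Theta (half_psd x)) stationary_psdmx).
rewrite [RHS](ge0_negligible_integral mnpsd measurableT (mE (2^-1 *: Theta))
  (fun x _ => e0 (2^-1 *: Theta) x) stationary_psdmx).
rewrite setTD setCK; apply: eq_integral => x /set_mem px.
by rewrite half_psdE// /expfun -scalemxAr -scalemxAl.
Qed.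

Let phi_cvg1 Theta : psdmx d Theta -> (fun n => phi (dyadic n Theta)) @ \oo --> (1 : R).
Proof.
move=> pT.
have mE Psi : measurable_fun [set: M] (fun x => (expfun Psi x)%:E).
  by apply/measurable_EFinP; exact: measurable_expfun.
have mp : measurable (psdmx d : set M) by exact: measurable_psdmx.
have phipsd n : (\int[P]_(x in psdmx d) (expfun (dyadic n Theta) x)%:E =
    (phi (dyadic n Theta))%:E)%E.
  rewrite -phiE; last exact: psdmx_dyadic.
  rewrite [RHS](ge0_negligible_integral mnpsd measurableT _ _ stationary_psdmx)//.
    by rewrite setTD setCK.
  by move=> x _; rewrite lee_fin expfun_ge0.
have P1 : P (psdmx d) = 1%E.
  have Pf : P (psdmx d) \is a fin_num by exact: fin_num_measure.
  have := probability_setC P mp; rewrite stationary_psdmx -(fineK Pf) -EFinB.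
  by move=> -[/esym/eqP]; rewrite subr_eq0 => /eqP <-.
have := @dominated_convergence _ _ _ P (psdmx d) mp
  (fun n x => (expfun (dyadic n Theta) x)%:E) (cst 1%E) (cst 1%E).
case.
- by move=> n; apply: measurable_funTS; exact: mE.
- exact: measurable_cst.
- apply: aeW => x _; rewrite /=; apply/fine_cvgP; split; first by near=> n.
  rewrite -expR0 -oppr0; apply: continuous_cvg; first exact: continuous_expR.
  apply: cvgN.
  rewrite (_ : (fun n => \tr (dyadic n Theta *m x)) =
    (fun n => 2^-1 ^+ n * \tr (Theta *m x))).
    by rewrite -[X in _ --> X](mul0r (\tr (Theta *m x))); apply: cvgMl; exact: dyadic_cvg0.
  by apply/funext => n; rewrite -scalemxAl linearZ.
- apply/integrableP; split; first exact: measurable_cst.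
  under eq_integral do rewrite /= normr1.
  by rewrite integral_cst// mul1e; apply: (@le_lt_trans _ _ 1%E);
    [exact: probability_le1|exact: ltry].
- apply: aeW => x n px; rewrite /= lee_fin ger0_norm ?expfun_ge0// expfun_le1//.
  exact: psdmx_dyadic.
move=> _ _; rewrite integral_cst// mul1e.
rewrite [X in (_ --> X)%E -> _]P1 => /fine_cvgP[_].
apply: cvg_trans; apply: near_eq_cvg; near=> n.
by rewrite /= phipsd.
Unshelve. all: by end_near. Qed.

Lemma laplace_stationary Theta : psdmx d Theta ->
  (\int[P]_x (expfun Theta x)%:E = (expR (- (kappa * H Theta)))%:E)%E.
Proof.
move=> pT; rewrite (phiE pT); congr EFin.
rewrite -[in LHS](dyadic0 Theta) -[in RHS](dyadic0 Theta).
pose D n := kappa * fine (laplace_exponent eta increment_radial (dyadic n Theta)).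
apply: (@halving_limit (fun n => phi (dyadic n Theta))
  (fun n => kappa * H (dyadic n Theta)) D).
- by move=> n; rewrite (phi_half (psdmx_dyadic n pT)) -dyadicS.
- by move=> n; rewrite (Hhalf (psdmx_dyadic n pT)) -dyadicS mulrDr.
- exact: phi_cvg1.
- by rewrite -(mulr0 kappa); apply: cvgMr; exact: H_cvg0.
Qed.

End law.

Lemma exists_gamma_law kappa : 0 < kappa -> exists P : probability M R,
  [/\ P (~` pdmx d) = 0%E, P (~` psdmx d) = 0%E &
    forall Theta, psdmx d Theta -> laplace P Theta =
      (expR (- (kappa * fine (laplace_exponent eta gamma_radial Theta))))%:E].
Proof.
move=> k0; have [P PS] := exists_stationary_law d_gt0 heta k0.
exists P; split; [exact: stationary_pdmx PS|exact: stationary_psdmx PS|].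
by move=> Theta pT; exact: (laplace_stationary PS pT).
Qed.

End gamma_law.

(** * The angular measure, the Levy measure and the Gamma law *)

Section matrix_gamma_law.
Context {R : realType} (d : nat) (eta omega : R).
Hypotheses (d_gt0 : (0 < d)%N) (heta : (d%:R - 1) / 2 < eta) (homega : 0 < omega).
Notation M := 'M[R]_d.
Let T := measurableTypeR R.
Notation leb := (@lebesgue_measure R).
Notation ls := (@lebesgue_sym R d).
Notation S := (@trsphere R d).
Notation sph := (@sphere_measure R d).
Notation gamma_density := (@levy_density R d eta gamma_radial).

Let c : R := c_const d eta omega.

Let c_gt0 : 0 < c. Proof. exact: c_const_gt0. Qed.

Let c_ge0 : 0 <= c. Proof. exact: ltW. Qed.

Let mS : measurable S. Proof. exact: measurable_trsphere. Qed.

(** The angular weight as a quotient of powers; it coincides with [sphere_density] on the positive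
    definite part of the sphere, which carries [sph]. *)
Let w (U : M) : R := \det U `^ eta / \det U `^ (d.+1%:R / 2).

Let w_ge0 U : 0 <= w U.
Proof. by rewrite divr_ge0 ?powR_ge0. Qed.

Let measurable_w : measurable_fun [set: M] (w : M -> T).
Proof.
have md : measurable_fun [set: M] (fun X => \det X : T) by exact: measurable_det.
rewrite /w; under eq_fun do rewrite -powRN.
by apply: measurable_funM; exact: measurable_fun_powR.
Qed.

Let w_sphere U : S U -> pdmx d U -> w U = sphere_density eta U.
Proof.
move=> SU pU; rewrite /w /sphere_density indicE mem_set// mul1r.
by have D0 := det_pdmx_gt0 pU; rewrite powRD ?(gt_eqF D0) ?implybT// powRN.
Qed.

Let ag (U : M) : R := \1_S U * (c * w U).

Let ag_ge0 U : 0 <= ag U.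
Proof. by apply: mulr_ge0; [rewrite indicE|exact: mulr_ge0]. Qed.

Let measurable_ag : measurable_fun [set: M] (EFin \o ag).
Proof.
apply/measurable_EFinP; apply: measurable_funM; first exact: measurable_indic.
exact: measurable_funM.
Qed.

Definition angular_measure of (0 < d)%N & (d%:R - 1) / 2 < eta & 0 < omega :
    set M -> \bar R :=
  density_measure sph ag_ge0 measurable_ag.

Notation alpha := (angular_measure d_gt0 heta homega).

HB.instance Definition _ := Measure.copy alpha
  (density_measure sph ag_ge0 measurable_ag).

Let sphere_integral (f : M -> \bar R) : (forall U, 0 <= f U)%E ->
  measurable_fun [set: M] f ->
  (\int[sph]_(U in S) (f U * (w U)%:E) =
   \int[sph]_U ((sphere_density eta U)%:E * f U))%E.
Proof.
move=> f0 mf; rewrite integral_mkcond.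
have mfw : measurable_fun [set: M] (fun U => f U * (w U)%:E)%E.
  by apply: emeasurable_funM => //; exact/measurable_EFinP.
apply: (polar_ae_eq (polar_sphere_measure d_gt0)).
- by move=> U; apply: erestrict_ge0 => V _; rewrite mule_ge0// lee_fin.
- by move=> U; rewrite mule_ge0// lee_fin sphere_density_ge0.
- exact: ((measurable_restrictT _ mS).1 (measurable_funTS mfw)).
- apply: emeasurable_funM => //; apply/measurable_EFinP.
  exact: measurable_sphere_density.
by move=> U SU pU; rewrite patchE mem_set// w_sphere// muleC.
Qed.

Lemma integral_angular_measure (f : M -> \bar R) : (forall U, 0 <= f U)%E ->
  measurable_fun [set: M] f ->
  (\int[alpha]_(U in S) f U = c%:E * \int[sph]_U ((sphere_density eta U)%:E * f U))%E.
Proof.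
move=> f0 mf; rewrite -sphere_integral// -ge0_integralZl//; last 2 first.
- by apply: measurable_funTS; apply: emeasurable_funM => //; exact/measurable_EFinP.
- by move=> U _; rewrite mule_ge0// lee_fin.
rewrite [LHS]integral_mkcond [LHS]integral_density_measure; last 2 first.
- by move=> U; apply: erestrict_ge0.
- exact: ((measurable_restrictT _ mS).1 (measurable_funTS mf)).
rewrite [RHS]integral_mkcond; apply: eq_integral => U _.
rewrite !patchE /ag indicE; case: ifPn => _; last by rewrite mule0.
by rewrite mul1r EFinM muleAC muleA.
Qed.

Let angular_measureE A : measurable A -> (alpha A = \int[sph]_(U in A `&` S)
  (c * (\det U `^ eta / \det U `^ (d.+1%:R / 2)))%:E)%E.
Proof.
move=> mA; rewrite [LHS]density_measureE// integral_mkcondr; apply: eq_integral => U _.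
by rewrite patchE /ag indicE; case: ifP => _; rewrite ?mul1r ?mul0r.
Qed.

Lemma angular_measure_sphere : alpha S = omega%:E.
Proof.
rewrite -[LHS]mul1e -integral_cst// (integral_angular_measure (f := cst 1%E))//.
under eq_integral do rewrite /= mule1.
rewrite -/(sphere_mass d eta) -(fineK (sphere_mass_fin_num d_gt0 heta)) -EFinM.
by rewrite c_const_mass.
Qed.

Lemma angular_measure_off_sphere : alpha (~` S) = 0%E.
Proof.
rewrite [LHS]density_measureE; last exact: measurableC.
by apply: integral0_eq => U nS; rewrite /ag indicE memNset// mul0r.
Qed.

Let alpha_fin : fin_num_fun alpha.
Proof.
apply: lty_fin_num_fun; rewrite -(setUv S) measureU//; last 2 first.
- exact: measurableC.
- by rewrite setICr.
rewrite [X in (X + _)%E](_ : _ = omega%:E); last exact: angular_measure_sphere.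
rewrite [X in (_ + X)%E](_ : _ = 0%E); last exact: angular_measure_off_sphere.
by rewrite adde0 ltry.
Qed.

HB.instance Definition _ := Measure_isFinite.Build _ _ _ alpha alpha_fin.

Let rdens (X : M) : R := c * gamma_density X.

Let rdens_ge0 X : 0 <= rdens X.
Proof. by rewrite mulr_ge0// levy_density_ge0//; exact: gamma_radial_ge0. Qed.

Let measurable_gd : measurable_fun [set: M] (gamma_density : M -> T).
Proof. by apply: measurable_levy_density; exact: measurable_gamma_radial. Qed.

Let measurable_rdens : measurable_fun [set: M] (EFin \o rdens).
Proof. by apply/measurable_EFinP; exact: measurable_funM. Qed.

Let rho : {measure set M -> \bar R} := density_measure ls rdens_ge0 measurable_rdens.

Let gd_ge0 X : 0 <= gamma_density X.
Proof. by apply: levy_density_ge0; exact: gamma_radial_ge0. Qed.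

Let integral_rho f : (forall X, 0 <= f X)%E -> measurable_fun [set: M] f ->
  (\int[rho]_X f X = c%:E * \int[ls]_X ((gamma_density X)%:E * f X))%E.
Proof.
move=> f0 mf; rewrite [LHS]integral_density_measure// -ge0_integralZl//; last 2 first.
- by apply: emeasurable_funM => //; exact/measurable_EFinP.
- by move=> X _; rewrite mule_ge0// lee_fin.
by apply: eq_integral => X _; rewrite EFinM muleA.
Qed.

Let measurable_rays (f : M -> \bar R) : (forall X, 0 <= f X)%E ->
  measurable_fun [set: M] f ->
  measurable_fun [set: M] (fun U =>
    \int[leb]_(r in `]0%R, +oo[) ((gamma_radial r / r)%:E * f (r *: U)))%E.
Proof.
move=> f0 mf; pose k (r : R) : R := \1_(`]0%R, +oo[%classic) r * (gamma_radial r * r `^ (- 1)).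
have mk : measurable_fun [set: T] (k : T -> T).
  apply: measurable_funM; first exact: measurable_indic.
  by apply: measurable_funM; [exact: measurable_gamma_radial|exact: (@measurable_powR R (- 1))].
have k0 r : 0 <= k r by rewrite /k indicE !mulr_ge0 ?powR_ge0 ?gamma_radial_ge0.
have kE U : (\int[leb]_(r in `]0%R, +oo[) ((gamma_radial r / r)%:E * f (r *: U)) =
    \int[leb]_r ((k r)%:E * f (r *: U)))%E.
  rewrite integral_mkcond; apply: eq_integral => r _; rewrite patchE /k indicE.
  have [/set_mem|_] := boolP (r \in _); last by rewrite mul0r mul0e.
  by rewrite /= in_itv/= andbT => r0; rewrite mul1r powRN powRr1 ?ltW.
under eq_fun do rewrite kE.
apply: (measurable_fun_integral (m2 := leb) (fun (U : M) (r : T) => (k r)%:E * f (r *: U))%E).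
  by move=> U r; rewrite mule_ge0// lee_fin.
have mscale : measurable_fun [set: M * T] (fun p : M * T => p.2 *: p.1).
  exact: measurable_mxZ.
apply: emeasurable_funM; last exact: (measurableT_comp mf mscale).
by apply/measurable_EFinP; exact: (measurableT_comp mk).
Qed.

Let integral_rho_polar f : (forall X, 0 <= f X)%E -> measurable_fun [set: M] f ->
  (\int[rho]_X f X = c%:E * \int[sph]_U ((sphere_density eta U)%:E *
    \int[leb]_(r in `]0%R, +oo[) ((gamma_radial r / r)%:E * f (r *: U))))%E.
Proof.
move=> f0 mf; rewrite integral_rho//; congr (_ * _)%E.
apply: polar_density => //; [exact: gamma_radial_ge0|exact: measurable_gamma_radial].
Qed.

Let rays_ge0 (f : M -> \bar R) (U : M) : (forall X, 0 <= f X)%E ->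
  (0 <= \int[leb]_(r in `]0%R, +oo[) ((gamma_radial r / r)%:E * f (r *: U)))%E.
Proof.
move=> f0; apply: integral_ge0 => r; rewrite /= in_itv/= andbT => r0.
by rewrite mule_ge0// lee_fin divr_ge0 ?gamma_radial_ge0// ltW.
Qed.

Let integral_rho_angular f : (forall X, 0 <= f X)%E -> measurable_fun [set: M] f ->
  (\int[rho]_X f X = \int[alpha]_(U in S)
    \int[leb]_(r in `]0%R, +oo[) ((gamma_radial r / r)%:E * f (r *: U)))%E.
Proof.
move=> f0 mf; rewrite integral_rho_polar// integral_angular_measure//.
- by move=> U; exact: rays_ge0.
- exact: measurable_rays.
Qed.

Let rhoE E : measurable E -> (rho E = \int[rho]_X (\1_E X)%:E)%E.
Proof. by move=> mE; rewrite integral_indic// setIT. Qed.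

Let indic_ge0 (E : set M) X : (0 <= (\1_E X)%:E :> \bar R)%E.
Proof. by rewrite lee_fin indicE. Qed.

Let measurable_indicE (E : set M) : measurable E ->
  measurable_fun [set: M] (fun X => (\1_E X)%:E : \bar R).
Proof. by move=> mE; apply/measurable_EFinP; exact: measurable_indic. Qed.

Let rho_gamma_levy E : measurable E -> rho E = gamma_levy alpha (cst 1) E.
Proof.
move=> mE; rewrite (rhoE mE).
rewrite (integral_rho_angular (indic_ge0 E) (measurable_indicE mE)).
apply: eq_integral => U _; apply: eq_integral => r _.
by rewrite -EFinM mulrC /= mul1r.
Qed.

Let rho_polar E : measurable E -> (rho E = c%:E *
  \int[sph]_(U in S) ((\int[leb]_(r in `]0%R, +oo[)
    (\1_E (r *: U) * (expR (- r) / r))%:E) *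
    (\det U `^ eta / \det U `^ (d.+1%:R / 2))%:E))%E.
Proof.
move=> mE; have mi := measurable_indicE mE.
rewrite (rhoE mE) (integral_rho_polar (indic_ge0 E) mi); congr (_ * _)%E.
rewrite -(sphere_integral (fun U => rays_ge0 U (indic_ge0 E))
  (measurable_rays (indic_ge0 E) mi)).
apply: eq_integral => U _; congr (_ * _)%E; apply: eq_integral => r _.
by rewrite -EFinM mulrC.
Qed.

Let rho_density E : measurable E ->
  (rho E = \int[ls]_(X in E `&` pdmx d) (g_density eta omega X)%:E)%E.
Proof.
move=> mE; rewrite [LHS]density_measureE// integral_mkcondr; apply: eq_integral => X _.
rewrite patchE /rdens /levy_density indicE /g_density -/c; case: ifP => _.
  by rewrite mul1r mulrA.
by rewrite mul0r mulr0.
Qed.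

Let rho_pdmx : rho (~` pdmx d) = 0%E.
Proof.
rewrite rho_density; last by apply: measurableC; exact: measurable_pdmx.
by rewrite setICl integral_set0.
Qed.

Let rho_null E : measurable E -> E `<=` ~` pdmx d -> rho E = 0%E.
Proof.
move=> mE Epd; apply/eqP; rewrite eq_le measure_ge0 andbT -rho_pdmx.
apply: le_measure; rewrite ?inE//.
by apply: measurableC; exact: measurable_pdmx.
Qed.

Let rho_psdmx : rho (~` psdmx d) = 0%E.
Proof.
apply: rho_null; first by apply: measurableC; exact: measurable_psdmx.
exact: subsetC (@pdmx_psdmx R d).
Qed.

Let rho0 : rho [set 0] = 0%E.
Proof.
apply: rho_null; last by move=> X -> /(trace_pd_gt0 d_gt0); rewrite linear0 ltxx.
(* Describing 0 as the nonnegative definite matrix of trace 0, by [psdmx_entry_le], gives the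
   measurability of the singleton. *)
rewrite (_ : [set 0] = psdmx d `&` ((fun X : M => \tr X : T) @^-1` [set 0%R])).
  apply: measurableI; first exact: measurable_psdmx.
  by apply: measurable_preimage => //; exact: measurable_mxtrace.
apply/seteqP; split=> [X ->|X [pX tX]]; first by split; [exact: psdmx0|exact: linear0].
apply/matrixP => i j; rewrite mxE; apply/eqP; rewrite -normr_le0.
by rewrite -tX; exact: psdmx_entry_le.
Qed.

Let rho_min_fin : (\int[rho]_(X in psdmx d) (Num.min 1 (\tr X))%:E < +oo)%E.
Proof.
have mt : measurable_fun [set: M] (fun X => \tr X : T) by exact: measurable_mxtrace.
have mnt : measurable_fun [set: M] (fun X => (`|\tr X|)%:E).
  by apply/measurable_EFinP; exact: measurableT_comp.
apply: (@le_lt_trans _ _ (\int[rho]_(X in psdmx d) (`|\tr X|)%:E)%E).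
  apply: ge0_le_integral.
  - exact: measurable_psdmx.
  - by move=> X pX; rewrite lee_fin le_min ler01 mxtrace_psdmx_ge0.
  - by apply: measurable_funTS; apply/measurable_EFinP; exact: measurable_minr.
  - exact: measurable_funTS.
  - by move=> X _; rewrite lee_fin ge_min ler_norm orbT.
apply: (@le_lt_trans _ _ (\int[rho]_X (`|\tr X|)%:E)%E).
  by apply: ge0_subset_integral => //; exact: measurable_psdmx.
rewrite integral_rho//; apply: lte_mul_pinfty; rewrite ?lee_fin//.
by have := gamma_trace_fin d_gt0 heta; under eq_integral do rewrite EFinM.
Qed.

Section laplace_exponents.
Variable Theta : M.
Hypothesis pTheta : psdmx d Theta.

Let f (X : M) : \bar R := ((fun X => (1 - expfun Theta X)%:E) \_ (psdmx d)) X.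

(** Restricted to the cone, where the integrand is nonnegative, since the formulas for [rho] take
    functions that are nonnegative everywhere. *)
Let f_ge0 X : (0 <= f X)%E.
Proof.
by apply: erestrict_ge0 => Z pZ; rewrite lee_fin subr_ge0 expfun_le1.
Qed.

Let measurable_f : measurable_fun [set: M] f.
Proof.
have mp : measurable (psdmx d : set M) by exact: measurable_psdmx.
have me : measurable_fun [set: M] (fun X => (1 - expfun Theta X)%:E).
  by apply/measurable_EFinP; apply: measurable_funB => //; exact: measurable_expfun.
exact: ((measurable_restrictT _ mp).1 (measurable_funTS me)).
Qed.

Let integral_rho_f : (\int[rho]_X f X =
  (c * fine (laplace_exponent eta gamma_radial Theta))%:E)%E.
Proof.
rewrite integral_rho// [RHS]EFinM fineK ?gamma_exponent_fin//; congr (_ * _)%E.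
apply: eq_integral => X _; have [pX|nX] := pselect (pdmx d X).
  by rewrite /f patchE mem_set ?EFinM//; exact: pdmx_psdmx.
by rewrite levy_density_notin// mul0r mul0e.
Qed.

Lemma rho_laplace : (\int[rho]_(X in psdmx d) (1 - expR (- \tr (Theta *m X)))%:E =
  (c * fine (laplace_exponent eta gamma_radial Theta))%:E)%E.
Proof. by rewrite integral_mkcond -integral_rho_f. Qed.

Lemma angular_laplace : (\int[alpha]_(U in S) \int[leb]_(r in `]0%R, +oo[)
    ((1 - expR (- (r * \tr (Theta *m U)))) * (expR (- (1 * r)) / r))%:E =
  (c * fine (laplace_exponent eta gamma_radial Theta))%:E)%E.
Proof.
rewrite -integral_rho_f integral_rho_angular//; apply: eq_integral => U /set_mem[pU _].
apply: eq_integral => r /set_mem; rewrite /= in_itv/= andbT => r0.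
rewrite /f patchE mem_set; last by apply: psdmxZ => //; exact: ltW.
by rewrite -EFinM /expfun -scalemxAr mxtraceZ mul1r mulrC.
Qed.

End laplace_exponents.

Let gamma_law_divisible (P : probability M R) : P (~` psdmx d) = 0%E ->
  (forall Theta, psdmx d Theta -> laplace P Theta =
    (expR (- (c * fine (laplace_exponent eta gamma_radial Theta))))%:E) ->
  infinitely_divisible P.
Proof.
move=> P0 LP n n0; have cn : 0 < c / n%:R by rewrite divr_gt0// ltr0n.
have [Q [_ Q0 LQ]] := exists_gamma_law d_gt0 heta cn.
exists Q => A mA; rewrite conv_powE//.
have QnT : mpow Q n setT = 1%E.
  rewrite -[LHS]mul1e -integral_cst//.
  rewrite (_ : (\int[_]_x _)%E = (\int[mpow Q n]_x ((cst 1%R : M -> R) x)%:E)%E)//.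
  rewrite (@integral_mpow _ _ Q (cst 1) 1) ?expr1n//.
  - by apply/measurable_EFinP; exact: measurable_cst.
  - by move=> x y; rewrite /= mulr1.
  - by rewrite -[LHS]/(\int[Q]_x cst 1%E x)%E integral_cst// mul1e;
      exact: (probability_setT Q).
pose Qn : probability M R := probability_of_measure QnT.
have Qn0 : Qn (~` psdmx d) = 0%E.
  by apply: mpow_support => //; [exact: measurable_psdmx|exact: psdmx0|exact: psdmxD].
apply: (laplace_unique (Q := Qn) P0 Qn0) => // Theta pT; rewrite LP//.
rewrite [RHS](@integral_mpow _ _ Q (expfun Theta)
  (expR (- (c / n%:R * fine (laplace_exponent eta gamma_radial Theta)))) _ _ _ _ (LQ _ pT)).
- congr EFin; rewrite -expRM_natl; congr expR.
  by field; rewrite pnatr_eq0 -lt0n.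
- exact: expfun_ge0.
- by apply/measurable_EFinP; exact: measurable_expfun.
- exact: expfunr0.
- exact: expfunDr.
Qed.

Lemma matrix_gamma_law :
  exists (al : {finite_measure set M -> \bar R}) (beta : M -> R)
         (P : probability M R) (ro : {measure set M -> \bar R}),
    (matrix_gamma al beta P /\ homogeneous beta) /\
    P (~` pdmx d) = 0%E /\
    (forall U, trsphere d U -> beta U = 1) /\
    (forall A, measurable A ->
       al A = (\int[sphere_measure d]_(U in A `&` trsphere d)
         (c_const d eta omega *
          ((\det U) `^ eta / (\det U) `^ (d.+1%:R / 2)))%:E)%E) /\
    al (trsphere d) = omega%:E /\
    levy_measure_of P ro /\
    (forall E, measurable E -> ro E = gamma_levy al beta E) /\
    ro (~` pdmx d) = 0%E /\
    (forall E, measurable E ->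
       ro E = (\int[lebesgue_sym d]_(X in E `&` pdmx d)
                  (g_density eta omega X)%:E)%E) /\
    (forall E, measurable E -> E `<=` psdmx d ->
       ro E = ((c_const d eta omega)%:E *
         \int[sphere_measure d]_(U in trsphere d)
           ((\int[lebesgue_measure]_(r in `]0%R, +oo[)
               (\1_E (r *: U) * (expR (- r) / r))%:E) *
            ((\det U) `^ eta / (\det U) `^ (d.+1%:R / 2))%:E))%E).
Proof.
have [P [Ppd Ppsd LP]] := exists_gamma_law d_gt0 heta c_gt0.
exists alpha, (cst 1), P, rho; do ![split] => //.
- exact: angular_measure_off_sphere.
- exact: gamma_law_divisible.
- by move=> Theta pT; rewrite LP// angular_laplace.
- by exists 1.
- exact: angular_measure_sphere.
(* The drift is 0: the integral against [rho] is already the whole exponent. *)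
- exists 0; first exact: psdmx0.
  by move=> Theta pT; rewrite LP// mulmx0 linear0 add0e rho_laplace.
- by move=> E mE _; exact: rho_polar.
Qed.

End matrix_gamma_law.

Unset Implicit Arguments.

Theorem proposition5p5 (R : realType) (d : nat) (eta omega : R)
    (hd : (1 <= d)%N) (heta : (d%:R - 1) / 2 < eta) (homega : 0 < omega) :
  exists (alpha : {finite_measure set 'M[R]_d -> \bar R})
         (beta : 'M[R]_d -> R)
         (P : probability 'M[R]_d R)
         (rho : {measure set 'M[R]_d -> \bar R}),
    (matrix_gamma alpha beta P /\ homogeneous beta) /\
    P (~` pdmx d) = 0%E /\
    (forall U, trsphere d U -> beta U = 1) /\
    (forall A, measurable A ->
       alpha A = (\int[sphere_measure d]_(U in A `&` trsphere d)
         (c_const d eta omega *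
          ((\det U) `^ eta / (\det U) `^ (d.+1%:R / 2)))%:E)%E) /\
    alpha (trsphere d) = omega%:E /\
    levy_measure_of P rho /\
    (forall E, measurable E -> rho E = gamma_levy alpha beta E) /\
    rho (~` pdmx d) = 0%E /\
    (forall E, measurable E ->
       rho E = (\int[lebesgue_sym d]_(X in E `&` pdmx d)
                  (g_density eta omega X)%:E)%E) /\
    (forall E, measurable E -> E `<=` psdmx d ->
       rho E = ((c_const d eta omega)%:E *
         \int[sphere_measure d]_(U in trsphere d)
           ((\int[lebesgue_measure]_(r in `]0%R, +oo[)
               (\1_E (r *: U) * (expR (- r) / r))%:E) *
            ((\det U) `^ eta / (\det U) `^ (d.+1%:R / 2))%:E))%E).
Proof. exact: matrix_gamma_law. Qed.
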